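(* Let $\mathsf{k}$ be a field and let $E$ and $F$ be finite directed graphs with no sinks. Suppose there exists an order-preserving, pointed $\mathbb{Z}[x,x^{-1}]$-module homomorphism $\alpha:K_0^{\mathrm{gr}}(L_{\mathsf{k}}(E))\to K_0^{\mathrm{gr}}(L_{\mathsf{k}}(F))$. Then there exists a unital graded (ring) homomorphism $\psi:L_{\mathsf{k}}(E)\to L_{\mathsf{k}}(F)$ such that $K_0^{\mathrm{gr}}(\psi)=\alpha$.
   Context: A directed graph is $E=(E^0,E^1,r,s)$ with range and source maps $r,s:E^1\to E^0$; a sink is a vertex emitting no edge. For a finite graph $E$, the Leavitt path algebra $L_{\mathsf{k}}(E)$ is the universal $\mathsf{k}$-algebra generated by $\{v:v\in E^0\}\cup\{e,e^*:e\in E^1\}$ subject to: $v^2=v$, $vw=0$ for distinct $v,w\in E^0$; $s(e)e=e\,r(e)=e$, $r(e)e^*=e^*s(e)=e^*$; $e^*e=r(e)$ and $e^*f=0$ for distinct edges $e\ne f$; $v=\sum_{s(e)=v}ee^*$ for every $v$ that is not a sink. It is $\mathbb{Z}$-graded by $\deg v=0$, $\deg e=1$, $\deg e^*=-1$. For a $\mathbb{Z}$-graded unital ring $T$, $K_0^{\mathrm{gr}}(T)$ is the group completion of the monoid of graded isomorphism classes of finitely generated graded projective right $T$-modules under $\oplus$; its positive cone is the image of this monoid, and a homomorphism is order-preserving if it maps the positive cone into the positive cone. It is a $\mathbb{Z}[x,x^{-1}]$-module by $x\cdot[M]=[M(1)]$, where $M(1)_n=M_{n+1}$. A homomorphism $K_0^{\mathrm{gr}}(T)\to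 K_0^{\mathrm{gr}}(T')$ is pointed if it sends $[T]$ to $[T']$. A unital graded ring homomorphism $\psi:T\to T'$ induces $K_0^{\mathrm{gr}}(\psi)[X]=[X\otimes_\psi T']$. *)

(* Defs.v *)
From HB Require Import structures.
From mathcomp Require Import all_boot all_order all_algebra.
From mathcomp Require Import boolp classical_sets.

Set Implicit Arguments.
Unset Strict Implicit.
Unset Printing Implicit Defensive.

Import GRing.Theory.
Local Open Scope ring_scope.
Local Open Scope classical_set_scope.
Local Open Scope quotient_scope.

(* [V] is the internal direct sum of the subgroups [C n], n in Z. *)
Definition is_grading (V : zmodType) (C : int -> set V) : Prop :=
  [/\ forall n, C n 0 /\ forall x y, C n x -> C n y -> C n (x - y),
      forall x, exists (s : seq int) (f : int -> V),
        [/\ uniq s, forall n, C n (f n) & x = \sum_(n <- s) f n]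
    & forall (s : seq int) (f : int -> V), uniq s -> (forall n, C n (f n)) ->
        \sum_(n <- s) f n = 0 -> forall n, n \in s -> f n = 0].

Section Grading.
Variables (V : zmodType) (C : int -> set V).

Lemma is_gradingP (p : int -> V -> V) :
    (forall n, C n 0) ->
    (forall n x y, C n x -> C n y -> C n (x - y)) ->
    (forall n, {morph p n : x y / x + y}) ->
    (forall m n x, C m x -> p n x = if m == n then x else 0) ->
    (forall x, exists s : seq (int * V),
        (forall q, q \in s -> C q.1 q.2) /\ x = \sum_(q <- s) q.2) ->
  is_grading C.
Proof.
move=> C0 CB pD pC dec; have p0 n : p n 0 = 0.
  by apply: (addrI (p n 0)); rewrite -pD !addr0.
have pS n (I : eqType) (s : seq I) (f : I -> V) :
    p n (\sum_(i <- s) f i) = \sum_(i <- s) p n (f i).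
  by elim: s => [|i s IH]; rewrite ?big_nil // !big_cons pD IH.
have CS n (I : eqType) (s : seq I) (f : I -> V) :
    (forall i, i \in s -> C n (f i)) -> C n (\sum_(i <- s) f i).
  elim: s => [|i s IH] H; rewrite ?big_nil // big_cons -[X in _ + X]opprK.
  apply: (CB); first by apply: H; rewrite mem_head.
  rewrite -[- _]add0r; apply: (CB) => //; apply: IH => j js.
  by apply: H; rewrite in_cons js orbT.
split=> [n|x|s f us fC s0 n ns]; first by split=> // x y; apply: CB.
  have [s [sC ->]] := dec x; set y := \sum_(q <- s) q.2.
  exists (undup [seq q.1 | q <- s]), (fun n => p n y).
  split; first exact: undup_uniq.
    move=> n; rewrite /y pS; apply: CS => q qs.
    by rewrite (pC q.1 _ _ (sC q qs)); have [<-|_] := eqVneq q.1 n; [apply: sC|apply: C0].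
  under eq_bigr do rewrite /y pS.
  rewrite exchange_big /= {1}/y [LHS]big_seq [RHS]big_seq.
  apply: eq_bigr => q qs.
  rewrite (bigD1_seq q.1) ?undup_uniq ?mem_undup ?map_f //=.
  rewrite (pC q.1 _ _ (sC q qs)) eqxx big1 ?addr0 // => n nq.
  by rewrite (pC q.1 _ _ (sC q qs)) eq_sym (negPf nq).
have := congr1 (p n) s0; rewrite p0 pS (bigD1_seq n) //= (pC n _ _ (fC n)) eqxx.
rewrite big1 ?addr0 // => m mn; rewrite (pC m _ _ (fC m)).
by rewrite (negPf mn).
Qed.

Hypothesis gC : is_grading C.

Lemma grading0 n : C n 0. Proof. by case: gC => /(_ n)[]. Qed.

Lemma gradingB n x y : C n x -> C n y -> C n (x - y).
Proof. by case: gC => /(_ n)[_ + _ _]; apply. Qed.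

Lemma gradingN n x : C n x -> C n (- x).
Proof. by move=> Cx; rewrite -sub0r; apply: gradingB => //; apply: grading0. Qed.

Lemma gradingD n x y : C n x -> C n y -> C n (x + y).
Proof. by move=> Cx Cy; rewrite -[y]opprK; apply: gradingB => //; apply: gradingN. Qed.

Lemma grading_ind (P : V -> Prop) :
  P 0 -> (forall x y, P x -> P y -> P (x + y)) ->
  (forall n x, C n x -> P x) -> forall x, P x.
Proof.
move=> P0 PD PC x; case: gC => _ /(_ x)[s [f [_ fC ->]]] _.
by elim/big_ind: _ => // i _; apply: PC (fC i).
Qed.

Fact component_ex x : exists p : (int -> V) * seq int,
  [/\ forall n, C n (p.1 n), uniq p.2, forall n, n \notin p.2 -> p.1 n = 0
    & x = \sum_(n <- p.2) p.1 n].
Proof.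
case: gC => _ /(_ x)[s [f [us fC xE]]] _.
exists (fun n => if n \in s then f n else 0, s); split=> //= [n|n /negPf->//|].
  by case: ifP => // _; apply: grading0.
by rewrite xE [LHS]big_seq [RHS]big_seq; apply: eq_bigr => n ->.
Qed.

Definition component (n : int) (x : V) : V := (projT1 (cid (component_ex x))).1 n.

Definition grsupp (x : V) : seq int := (projT1 (cid (component_ex x))).2.

Lemma componentP n x : C n (component n x).
Proof. by rewrite /component; case: cid => p []. Qed.

Lemma grsupp_uniq x : uniq (grsupp x).
Proof. by rewrite /grsupp; case: cid => p []. Qed.

Lemma component_notin n x : n \notin grsupp x -> component n x = 0.
Proof. by rewrite /grsupp /component; case: cid => p [_ _ + _] /=; apply. Qed.

Lemma component_sum x : x = \sum_(n <- grsupp x) component n x.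
Proof. by rewrite /grsupp /component; case: cid => p [_ _ _ /=]. Qed.

Lemma component_sum_sub x (s : seq int) (W : zmodType) (F : int -> V -> W) :
  (forall n, F n 0 = 0) -> uniq s -> {subset grsupp x <= s} ->
  \sum_(n <- s) F n (component n x) = \sum_(n <- grsupp x) F n (component n x).
Proof.
move=> F0 us sub; rewrite (bigID (mem (grsupp x))) /= [X in _ + X]big1 ?addr0.
  rewrite -big_filter; apply: perm_big; apply: uniq_perm.
  - exact: filter_uniq.
  - exact: grsupp_uniq.
  by move=> n; rewrite mem_filter; case: (boolP (n \in grsupp x)) => //= /sub.
by move=> n /component_notin->.
Qed.

Lemma componentD n : {morph component n : x y / x + y}.
Proof.
move=> x y; pose s := undup (n :: grsupp x ++ grsupp y ++ grsupp (x + y)).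
have us : uniq s by apply: undup_uniq.
have sx z : {subset grsupp z <= grsupp x ++ grsupp y ++ grsupp (x + y)} ->
    z = \sum_(m <- s) component m z.
  move=> sub; rewrite (@component_sum_sub z s _ (fun _ => id)) //.
    exact: component_sum.
  by move=> m ms; rewrite mem_undup in_cons sub ?orbT.
case: gC => _ _ /(_ s
   (fun m => component m (x + y) - (component m x + component m y)) us) H.
suff /eqP : component n (x + y) - (component n x + component n y) = 0.
  by rewrite subr_eq0 => /eqP.
apply: H; last by rewrite mem_undup mem_head.
  by move=> m; apply: gradingB; [|apply: gradingD]; apply: componentP.
rewrite big_split sumrN big_split /= -!sx ?subrr //;
  by move=> m; rewrite !mem_cat => ->; rewrite ?orbT.
Qed.

Lemma component_homog m n x : C m x -> component n x = if m == n then x else 0.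
Proof.
move=> Cx; pose s := undup (n :: m :: grsupp x).
have us : uniq s by apply: undup_uniq.
case: gC => _ _ /(_ s
   (fun i => component i x - (if m == i then x else 0)) us) H.
suff /eqP : component n x - (if m == n then x else 0) = 0.
  by rewrite subr_eq0 => /eqP.
apply: H; last by rewrite mem_undup mem_head.
  move=> i; apply: gradingB; first exact: componentP.
  by have [<-|_] := eqVneq m i => //; apply: grading0.
rewrite sumrB (@component_sum_sub x s _ (fun _ => id)) //; last first.
  by move=> i ix; rewrite mem_undup !in_cons ix !orbT.
rewrite -component_sum (bigD1_seq m) //=; last first.
  by rewrite mem_undup !in_cons eqxx !orbT.
rewrite eqxx big1 ?addr0 ?subrr // => i im.
by rewrite eq_sym (negPf im).
Qed.

Lemma component0 n : component n 0 = 0.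
Proof.
by rewrite (@component_homog n) ?if_same //; apply: grading0.
Qed.

(* \sum_n F n (x_n), x_n being the degree n component of x *)
Definition grsum (W : zmodType) (F : int -> V -> W) (x : V) : W :=
  \sum_(n <- grsupp x) F n (component n x).

Lemma grsumD (W : zmodType) (F : int -> V -> W) :
  (forall n, {morph F n : x y / x + y}) -> {morph grsum F : x y / x + y}.
Proof.
move=> FD x y; have F0 n : F n 0 = 0.
  by apply: (addrI (F n 0)); rewrite -FD !addr0.
pose s := undup (grsupp x ++ grsupp y ++ grsupp (x + y)).
have us : uniq s by apply: undup_uniq.
have sx z : {subset grsupp z <= grsupp x ++ grsupp y ++ grsupp (x + y)} ->
    grsum F z = \sum_(m <- s) F m (component m z).
  move=> sub; rewrite component_sum_sub //.
  by move=> m ms; rewrite mem_undup sub.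
rewrite !sx; first by rewrite -big_split; apply: eq_bigr => n _; rewrite componentD FD.
all: by move=> m; rewrite !mem_cat => ->; rewrite ?orbT.
Qed.

Lemma grsum_homog (W : zmodType) (F : int -> V -> W) m x :
  (forall n, F n 0 = 0) -> C m x -> grsum F x = F m x.
Proof.
move=> F0 Cx; rewrite /grsum.
rewrite -(@component_sum_sub x (undup (m :: grsupp x))) ?undup_uniq //; last first.
  by move=> n nx; rewrite mem_undup in_cons nx orbT.
rewrite (bigD1_seq m) ?undup_uniq ?mem_undup ?mem_head //=.
rewrite (component_homog _ Cx) eqxx big1 ?addr0 // => n nm.
by rewrite (component_homog _ Cx) eq_sym (negPf nm).
Qed.

End Grading.

(* Rings are [pzRingType]s: the Leavitt path algebra of the empty graph is 0. *)
Record grRing := GrRing {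
  gr_ring :> pzRingType;
  gr_part : int -> set gr_ring;
  gr_grading : is_grading gr_part;
  gr_one : gr_part 0 1;
  gr_mul : forall m n x y,
    gr_part m x -> gr_part n y -> gr_part (m + n) (x * y)
}.

Record grRHom (T T' : grRing) := GrRHom {
  rhom_fun :> {rmorphism T -> T'};
  rhom_deg : forall n x, gr_part n x -> gr_part n (rhom_fun x)
}.

(* Right T-modules are left modules over the converse ring T^c, so that the
   product x.t is written [(t : T^c) *: x]. *)
Record grMod (T : grRing) := GrMod {
  gm_mod :> lmodType T^c;
  gm_part : int -> set gm_mod;
  gm_grading : is_grading gm_part;
  gm_act : forall m n (x : gm_mod) (t : T),
    gm_part m x -> gr_part n t -> gm_part (m + n) ((t : T^c) *: x)
}.

Record grHom (T : grRing) (M N : grMod T) := GrHom {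
  hom_fun :> {linear M -> N};
  hom_deg : forall n x, gm_part n x -> gm_part n (hom_fun x)
}.

Definition grIso (T : grRing) (M N : grMod T) : Prop :=
  exists (f : grHom M N) (g : grHom N M), cancel f g /\ cancel g f.

Definition fin_gen (T : grRing) (M : grMod T) : Prop :=
  exists (n : nat) (g : 'I_n -> M), forall x,
    exists c : 'I_n -> T, x = \sum_(i < n) (c i : T^c) *: g i.

(* Projective objects of the category of graded modules. *)
Definition gr_projective (T : grRing) (M : grMod T) : Prop :=
  forall (A B : grMod T) (g : grHom A B) (f : grHom M B),
    (forall b, exists a, g a = b) ->
    exists h : grHom M A, forall x, g (h x) = f x.

Record fgProj (T : grRing) := FgProj {
  fgp_mod :> grMod T;
  fgp_fin_gen : fin_gen fgp_mod;
  fgp_proj : gr_projective fgp_mod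
}.

Section GrModTheory.
Variable T : grRing.
Implicit Types (M N P : grMod T).

Lemma scaler_conv (M : lmodType T^c) (s t : T) (x : M) :
  (t : T^c) *: ((s : T^c) *: x) = ((s * t : T) : T^c) *: x.
Proof. by rewrite scalerA. Qed.

Definition mkHom M N (f : M -> N) (flin : linear f)
    (fdeg : forall n x, gm_part n x -> gm_part n (f x)) : grHom M N :=
  let lin := GRing.isLinear.Build T^c M N *:%R f flin in
  @GrHom T M N (HB.pack_for {linear M -> N} f lin) fdeg.

Lemma mkHomE M N f flin fdeg x : @mkHom M N f flin fdeg x = f x.
Proof. by []. Qed.

Definition idHom M : grHom M M :=
  @GrHom T M M (@idfun M : {linear M -> M}) (fun _ _ h => h).

Definition compHom M N P (g : grHom N P) (f : grHom M N) : grHom M P :=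
  @GrHom T M P (g \o f : {linear M -> P})
    (fun n x h => hom_deg g (hom_deg f h)).

Lemma compHomE M N P (g : grHom N P) (f : grHom M N) x :
  compHom g f x = g (f x).
Proof. by []. Qed.

Lemma grIso_refl M : grIso M M.
Proof. by exists (idHom M), (idHom M). Qed.

Lemma grIso_sym M N : grIso M N -> grIso N M.
Proof. by case=> f [g [fK gK]]; exists g, f. Qed.

Lemma grIso_trans M N P : grIso M N -> grIso N P -> grIso M P.
Proof.
move=> [f [g [fK gK]]] [f' [g' [fK' gK']]].
exists (compHom f' f), (compHom g g').
by split=> x /=; rewrite ?fK' ?gK // ?gK.
Qed.

Lemma hom_component M N (f : grHom M N) n x :
  component (gm_grading N) n (f x) = f (component (gm_grading M) n x).
Proof.
elim/(grading_ind (gm_grading M)): x => [|x y|m x Cx].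
- by rewrite linear0 !component0 linear0.
- by rewrite linearD !componentD linearD => -> ->.
- rewrite (component_homog _ _ Cx) (component_homog _ _ (hom_deg f Cx)).
  by case: eqP => // _; rewrite linear0.
Qed.

End GrModTheory.

Section Constructions.
Variable T : grRing.
Implicit Types (M N P : grMod T).

Fact zeroM_grading : is_grading (fun _ : int => [set: 'rV[T^c]_0]).
Proof.
have z (x y : 'rV[T^c]_0) : x = y by apply/rowP => [[]].
apply: (@is_gradingP _ _ (fun _ => id)) => // x.
by exists [::]; split.
Qed.

Definition zeroM : grMod T :=
  @GrMod T 'rV[T^c]_0 _ zeroM_grading (fun _ _ _ _ _ _ => Logic.I).

Lemma zeroM_eq (x y : zeroM) : x = y.
Proof. by apply/rowP => [[]]. Qed.

Fact zeroM_fg : fin_gen zeroM.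
Proof. by exists 0, (fun=> 0) => x; exists (fun=> 0); apply: zeroM_eq. Qed.

Definition zeroHom (M N : grMod T) : grHom M N :=
  @mkHom T M N (fun=> 0) (fun a u v => esym (etrans (addr0 _) (scaler0 _ a)))
    (fun n _ _ => grading0 (gm_grading N) n).

Fact zeroM_proj : gr_projective zeroM.
Proof.
move=> A B g f _; exists (zeroHom zeroM A) => x.
by rewrite (zeroM_eq x 0) !linear0.
Qed.

Definition zeroP : fgProj T := FgProj zeroM_fg zeroM_proj.

Definition sum_part (M N : grMod T) (n : int) : set (M * N)%type :=
  [set x | gm_part n x.1 /\ gm_part n x.2].

Fact sum_grading M N : is_grading (@sum_part M N).
Proof.
apply: (@is_gradingP _ _ (fun n x =>
  (component (gm_grading M) n x.1, component (gm_grading N) n x.2))).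
- by move=> n; split; apply: grading0; apply: gm_grading.
- by move=> n x y [x1 x2] [y1 y2]; split; apply: gradingB => //; apply: gm_grading.
- by move=> n x y /=; rewrite !componentD.
- move=> m n [x y] [/= Cx Cy].
  rewrite (component_homog _ _ Cx) (component_homog _ _ Cy).
  by case: eqP.
- move=> [x y].
  exists ([seq (n, (component (gm_grading M) n x, 0)) |
             n <- grsupp (gm_grading M) x] ++
          [seq (n, (0, component (gm_grading N) n y)) |
             n <- grsupp (gm_grading N) y]); split.
    move=> q; rewrite mem_cat => /orP[] /mapP[n _ ->] /=;
    by split; solve [exact: componentP | apply: grading0; apply: gm_grading].
  rewrite big_cat !big_map /=.
  rewrite {1}(component_sum (gm_grading M) x) {1}(component_sum (gm_grading N) y).
  rewrite -[LHS]/(_, _).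
  have -> : \sum_(n <- grsupp (gm_grading M) x)
     (component (gm_grading M) n x, 0 : N) =
     (\sum_(n <- grsupp (gm_grading M) x) component (gm_grading M) n x, 0).
    by elim/big_rec2: _ => // i a b _ ->; rewrite -[LHS]/(_, _) addr0.
  have -> : \sum_(n <- grsupp (gm_grading N) y)
     (0 : M, component (gm_grading N) n y) =
     (0, \sum_(n <- grsupp (gm_grading N) y) component (gm_grading N) n y).
    by elim/big_rec2: _ => // i a b _ ->; rewrite -[LHS]/(_, _) addr0.
  by rewrite -[RHS]/(_, _) /= addr0 add0r.
Qed.

Fact sum_act M N m n (x : (M * N)%type) (t : T) :
  sum_part m x -> gr_part n t -> sum_part (m + n) ((t : T^c) *: x).
Proof. by move=> [x1 x2] Ct; split; apply: gm_act. Qed.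

Definition sumM (M N : grMod T) : grMod T :=
  @GrMod T (M * N)%type _ (sum_grading M N) (@sum_act M N).

Fact sumM_fg M N : fin_gen M -> fin_gen N -> fin_gen (sumM M N).
Proof.
move=> [m [g gP]] [n [h hP]].
exists (m + n)%N, (fun i => match split i with
  inl j => (g j, 0) | inr j => (0, h j) end).
move=> [x y]; have [c ->] := gP x; have [d ->] := hP y.
exists (fun i => match split i with inl j => c j | inr j => d j end).
rewrite big_split_ord /=.
under [X in _ = X + _]eq_bigr => i _ do rewrite (unsplitK (inl i)).
under [X in _ = _ + X]eq_bigr => i _ do rewrite (unsplitK (inr i)).
have -> : \sum_(i < m) (c i : T^c) *: ((g i, 0) : (M * N)%type) =
          (\sum_(i < m) (c i : T^c) *: g i, 0).
  by elim/big_rec2: _ => // i a b _ ->; rewrite -[LHS]/(_, _) /= scaler0 addr0.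
have -> : \sum_(i < n) (d i : T^c) *: ((0, h i) : (M * N)%type) =
          (0, \sum_(i < n) (d i : T^c) *: h i).
  by elim/big_rec2: _ => // i a b _ ->; rewrite -[LHS]/(_, _) /= scaler0 addr0.
by rewrite -[RHS]/(_, _) /= addr0 add0r.
Qed.

Definition inlHom M N : grHom M (sumM M N).
Proof.
apply: (@mkHom T M (sumM M N) (fun x => (x, 0))) => [a u v|n x Cx].
  by rewrite -[RHS]/(_, _) /= scaler0 addr0.
by split=> //; apply: grading0; apply: gm_grading.
Defined.

Definition inrHom M N : grHom N (sumM M N).
Proof.
apply: (@mkHom T N (sumM M N) (fun x => (0, x))) => [a u v|n x Cx].
  by rewrite -[RHS]/(_, _) /= scaler0 addr0.
by split=> //; apply: grading0; apply: gm_grading.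
Defined.

Definition copairHom M N P (f : grHom M P) (g : grHom N P) : grHom (sumM M N) P.
Proof.
apply: (@mkHom T (sumM M N) P (fun x => f x.1 + g x.2)) => [a u v|n x [C1 C2]].
  by rewrite /= !linearP scalerDr addrACA.
by apply: gradingD; [apply: gm_grading|apply: hom_deg..].
Defined.

Lemma inlHomE M N x : inlHom M N x = (x, 0). Proof. by []. Qed.
Lemma inrHomE M N x : inrHom M N x = (0, x). Proof. by []. Qed.
Lemma copairHomE M N P (f : grHom M P) (g : grHom N P) x :
  copairHom f g x = f x.1 + g x.2.
Proof. by []. Qed.

Lemma sumM_addE M N (a c : M) (b d : N) :
  ((a, b) : sumM M N) + (c, d) = (a + c, b + d).
Proof. by []. Qed.

Fact sumM_proj M N :
  gr_projective M -> gr_projective N -> gr_projective (sumM M N).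
Proof.
move=> pM pN A B g f gs.
have [h hP] := pM A B g (compHom f (inlHom M N)) gs.
have [h' hP'] := pN A B g (compHom f (inrHom M N)) gs.
exists (copairHom h h') => -[x y] /=.
rewrite linearD hP hP' /= -linearD; congr (f _).
by rewrite -[LHS]/(_, _) /= addr0 add0r.
Qed.

Definition sumP (M N : fgProj T) : fgProj T :=
  FgProj (sumM_fg (fgp_fin_gen M) (fgp_fin_gen N))
         (sumM_proj (@fgp_proj T M) (@fgp_proj T N)).

Lemma sumM_iso M M' N N' :
  grIso M M' -> grIso N N' -> grIso (sumM M N) (sumM M' N').
Proof.
move=> [f [f' [fK fK']]] [g [g' [gK gK']]].
exists (copairHom (compHom (inlHom M' N') f) (compHom (inrHom M' N') g)).
exists (copairHom (compHom (inlHom M N) f') (compHom (inrHom M N) g')).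
by split=> -[x y] /=; rewrite -[LHS]/(_, _) /= !(addr0, add0r, fK, fK', gK, gK').
Qed.

Lemma sumM_isoC M N : grIso (sumM M N) (sumM N M).
Proof.
exists (copairHom (inrHom N M) (inlHom N M)).
exists (copairHom (inrHom M N) (inlHom M N)).
by split=> -[x y] /=; rewrite -[LHS]/(_, _) /= !(addr0, add0r).
Qed.

Lemma sumM_isoA M N P : grIso (sumM M (sumM N P)) (sumM (sumM M N) P).
Proof.
exists (copairHom (compHom (inlHom _ P) (inlHom M N))
  (copairHom (compHom (inlHom _ P) (inrHom M N)) (inrHom _ P))).
exists (copairHom (copairHom (inlHom M _) (compHom (inrHom M _) (inlHom N P)))
  (compHom (inrHom M _) (inrHom N P))).
have pairD (A B : zmodType) (a c : A) (b d : B) :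
  ((a, b) : A * B) + (c, d) = (a + c, b + d) by [].
by split=> [[x [y z]]|[[x y] z]]; rewrite /= !pairD /= !(addr0, add0r).
Qed.

Lemma sumM_iso0 M : grIso (sumM zeroM M) M.
Proof.
exists (copairHom (zeroHom _ _) (idHom M)), (inrHom _ _).
split=> [[x y]|x] /=; last by rewrite add0r.
by rewrite add0r; congr pair; apply: zeroM_eq.
Qed.

(* M(n)_m = M_(n + m) *)
Definition shift_part (n : int) (M : grMod T) (m : int) : set M :=
  gm_part (n + m).

Fact shift_grading n M : is_grading (@shift_part n M).
Proof.
apply: (@is_gradingP _ _ (fun m => component (gm_grading M) (n + m))).
- by move=> m; apply: (grading0 (gm_grading M)).
- by move=> m x y; apply: (gradingB (gm_grading M)).
- by move=> m; apply: componentD.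
- move=> m p x Cx.
  rewrite (component_homog (gm_grading M) _ (Cx : gm_part (n + m) x)).
  by rewrite (inj_eq (addrI n)).
- move=> x.
  exists [seq (m - n, component (gm_grading M) m x) | m <- grsupp (gm_grading M) x].
  split; last by rewrite big_map /=; apply: component_sum.
  move=> q /mapP[m _ ->] /=; rewrite /shift_part addrC subrK.
  exact: componentP.
Qed.

Fact shift_act n M p m (x : M) (t : T) :
  shift_part n p x -> gr_part m t -> shift_part n (p + m) ((t : T^c) *: x).
Proof. by rewrite /shift_part addrA => Cx Ct; apply: gm_act. Qed.

Definition shiftM (n : int) (M : grMod T) : grMod T :=
  @GrMod T M _ (shift_grading n M) (@shift_act n M).

Fact shiftM_proj n M : gr_projective M -> gr_projective (shiftM n M).
Proof.
move=> pM A B g f gs.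
have fd m (x : M) : gm_part m x -> @gm_part T (shiftM (- n) B) m (f x).
  move=> Cx; apply: hom_deg; rewrite /= /shift_part addrA subrr add0r; exact: Cx.
have gd m (x : A) : @gm_part T (shiftM (- n) A) m x ->
    @gm_part T (shiftM (- n) B) m (g x) by exact: (@hom_deg T A B g (- n + m)).
have [h hP] := pM (shiftM (- n) A) (shiftM (- n) B)
  (@GrHom T (shiftM (- n) A) (shiftM (- n) B) (hom_fun g) gd)
  (@GrHom T M (shiftM (- n) B) (hom_fun f) fd) gs.
have hd m (x : shiftM n M) : gm_part m x -> @gm_part T A m (h x).
  move=> Cx; have := hom_deg h (Cx : @gm_part T M (n + m) x).
  by rewrite /= /shift_part addrA addNr add0r.
by exists (@GrHom T (shiftM n M) A (hom_fun h) hd).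
Qed.

Definition shiftP (n : int) (M : fgProj T) : fgProj T :=
  @FgProj T (shiftM n M) (fgp_fin_gen M) (shiftM_proj (@fgp_proj T M)).

Lemma shiftM_iso n M N : grIso M N -> grIso (shiftM n M) (shiftM n N).
Proof.
move=> [f [g [fK gK]]].
exists (@GrHom T (shiftM n M) (shiftM n N) (hom_fun f) (fun m => @hom_deg T _ _ f (n + m))).
by exists (@GrHom T (shiftM n N) (shiftM n M) (hom_fun g) (fun m => @hom_deg T _ _ g (n + m))).
Qed.

Lemma shiftM_sum n M N :
  grIso (shiftM n (sumM M N)) (sumM (shiftM n M) (shiftM n N)).
Proof.
exists (@GrHom T (shiftM n (sumM M N)) (sumM (shiftM n M) (shiftM n N))
   (@idfun (M * N)%type : {linear _ -> _}) (fun _ _ h => h)).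
by exists (@GrHom T (sumM (shiftM n M) (shiftM n N)) (shiftM n (sumM M N))
   (@idfun (M * N)%type : {linear _ -> _}) (fun _ _ h => h)).
Qed.

Lemma shiftM0 M : grIso (shiftM 0 M) M.
Proof.
have d m (x : M) : @gm_part T (shiftM 0 M) m x <-> gm_part m x.
  by rewrite /= /shift_part add0r.
exists (@GrHom T (shiftM 0 M) M (@idfun M : {linear _ -> _}) (fun m x => (d m x).1)).
by exists (@GrHom T M (shiftM 0 M) (@idfun M : {linear _ -> _}) (fun m x => (d m x).2)).
Qed.

Lemma shiftMD n p M : grIso (shiftM n (shiftM p M)) (shiftM (n + p) M).
Proof.
have d m (x : M) :
    @gm_part T (shiftM n (shiftM p M)) m x <-> @gm_part T (shiftM (n + p) M) m x.
  by rewrite /= /shift_part /= /shift_part addrA [p + n]addrC.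
exists (@GrHom T (shiftM n (shiftM p M)) (shiftM (n + p) M)
   (@idfun M : {linear _ -> _}) (fun m x => (d m x).1)).
by exists (@GrHom T (shiftM (n + p) M) (shiftM n (shiftM p M))
   (@idfun M : {linear _ -> _}) (fun m x => (d m x).2)).
Qed.

Fact regular_grading : @is_grading (T^c)^o (@gr_part T).
Proof. exact: (gr_grading T). Qed.

Fact regular_act m n (x : (T^c)^o) (t : T) :
  @gr_part T m x -> gr_part n t -> @gr_part T (m + n) ((t : T^c) *: x).
Proof. exact: gr_mul. Qed.

Definition regularM : grMod T := @GrMod T (T^c)^o _ regular_grading regular_act.

Fact regularM_fg : fin_gen regularM.
Proof.
exists 1%N, (fun=> (1 : T)) => x; exists (fun=> x).
by rewrite big_ord1 -[RHS]/((1 : T) * (x : T)) mul1r.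
Qed.

Fact regularM_proj : gr_projective regularM.
Proof.
move=> A B g f gs; have [a ga] := gs (f (1 : T)).
pose a0 := component (gm_grading A) 0 a.
have ga0 : g a0 = f (1 : T).
  rewrite -hom_component ga hom_component (@component_homog _ _ _ 0) //.
  exact: gr_one.
have lin : linear (fun t : regularM => (t : T^c) *: a0).
  by move=> c u v; rewrite scalerDl -scalerA.
have deg n (t : regularM) : gm_part n t -> gm_part n ((t : T^c) *: a0).
  by move=> Ct; rewrite -[n]add0r; apply: gm_act => //; apply: componentP.
exists (mkHom lin deg) => x; rewrite mkHomE linearZ /= ga0 -linearZ.
by congr (f _); rewrite -[LHS]/((1 : T) * (x : T)) mul1r.
Qed.

Definition regularP : fgProj T := FgProj regularM_fg regularM_proj.

End Constructions.

(* X ⊗_psi T' is the abelian group presented by the symbols x ⊗ t subject to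
   biadditivity and x.r ⊗ t = x ⊗ psi(r) t. *)
Section TensorDef.
Variables (T T' : grRing) (psi : grRHom T T') (X : grMod T).

Inductive tterm :=
| TTens of X & T'
| TZero
| TAdd of tterm & tterm
| TOpp of tterm.

Inductive tcongr : tterm -> tterm -> Prop :=
| tc_refl a : tcongr a a
| tc_sym a b : tcongr a b -> tcongr b a
| tc_trans a b c : tcongr a b -> tcongr b c -> tcongr a c
| tc_add a a' b b' : tcongr a a' -> tcongr b b' -> tcongr (TAdd a b) (TAdd a' b')
| tc_opp a a' : tcongr a a' -> tcongr (TOpp a) (TOpp a')
| tc_addA a b c : tcongr (TAdd a (TAdd b c)) (TAdd (TAdd a b) c)
| tc_addC a b : tcongr (TAdd a b) (TAdd b a)
| tc_add0 a : tcongr (TAdd TZero a) a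
| tc_addN a : tcongr (TAdd (TOpp a) a) TZero
| tc_tensDl x y t : tcongr (TTens (x + y) t) (TAdd (TTens x t) (TTens y t))
| tc_tensDr x s t : tcongr (TTens x (s + t)) (TAdd (TTens x s) (TTens x t))
| tc_bal x (r : T) t : tcongr (TTens ((r : T^c) *: x) t) (TTens x (psi r * t)).

Definition trel (a b : {classic tterm}) : bool := `[< tcongr a b >].

Fact trel_refl : reflexive trel.
Proof. by move=> a; apply/asboolP; apply: tc_refl. Qed.

Fact trel_sym : symmetric trel.
Proof. by move=> a b; apply/asboolP/asboolP => /tc_sym. Qed.

Fact trel_trans : transitive trel.
Proof. by move=> b a c /asboolP ab /asboolP bc; apply/asboolP; apply: tc_trans bc. Qed.

Canonical trel_equiv := EquivRel trel trel_refl trel_sym trel_trans.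

Definition tensor : Type := {eq_quot trel_equiv}.
HB.instance Definition _ := Choice.on tensor.

Definition tpi (a : tterm) : tensor := \pi_({eq_quot trel_equiv}) (a : {classic tterm}).
Definition trepr (x : tensor) : tterm := repr (x : {eq_quot trel_equiv}).

Lemma treprK x : tpi (trepr x) = x. Proof. exact: reprK. Qed.

Lemma tpiP a b : tpi a = tpi b <-> tcongr a b.
Proof.
split=> [/eqmodP/asboolP//|ab]; apply/eqmodP; exact/asboolP.
Qed.

Lemma treprP a : tcongr (trepr (tpi a)) a.
Proof. by apply/tpiP; rewrite treprK. Qed.

Definition tzero : tensor := tpi TZero.
Definition tadd (x y : tensor) : tensor := tpi (TAdd (trepr x) (trepr y)).
Definition topp (x : tensor) : tensor := tpi (TOpp (trepr x)).

Lemma tadd_pi a b : tadd (tpi a) (tpi b) = tpi (TAdd a b).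
Proof. by apply/tpiP; apply: tc_add; apply: treprP. Qed.

Lemma topp_pi a : topp (tpi a) = tpi (TOpp a).
Proof. by apply/tpiP; apply: tc_opp; apply: treprP. Qed.

Fact taddA : associative tadd.
Proof.
move=> x y z; rewrite -(treprK x) -(treprK y) -(treprK z) !tadd_pi.
by apply/tpiP; apply: tc_addA.
Qed.

Fact taddC : commutative tadd.
Proof.
move=> x y; rewrite -(treprK x) -(treprK y) !tadd_pi.
by apply/tpiP; apply: tc_addC.
Qed.

Fact tadd0 : left_id tzero tadd.
Proof. by move=> x; rewrite -(treprK x) tadd_pi; apply/tpiP; apply: tc_add0. Qed.

Fact taddN : left_inverse tzero topp tadd.
Proof.
by move=> x; rewrite -(treprK x) topp_pi tadd_pi; apply/tpiP; apply: tc_addN.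
Qed.

HB.instance Definition _ := GRing.isZmodule.Build tensor taddA taddC tadd0 taddN.

Lemma tpiD a b : tpi (TAdd a b) = tpi a + tpi b.
Proof. by rewrite -tadd_pi. Qed.

Lemma tpiN a : tpi (TOpp a) = - tpi a.
Proof. by rewrite -topp_pi. Qed.

Definition tens (x : X) (t : T') : tensor := tpi (TTens x t).

Lemma tensDl x y t : tens (x + y) t = tens x t + tens y t.
Proof. by rewrite -tpiD; apply/tpiP; apply: tc_tensDl. Qed.

Lemma tensDr x s t : tens x (s + t) = tens x s + tens x t.
Proof. by rewrite -tpiD; apply/tpiP; apply: tc_tensDr. Qed.

Lemma tens_bal x (r : T) t : tens ((r : T^c) *: x) t = tens x (psi r * t).
Proof. by apply/tpiP; apply: tc_bal. Qed.

Lemma tens0l t : tens 0 t = 0.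
Proof. by apply: (addrI (tens 0 t)); rewrite -tensDl !addr0. Qed.

Lemma tens0r x : tens x 0 = 0.
Proof. by apply: (addrI (tens x 0)); rewrite -tensDr !addr0. Qed.

Lemma tensNl x t : tens (- x) t = - tens x t.
Proof. by apply/eqP; rewrite -addr_eq0 -tensDl addNr tens0l. Qed.

Lemma tens_ind (P : tensor -> Prop) :
  P 0 -> (forall x y, P x -> P y -> P (x + y)) ->
  (forall x t, P (tens x t)) -> forall x, P x.
Proof.
move=> P0 PD PT x; rewrite -(treprK x).
suff [] : P (tpi (trepr x)) /\ P (- tpi (trepr x)) by [].
elim: (trepr x) => [y t||a [Pa Na] b [Pb Nb]|a [Pa Na]].
- by split; [|rewrite -[- _]/(- tens y t) -tensNl]; apply: PT.
- by split; rewrite -[tpi TZero]/(0 : tensor) ?oppr0.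
- by rewrite tpiD opprD; split; apply: PD.
- by rewrite tpiN opprK.
Qed.

Section Lift.
Variables (Z : zmodType) (f : X -> T' -> Z).
Hypothesis fDl : forall x y t, f (x + y) t = f x t + f y t.
Hypothesis fDr : forall x s t, f x (s + t) = f x s + f x t.
Hypothesis fbal : forall x (r : T) t, f ((r : T^c) *: x) t = f x (psi r * t).

Fixpoint tlift_term (a : tterm) : Z :=
  match a with
  | TTens x t => f x t
  | TZero => 0
  | TAdd a b => tlift_term a + tlift_term b
  | TOpp a => - tlift_term a
  end.

Definition tlift (x : tensor) : Z := tlift_term (trepr x).

Lemma tlift_congr a b : tcongr a b -> tlift_term a = tlift_term b.
Proof.
move=> ab; elim: a b / ab => //=.
- by move=> b c d _ -> _.
- by move=> b b' c c' _ -> _ ->.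
- by move=> b b' _ ->.
- by move=> b c d; apply: addrA.
- by move=> b c; apply: addrC.
- by move=> b; apply: add0r.
- by move=> b; apply: addNr.
Qed.

Lemma tlift_pi a : tlift (tpi a) = tlift_term a.
Proof. exact/tlift_congr/treprP. Qed.

Lemma tlift_tens x t : tlift (tens x t) = f x t.
Proof. exact: tlift_pi. Qed.

Lemma tliftD : {morph tlift : x y / x + y}.
Proof.
move=> x y; rewrite -(treprK x) -(treprK y).
by rewrite -tpiD !tlift_pi.
Qed.

Lemma tlift0 : tlift 0 = 0.
Proof. exact: tlift_pi. Qed.

End Lift.

Section Action.
Variable t : T'.

Definition tact : tensor -> tensor := tlift (fun x s => tens x (s * t)).

Lemma tact_tens x s : tact (tens x s) = tens x (s * t).
Proof.
apply: tlift_tens => [y z u|y u v|y r u]; first exact: tensDl.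
  by rewrite mulrDl tensDr.
by rewrite tens_bal mulrA.
Qed.

Lemma tactD : {morph tact : x y / x + y}.
Proof.
apply: tliftD => [y z u|y u v|y r u]; first exact: tensDl.
  by rewrite mulrDl tensDr.
by rewrite tens_bal mulrA.
Qed.

Lemma tact0 : tact 0 = 0.
Proof. by apply: (addrI (tact 0)); rewrite -tactD !addr0. Qed.

End Action.

Definition tscale (t : T'^c) (x : tensor) : tensor := tact t x.

Fact tscaleA (a b : T'^c) x : tscale a (tscale b x) = tscale (a * b) x.
Proof.
rewrite /tscale; elim/tens_ind: x => [|x y IHx IHy|x t].
- by rewrite !tact0.
- by rewrite !tactD IHx IHy.
- by rewrite !tact_tens -mulrA.
Qed.

Fact tscale1 : left_id 1 tscale.
Proof.
rewrite /tscale; elim/tens_ind => [|x y IHx IHy|x t].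
- by rewrite !tact0.
- by rewrite !tactD IHx IHy.
- by rewrite !tact_tens mulr1.
Qed.

Fact tscaleDr : right_distributive tscale +%R.
Proof. by move=> a x y; apply: tactD. Qed.

Fact tscaleDl v : {morph tscale^~ v : a b / a + b}.
Proof.
move=> a b; rewrite /tscale; elim/tens_ind: v => [|x y IHx IHy|x t].
- by rewrite !tact0 addr0.
- by rewrite !tactD IHx IHy addrACA.
- by rewrite !tact_tens mulrDr tensDr.
Qed.

HB.instance Definition _ :=
  GRing.Zmodule_isLmodule.Build T'^c tensor tscaleA tscale1 tscaleDr tscaleDl.

Lemma tens_act x s (t : T') : (t : T'^c) *: tens x s = tens x (s * t).
Proof. exact: tact_tens. Qed.

(* The degree n part is spanned by the x ⊗ t with deg x + deg t = n. *)
Inductive tensor_part (n : int) : set tensor :=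
| tpart0 : tensor_part n 0
| tpartB x y : tensor_part n x -> tensor_part n y -> tensor_part n (x - y)
| tpart_tens i j x t : gm_part i x -> gr_part j t -> i + j = n ->
    tensor_part n (tens x t).

Lemma tpartN n x : tensor_part n x -> tensor_part n (- x).
Proof. by move=> px; rewrite -sub0r; apply: tpartB => //; apply: tpart0. Qed.

Lemma tpartD n x y : tensor_part n x -> tensor_part n y -> tensor_part n (x + y).
Proof. by move=> px py; rewrite -[y]opprK; apply/tpartB/tpartN. Qed.

Definition tproj_fun (n : int) (x : X) (t : T') : tensor :=
  grsum (gm_grading X) (fun i y => tens y (component (gr_grading T') (n - i) t)) x.

Lemma tproj_funDl n x y t : tproj_fun n (x + y) t = tproj_fun n x t + tproj_fun n y t.
Proof. by apply: grsumD => i u v; apply: tensDl. Qed.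

Lemma tproj_funDr n x s t : tproj_fun n x (s + t) = tproj_fun n x s + tproj_fun n x t.
Proof.
rewrite /tproj_fun /grsum -big_split; apply: eq_bigr => i _.
by rewrite componentD tensDr.
Qed.

Lemma tproj_fun_homog n i x t : gm_part i x ->
  tproj_fun n x t = tens x (component (gr_grading T') (n - i) t).
Proof. by move=> Cx; rewrite /tproj_fun (grsum_homog _ _ Cx) // => j; apply: tens0l. Qed.

Lemma tproj_fun0l n t : tproj_fun n 0 t = 0.
Proof. by apply: (addrI (tproj_fun n 0 t)); rewrite -tproj_funDl !addr0. Qed.

Lemma tproj_fun0r n x : tproj_fun n x 0 = 0.
Proof. by apply: (addrI (tproj_fun n x 0)); rewrite -tproj_funDr !addr0. Qed.

Lemma tproj_fun_bal n x (r : T) t :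
  tproj_fun n ((r : T^c) *: x) t = tproj_fun n x (psi r * t).
Proof.
elim/(grading_ind (gm_grading X)): x => [|x y IHx IHy|i x Cx].
- by rewrite scaler0 !tproj_fun0l.
- by rewrite scalerDr !tproj_funDl IHx IHy.
elim/(grading_ind (gr_grading T)): r => [|r s IHr IHs|j r Cr].
- by rewrite scale0r tproj_fun0l rmorph0 mul0r tproj_fun0r.
- by rewrite scalerDl tproj_funDl IHr IHs rmorphD mulrDl tproj_funDr.
elim/(grading_ind (gr_grading T')): t => [|s t IHs IHt|l t Ct].
- by rewrite mulr0 !tproj_fun0r.
- by rewrite mulrDr !tproj_funDr IHs IHt.
rewrite (tproj_fun_homog _ _ (gm_act Cx Cr)) (tproj_fun_homog _ _ Cx).
rewrite (component_homog _ _ Ct) (component_homog _ _ (gr_mul (rhom_deg psi Cr) Ct)).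
rewrite -[l == _](inj_eq (addrI j)) opprD !addrA.
have -> : j + n - i - j = n - i by rewrite [j + n]addrC [LHS]addrAC addrK.
by case: ifP => _; [apply: tens_bal|rewrite !tens0r].
Qed.

Fact tensor_grading : is_grading tensor_part.
Proof.
have pE n x t : tlift (tproj_fun n) (tens x t) = tproj_fun n x t.
  by apply: tlift_tens => *; [apply: tproj_funDl|apply: tproj_funDr|apply: tproj_fun_bal].
have pD n : {morph tlift (tproj_fun n) : x y / x + y}.
  by apply: tliftD => *; [apply: tproj_funDl|apply: tproj_funDr|apply: tproj_fun_bal].
have p0 n : tlift (tproj_fun n) 0 = 0.
  by apply: (addrI (tlift (tproj_fun n) 0)); rewrite -pD !addr0.
have pN n x : tlift (tproj_fun n) (- x) = - tlift (tproj_fun n) x.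
  by apply/eqP; rewrite -addr_eq0 -pD addNr p0.
apply: (@is_gradingP _ _ (fun n => tlift (tproj_fun n))) => //.
- exact: tpart0.
- exact: tpartB.
- move=> m n x; elim=> [|{}x y _ IHx _ IHy|i j {}x t Cx Ct <-].
  + by rewrite if_same.
  + by rewrite pD pN IHx IHy; case: ifP => _; rewrite ?subr0.
  rewrite pE (tproj_fun_homog _ _ Cx) (component_homog _ _ Ct).
  rewrite -[j == _](inj_eq (addrI i)) [i + (n - i)]addrC subrK.
  by case: ifP => // _; apply: tens0r.
elim/tens_ind => [|x y [s [sC ->]] [s' [sC' ->]]|x t].
- by exists [::]; rewrite big_nil.
- exists (s ++ s'); rewrite big_cat; split=> // q.
  by rewrite mem_cat => /orP[]; [apply: sC|apply: sC'].
elim/(grading_ind (gm_grading X)): x => [|x y [s [sC sE]] [s' [sC' sE']]|i x Cx].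
- by exists [::]; rewrite big_nil tens0l.
- exists (s ++ s'); rewrite big_cat tensDl sE sE'; split=> // q.
  by rewrite mem_cat => /orP[]; [apply: sC|apply: sC'].
elim/(grading_ind (gr_grading T')): t => [|t u [s [sC sE]] [s' [sC' sE']]|j t Ct].
- by exists [::]; rewrite big_nil tens0r.
- exists (s ++ s'); rewrite big_cat tensDr sE sE'; split=> // q.
  by rewrite mem_cat => /orP[]; [apply: sC|apply: sC'].
exists [:: (i + j, tens x t)]; rewrite big_seq1; split=> // q.
by rewrite inE => /eqP-> /=; apply: tpart_tens Cx Ct _.
Qed.

Fact tensor_act m n (x : tensor) (t : T') :
  tensor_part m x -> gr_part n t -> tensor_part (m + n) ((t : T'^c) *: x).
Proof.
move=> + Ct; elim=> [|{}x y _ IHx _ IHy|i j {}x s Cx Cs <-].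
- by rewrite scaler0; apply: tpart0.
- by rewrite scalerBr; apply: tpartB.
- by rewrite tens_act -addrA; apply: tpart_tens Cx (gr_mul Cs Ct) _.
Qed.

Definition tensorM : grMod T' := @GrMod T' tensor _ tensor_grading tensor_act.

End TensorDef.

(* Restriction of scalars, right adjoint to X |-> X ⊗_psi T'. *)
Section Restriction.
Variables (T T' : grRing) (psi : grRHom T T') (A : grMod T').

Definition res_sort : Type := A.
HB.instance Definition _ := GRing.Zmodule.on res_sort.

Definition res_scale (r : T^c) (x : res_sort) : res_sort :=
  ((psi r : T') : T'^c) *: (x : A).

Fact res_scaleA (a b : T^c) x : res_scale a (res_scale b x) = res_scale (a * b) x.
Proof. by rewrite /res_scale scalerA; congr (_ *: _); exact: esym (rmorphM psi b a). Qed.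

Fact res_scale1 : left_id 1 res_scale.
Proof. by move=> x; rewrite /res_scale rmorph1 scale1r. Qed.

Fact res_scaleDr : right_distributive res_scale +%R.
Proof. by move=> a x y; apply: scalerDr. Qed.

Fact res_scaleDl v : {morph res_scale^~ v : a b / a + b}.
Proof. by move=> a b; rewrite /res_scale rmorphD; apply: scalerDl. Qed.

HB.instance Definition _ :=
  GRing.Zmodule_isLmodule.Build T^c res_sort res_scaleA res_scale1 res_scaleDr res_scaleDl.

Definition resM : grMod T :=
  @GrMod T res_sort (@gm_part T' A) (gm_grading A)
    (fun m n x t Cx Ct => gm_act Cx (rhom_deg psi Ct)).

End Restriction.

Section Adjunction.
Variables (T T' : grRing) (psi : grRHom T T').

Definition tens_unit (X : grMod T) : grHom X (resM psi (tensorM psi X)).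
Proof.
apply: (@mkHom T X (resM psi (tensorM psi X)) (fun x => tens psi x 1)).
- move=> a x y; rewrite tensDl tens_bal.
  by rewrite -[a *: _]/(_ *: tens psi x 1) tens_act mulr1 mul1r.
- by move=> n x Cx; apply: tpart_tens Cx (gr_one T') _; rewrite addr0.
Defined.

Definition res_hom (A B : grMod T') (g : grHom A B) : grHom (resM psi A) (resM psi B).
Proof.
apply: (@mkHom T (resM psi A) (resM psi B) g).
- by move=> a x y; apply: linearP.
- by move=> n x; apply: (hom_deg g).
Defined.

Section Extension.
Variables (X : grMod T) (A : grMod T') (f : grHom X (resM psi A)).

Definition ext_fun (x : X) (t : T') : A := (t : T'^c) *: (f x : A).

Fact ext_funDl x y t : ext_fun (x + y) t = ext_fun x t + ext_fun y t.
Proof. by rewrite /ext_fun linearD; apply: scalerDr. Qed.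

Fact ext_funDr x s t : ext_fun x (s + t) = ext_fun x s + ext_fun x t.
Proof. exact: scalerDl. Qed.

Fact ext_fun_bal x (r : T) t :
  ext_fun ((r : T^c) *: x) t = ext_fun x (psi r * t).
Proof. by rewrite /ext_fun linearZ; apply: (@scaler_conv T' A). Qed.

Definition ext_lift : tensorM psi X -> A := tlift ext_fun.

Fact ext_lift_tens x t : ext_lift (tens psi x t) = (t : T'^c) *: (f x : A).
Proof. exact: (tlift_tens ext_funDl ext_funDr ext_fun_bal). Qed.

Fact ext_liftD x y : ext_lift (x + y) = ext_lift x + ext_lift y.
Proof. exact: (tliftD ext_funDl ext_funDr ext_fun_bal). Qed.

Fact ext_lift0 : ext_lift 0 = 0.
Proof. exact: (tlift0 ext_funDl ext_funDr ext_fun_bal). Qed.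

Fact ext_lift_linear : linear ext_lift.
Proof.
move=> a x y; rewrite ext_liftD; congr (_ + _).
elim/tens_ind: x => [|u v IHu IHv|u t].
- by rewrite scaler0 ext_lift0 scaler0.
- by rewrite scalerDr !ext_liftD IHu IHv scalerDr.
- by rewrite tens_act !ext_lift_tens scaler_conv.
Qed.

Fact ext_lift_deg n x : gm_part n x -> gm_part n (ext_lift x).
Proof.
elim=> [|{}x y _ IHx _ IHy|i j {}x t Cx Ct <-].
- by rewrite ext_lift0; apply: grading0; apply: gm_grading.
- have yN : ext_lift (- y) = - ext_lift y.
    by apply/eqP; rewrite -addr_eq0 -ext_liftD addNr ext_lift0.
  by rewrite ext_liftD yN; apply: gradingB => //; apply: gm_grading.
- by rewrite ext_lift_tens; apply: gm_act => //; apply: (hom_deg f).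
Qed.

Definition tens_ext : grHom (tensorM psi X) A := mkHom ext_lift_linear ext_lift_deg.

Lemma tens_extE x (t : T') : tens_ext (tens psi x t) = (t : T'^c) *: (f x : A).
Proof. exact: ext_lift_tens. Qed.

End Extension.
Arguments tens_ext : simpl never.

Lemma tens_hom_eq X (A : grMod T') (f g : grHom (tensorM psi X) A) :
  (forall x, f (tens psi x 1) = g (tens psi x 1)) -> forall x, f x = g x.
Proof.
move=> fg; elim/tens_ind => [|x y IHx IHy|x t]; first by rewrite !linear0.
  by rewrite !linearD IHx IHy.
by rewrite -[t]mul1r -tens_act !linearZ /= fg.
Qed.

Definition tens_map X Y (f : grHom X Y) : grHom (tensorM psi X) (tensorM psi Y) :=
  tens_ext (compHom (tens_unit Y) f).
Arguments tens_map : simpl never.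

Lemma tens_mapE X Y (f : grHom X Y) x t :
  tens_map f (tens psi x t) = tens psi (f x) t.
Proof. by rewrite tens_extE -[LHS]/(_ *: tens psi (f x) 1) tens_act mul1r. Qed.

Lemma tensorM_iso X Y : grIso X Y -> grIso (tensorM psi X) (tensorM psi Y).
Proof.
move=> [f [g [fK gK]]]; exists (tens_map f), (tens_map g); split=> x.
  apply: (tens_hom_eq (f := compHom (tens_map g) (tens_map f)) (g := idHom _)) => y.
  by rewrite !compHomE !tens_mapE fK.
apply: (tens_hom_eq (f := compHom (tens_map f) (tens_map g)) (g := idHom _)) => y.
by rewrite !compHomE !tens_mapE gK.
Qed.

Lemma tensorM_sum X Y :
  grIso (tensorM psi (sumM X Y)) (sumM (tensorM psi X) (tensorM psi Y)).
Proof.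
pose F : grHom (tensorM psi (sumM X Y)) (sumM (tensorM psi X) (tensorM psi Y)) :=
  tens_ext (copairHom
    (compHom (res_hom (inlHom _ _)) (tens_unit X) : grHom X (resM psi (sumM _ _)))
    (compHom (res_hom (inrHom _ _)) (tens_unit Y))).
pose G : grHom (sumM (tensorM psi X) (tensorM psi Y)) (tensorM psi (sumM X Y)) :=
  copairHom (tens_map (inlHom X Y)) (tens_map (inrHom X Y)).
have FE z t : F (tens psi z t) = (tens psi z.1 t, tens psi z.2 t).
  rewrite tens_extE copairHomE !compHomE.
  rewrite -[LHS]/(_ *: (tens psi z.1 1 + 0), _ *: (0 + tens psi z.2 1)).
  by rewrite addr0 add0r !tens_act !mul1r.
exists F, G; split.
- apply: (tens_hom_eq (f := compHom G F) (g := idHom _)) => z.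
  rewrite compHomE FE copairHomE !tens_mapE -tensDl; congr (tens _ _ _).
  by case: z => x y; rewrite -[LHS]/(_, _) /= addr0 add0r.
- move=> [u v]; rewrite copairHomE linearD.
  have -> : F (tens_map (inlHom X Y) u) = (u, 0).
    apply: (tens_hom_eq (f := compHom F (tens_map (inlHom X Y))) (g := inlHom _ _)) => x.
    by rewrite compHomE tens_mapE FE tens0l.
  have -> : F (tens_map (inrHom X Y) v) = (0, v).
    apply: (tens_hom_eq (f := compHom F (tens_map (inrHom X Y))) (g := inrHom _ _)) => y.
    by rewrite compHomE tens_mapE FE tens0l.
  by rewrite -[LHS]/(_, _) /= addr0 add0r.
Qed.

Fact tensorM_fg X : fin_gen X -> fin_gen (tensorM psi X).
Proof.
move=> [n [g gP]]; exists n, (fun i => tens psi (g i) 1).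
elim/tens_ind => [|x y [c ->] [d ->]|x t].
- by exists (fun=> 0); rewrite big1 // => i _; rewrite scale0r.
- by exists (fun i => c i + d i); rewrite -big_split; apply: eq_bigr => i _; rewrite scalerDl.
have [c ->] := gP x; exists (fun i => psi (c i) * t).
rewrite (big_morph (fun y => tens psi y t) (fun y z => tensDl psi y z t) (tens0l psi X t)).
by apply: eq_bigr => i _; rewrite tens_bal tens_act mul1r.
Qed.

Fact tensorM_proj X : gr_projective X -> gr_projective (tensorM psi X).
Proof.
move=> pX A B g f gs.
have [h hP] := pX (resM psi A) (resM psi B) (res_hom g)
  (compHom (res_hom f) (tens_unit X)) gs.
exists (tens_ext h).
apply: (tens_hom_eq (f := compHom g (tens_ext h)) (g := f)) => x.
by rewrite compHomE tens_extE scale1r; apply: hP.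
Qed.

Definition tensorP (X : fgProj T) : fgProj T' :=
  FgProj (tensorM_fg (fgp_fin_gen X)) (tensorM_proj (@fgp_proj T X)).

End Adjunction.

(* Quotient by an equivalence relation, used for types containing all graded
   modules. These live one universe above [lmodType], which in the (universe
   monomorphic) algebraic hierarchy is not below [zmodType]: declaring the
   graded Grothendieck group as a [zmodType] is a universe inconsistency. *)
Section LargeQuotient.
Variables (X : Type) (R : X -> X -> Prop).

Definition lquot : Type := {A : X -> Prop | exists x, A = R x}.
Definition lpi (x : X) : lquot := exist _ (R x) (ex_intro _ x erefl).
Definition lrepr (q : lquot) : X := projT1 (cid (proj2_sig q)).

Lemma lreprK q : lpi (lrepr q) = q.
Proof.
rewrite /lrepr; case: cid => x /=; case: q => A [y Ay] /= AE.
by apply: eq_exist; rewrite AE.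
Qed.

Hypotheses (Rr : forall x, R x x) (Rs : forall x y, R x y -> R y x)
  (Rt : forall x y z, R x y -> R y z -> R x z).

Lemma lpiP x y : lpi x = lpi y <-> R x y.
Proof.
split=> [/(congr1 (@proj1_sig _ _)) /= ->|Rxy]; first exact: Rr.
apply: eq_exist; apply: funext => z; apply: propext.
by split; apply: Rt => //; apply: Rs.
Qed.

Lemma lreprP x : R (lrepr (lpi x)) x.
Proof. by apply/lpiP; rewrite lreprK. Qed.

End LargeQuotient.

Section GradedGrothendieck.
Variable T : grRing.

Definition Vgr : Type := lquot (fun M N : fgProj T => grIso M N).

Definition v_class (M : fgProj T) : Vgr := lpi _ M.

Definition v_zero : Vgr := v_class (zeroP T).
Definition v_add (a b : Vgr) : Vgr := v_class (sumP (lrepr a) (lrepr b)).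
Definition v_shift (n : int) (a : Vgr) : Vgr := v_class (shiftP n (lrepr a)).

Lemma v_reprK a : v_class (lrepr a) = a. Proof. exact: lreprK. Qed.

Lemma v_classP (M N : fgProj T) : v_class M = v_class N <-> grIso M N.
Proof.
apply: (lpiP (R := fun M N : fgProj T => grIso M N)) => [P|P Q|P Q S].
- exact: grIso_refl.
- exact: grIso_sym.
- exact: grIso_trans.
Qed.

Lemma v_reprP (M : fgProj T) : grIso (lrepr (v_class M)) M.
Proof. by apply/v_classP; rewrite v_reprK. Qed.

Lemma v_addE (M N : fgProj T) : v_add (v_class M) (v_class N) = v_class (sumP M N).
Proof. by apply/v_classP/sumM_iso; apply: v_reprP. Qed.

Lemma v_shiftE n (M : fgProj T) : v_shift n (v_class M) = v_class (shiftP n M).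
Proof. by apply/v_classP/shiftM_iso; apply: v_reprP. Qed.

Lemma v_addC : commutative v_add.
Proof.
move=> a b; rewrite -(v_reprK a) -(v_reprK b) !v_addE.
by apply/v_classP/sumM_isoC.
Qed.

Lemma v_addA : associative v_add.
Proof.
move=> a b c; rewrite -(v_reprK a) -(v_reprK b) -(v_reprK c) !v_addE.
by apply/v_classP/sumM_isoA.
Qed.

Lemma v_add0 : left_id v_zero v_add.
Proof. by move=> a; rewrite -(v_reprK a) v_addE; apply/v_classP/sumM_iso0. Qed.

Lemma v_addCA : left_commutative v_add.
Proof. by move=> a b c; rewrite !v_addA [v_add a b]v_addC. Qed.

Lemma v_addAC : right_commutative v_add.
Proof. by move=> a b c; rewrite -!v_addA [v_add b c]v_addC. Qed.

Lemma v_addACA : interchange v_add v_add.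
Proof. by move=> a b c d; rewrite -!v_addA [v_add b _]v_addCA. Qed.

Lemma v_shift_add n a b : v_shift n (v_add a b) = v_add (v_shift n a) (v_shift n b).
Proof.
rewrite -(v_reprK a) -(v_reprK b) !(v_addE, v_shiftE).
by apply/v_classP/shiftM_sum.
Qed.

Lemma v_shift0 a : v_shift 0 a = a.
Proof. by rewrite -(v_reprK a) v_shiftE; apply/v_classP/shiftM0. Qed.

Lemma v_shiftD n p a : v_shift n (v_shift p a) = v_shift (n + p) a.
Proof. by rewrite -(v_reprK a) !v_shiftE; apply/v_classP/shiftMD. Qed.

(* Group completion: (a, b) stands for the formal difference a - b. *)
Definition k0_rel (p q : Vgr * Vgr) : Prop :=
  exists s, v_add (v_add p.1 q.2) s = v_add (v_add q.1 p.2) s.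

Definition K0gr : Type := lquot k0_rel.

Definition k0_diff (a b : Vgr) : K0gr := lpi k0_rel (a, b).

Definition k0_class (M : fgProj T) : K0gr := k0_diff (v_class M) v_zero.

Definition k0_pos (x : K0gr) : Prop := exists M : fgProj T, x = k0_class M.

Definition k0_zero : K0gr := k0_diff v_zero v_zero.
Definition k0_add (x y : K0gr) : K0gr :=
  k0_diff (v_add (lrepr x).1 (lrepr y).1) (v_add (lrepr x).2 (lrepr y).2).
Definition k0_opp (x : K0gr) : K0gr := k0_diff (lrepr x).2 (lrepr x).1.

(* The action of x^n, n in Z *)
Definition k0_shift (n : int) (x : K0gr) : K0gr :=
  k0_diff (v_shift n (lrepr x).1) (v_shift n (lrepr x).2).

Lemma k0_rel_refl p : k0_rel p p.
Proof. by exists v_zero. Qed.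

Lemma k0_rel_sym p q : k0_rel p q -> k0_rel q p.
Proof. by case=> s sE; exists s. Qed.

Lemma k0_rel_trans p q r : k0_rel p q -> k0_rel q r -> k0_rel p r.
Proof.
case: p q r => [a b] [c d] [e f] [s /= E1] [t /= E2].
exists (v_add (v_add c d) (v_add s t)) => /=.
have H u v : v_add (v_add u v) (v_add (v_add c d) (v_add s t)) =
    v_add (v_add (v_add u d) (v_add c v)) (v_add s t).
  by rewrite v_addA; congr (v_add _ _); rewrite [v_add c v]v_addC [RHS]v_addACA [v_add d c]v_addC.
by rewrite !H [LHS]v_addACA E1 E2 [LHS]v_addACA [X in v_add X _]v_addC.
Qed.

Lemma k0_reprK x : k0_diff (lrepr x).1 (lrepr x).2 = x.
Proof. by rewrite /k0_diff -surjective_pairing; apply: lreprK. Qed.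

Lemma k0_diffP a b c d : k0_diff a b = k0_diff c d <->
  exists s, v_add (v_add a d) s = v_add (v_add c b) s.
Proof. exact: (lpiP k0_rel_refl k0_rel_sym k0_rel_trans). Qed.

Lemma k0_diff_reprP a b : k0_rel (lrepr (k0_diff a b)) (a, b).
Proof. exact: (lreprP k0_rel_refl k0_rel_sym k0_rel_trans). Qed.

Lemma k0_ind (P : K0gr -> Prop) : (forall a b, P (k0_diff a b)) -> forall x, P x.
Proof. by move=> PD x; rewrite -(k0_reprK x). Qed.

Lemma k0_addE a b c d :
  k0_add (k0_diff a b) (k0_diff c d) = k0_diff (v_add a c) (v_add b d).
Proof.
have [s /= E1] := k0_diff_reprP a b; have [t /= E2] := k0_diff_reprP c d.
apply/k0_diffP; exists (v_add s t).
rewrite [X in v_add X _]v_addACA [LHS]v_addACA E1 E2 v_addACA.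
by congr (v_add _ _); rewrite v_addACA.
Qed.

Lemma k0_oppE a b : k0_opp (k0_diff a b) = k0_diff b a.
Proof.
have [s /= E] := k0_diff_reprP a b; apply/k0_diffP; exists s.
by rewrite [v_add (lrepr _).2 a]v_addC -E [v_add b _]v_addC.
Qed.

Lemma k0_shiftE n a b :
  k0_shift n (k0_diff a b) = k0_diff (v_shift n a) (v_shift n b).
Proof.
have [s /= E] := k0_diff_reprP a b; apply/k0_diffP; exists (v_shift n s).
by rewrite -!v_shift_add E.
Qed.

Lemma k0_addC : commutative k0_add.
Proof.
elim/k0_ind=> a b; elim/k0_ind=> c d.
by rewrite !k0_addE [v_add a c]v_addC [v_add b d]v_addC.
Qed.

Lemma k0_addA : associative k0_add.
Proof.
by elim/k0_ind=> a b; elim/k0_ind=> c d; elim/k0_ind=> e f; rewrite !k0_addE !v_addA.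
Qed.

Lemma k0_add0 : left_id k0_zero k0_add.
Proof. by elim/k0_ind=> a b; rewrite k0_addE !v_add0. Qed.

Lemma k0_addN : left_inverse k0_zero k0_opp k0_add.
Proof.
elim/k0_ind=> a b; rewrite k0_oppE k0_addE; apply/k0_diffP; exists v_zero.
by rewrite [v_add a b]v_addC v_addC [in RHS]v_addC [v_add v_zero (v_add b a)]v_addC.
Qed.

Lemma k0_shift_add n x y : k0_shift n (k0_add x y) = k0_add (k0_shift n x) (k0_shift n y).
Proof.
by elim/k0_ind: x => a b; elim/k0_ind: y => c d;
   rewrite !(k0_addE, k0_shiftE) !v_shift_add.
Qed.

Lemma k0_shift0 x : k0_shift 0 x = x.
Proof. by elim/k0_ind: x => a b; rewrite k0_shiftE !v_shift0. Qed.

Lemma k0_shiftD n p x : k0_shift n (k0_shift p x) = k0_shift (n + p) x.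
Proof. by elim/k0_ind: x => a b; rewrite !k0_shiftE !v_shiftD. Qed.

Lemma k0_classD (M N : fgProj T) :
  k0_add (k0_class M) (k0_class N) = k0_class (sumP M N).
Proof. by rewrite k0_addE v_addE v_add0. Qed.

Lemma k0_class_shift n (M : fgProj T) :
  k0_shift n (k0_class M) = k0_class (shiftP n M).
Proof.
rewrite k0_shiftE v_shiftE; apply/k0_diffP; exists v_zero; congr (v_add _ _).
rewrite v_addC [RHS]v_addC v_add0 /v_zero v_shiftE.
have -> : v_class (shiftP n (zeroP T)) = v_zero; last by rewrite v_add0.
apply/v_classP; exists (zeroHom _ _), (zeroHom _ _).
by split=> x; apply: zeroM_eq.
Qed.

Definition k0_intmul (c : int) (x : K0gr) : K0gr :=
  match c with
  | Posz n => iter n (k0_add x) k0_zero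
  | Negz n => k0_opp (iter n.+1 (k0_add x) k0_zero)
  end.

(* The list of the (c_i, n_i) stands for the Laurent polynomial
   \sum_i c_i x^(n_i). *)
Definition k0_scale (p : seq (int * int)) (a : K0gr) : K0gr :=
  foldr (fun t b => k0_add (k0_intmul t.1 (k0_shift t.2 a)) b) k0_zero p.

End GradedGrothendieck.

Section GrothendieckMaps.
Variables T T' : grRing.

Definition is_laurent_linear (alpha : K0gr T -> K0gr T') : Prop :=
  (forall a b, alpha (k0_add a b) = k0_add (alpha a) (alpha b)) /\
  (forall (p : seq (int * int)) a, alpha (k0_scale p a) = k0_scale p (alpha a)).

Definition is_order_preserving (alpha : K0gr T -> K0gr T') : Prop :=
  forall a, k0_pos a -> k0_pos (alpha a).

Definition is_pointed (alpha : K0gr T -> K0gr T') : Prop :=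
  alpha (k0_class (regularP T)) = k0_class (regularP T').

Lemma is_laurent_linearP alpha : is_laurent_linear alpha <->
  (forall a b, alpha (k0_add a b) = k0_add (alpha a) (alpha b)) /\
  (forall n a, alpha (k0_shift n a) = k0_shift n (alpha a)).
Proof.
split=> -[aD aZ]; split=> //.
  move=> n a; have add0 (S : grRing) (x : K0gr S) : k0_add x (k0_zero S) = x.
    by rewrite k0_addC k0_add0.
  by have := aZ [:: (1, n)] a; rewrite /k0_scale /= /k0_intmul /= !add0.
have addI (S : grRing) (x y z : K0gr S) : k0_add x y = k0_add x z -> y = z.
  move=> E; have := congr1 (k0_add (k0_opp x)) E.
  by rewrite !k0_addA !k0_addN !k0_add0.
have a0 : alpha (k0_zero T) = k0_zero T'.
  apply: (addI _ (alpha (k0_zero T))).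
  by rewrite -aD k0_add0 k0_addC k0_add0.
have aN x : alpha (k0_opp x) = k0_opp (alpha x).
  by apply: (addI _ (alpha x)); rewrite -aD ![k0_add _ (k0_opp _)]k0_addC !k0_addN.
have aM c x : alpha (k0_intmul c x) = k0_intmul c (alpha x).
  have aI n : alpha (iter n (k0_add x) (k0_zero T)) =
              iter n (k0_add (alpha x)) (k0_zero T').
    by elim: n => //= n IH; rewrite aD IH.
  by case: c => n; rewrite /k0_intmul ?aN aI.
move=> p a; elim: p => //= t p IH.
by rewrite aD aM aZ IH.
Qed.

Variable psi : grRHom T T'.

Definition v_map (a : Vgr T) : Vgr T' := v_class (tensorP psi (lrepr a)).

Definition k0_map (x : K0gr T) : K0gr T' :=
  k0_diff (v_map (lrepr x).1) (v_map (lrepr x).2).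

Lemma v_mapE (M : fgProj T) : v_map (v_class M) = v_class (tensorP psi M).
Proof. by apply/v_classP/tensorM_iso; apply: v_reprP. Qed.

Lemma v_mapD a b : v_map (v_add a b) = v_add (v_map a) (v_map b).
Proof.
rewrite -(v_reprK a) -(v_reprK b) !(v_addE, v_mapE).
by apply/v_classP/tensorM_sum.
Qed.

Lemma v_map0 : v_map (v_zero T) = v_zero T'.
Proof.
rewrite v_mapE; apply/v_classP.
exists (zeroHom _ _), (zeroHom _ _); split=> x; last exact: zeroM_eq.
apply: (tens_hom_eq (f := zeroHom _ _) (g := idHom _)) => y.
by rewrite (zeroM_eq y 0) tens0l !linear0.
Qed.

Lemma k0_mapE a b : k0_map (k0_diff a b) = k0_diff (v_map a) (v_map b).
Proof.
have [s /= E] := k0_diff_reprP a b; apply/k0_diffP; exists (v_map s).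
by rewrite -!v_mapD E.
Qed.

Lemma k0_map_class (M : fgProj T) :
  k0_map (k0_class M) = k0_class (tensorP psi M).
Proof. by rewrite k0_mapE v_mapE v_map0. Qed.

End GrothendieckMaps.

Record digraph := Digraph {
  vertex : finType;
  edge : finType;
  src : edge -> vertex;
  rng : edge -> vertex
}.

Definition is_sink (E : digraph) (v : vertex E) : Prop :=
  forall e : edge E, src e <> v.

Definition no_sinks (E : digraph) : Prop := forall v : vertex E, ~ is_sink v.

Section Leavitt.
Variables (k : fieldType) (E : digraph).

Inductive lgen := Vtx of vertex E | Edg of edge E | Gst of edge E.

HB.instance Definition _ := gen_eqMixin lgen.

Definition gdeg (g : lgen) : int :=
  match g with Vtx _ => 0 | Edg _ => 1 | Gst _ => -1 end.

Inductive lterm :=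
| LGen of lgen
| LZero
| LOne
| LAdd of lterm & lterm
| LOpp of lterm
| LMul of lterm & lterm
| LScale of k & lterm.

(* The congruence generated by the axioms of unital associative k-algebras and
   the relations of the Leavitt path algebra. As E has finitely many vertices,
   the sum of all vertices is a unit of the algebra presented by the latter; in
   the language of unital algebras this is the relation [lc_unit]; see
   [leavitt_universal] below for the universal property it ensures. *)
Inductive lcongr : lterm -> lterm -> Prop :=
| lc_refl a : lcongr a a
| lc_sym a b : lcongr a b -> lcongr b a
| lc_trans a b c : lcongr a b -> lcongr b c -> lcongr a c
| lc_add a a' b b' : lcongr a a' -> lcongr b b' -> lcongr (LAdd a b) (LAdd a' b')
| lc_opp a a' : lcongr a a' -> lcongr (LOpp a) (LOpp a')
| lc_mul a a' b b' : lcongr a a' -> lcongr b b' -> lcongr (LMul a b) (LMul a' b')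
| lc_scale c a a' : lcongr a a' -> lcongr (LScale c a) (LScale c a')
| lc_addA a b c : lcongr (LAdd a (LAdd b c)) (LAdd (LAdd a b) c)
| lc_addC a b : lcongr (LAdd a b) (LAdd b a)
| lc_add0 a : lcongr (LAdd LZero a) a
| lc_addN a : lcongr (LAdd (LOpp a) a) LZero
| lc_mulA a b c : lcongr (LMul a (LMul b c)) (LMul (LMul a b) c)
| lc_mul1l a : lcongr (LMul LOne a) a
| lc_mul1r a : lcongr (LMul a LOne) a
| lc_mulDl a b c : lcongr (LMul (LAdd a b) c) (LAdd (LMul a c) (LMul b c))
| lc_mulDr a b c : lcongr (LMul a (LAdd b c)) (LAdd (LMul a b) (LMul a c))
| lc_scaleA c d a : lcongr (LScale c (LScale d a)) (LScale (c * d) a)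
| lc_scale1 a : lcongr (LScale 1 a) a
| lc_scaleDr c a b : lcongr (LScale c (LAdd a b)) (LAdd (LScale c a) (LScale c b))
| lc_scaleDl c d a : lcongr (LScale (c + d) a) (LAdd (LScale c a) (LScale d a))
| lc_scaleAl c a b : lcongr (LScale c (LMul a b)) (LMul (LScale c a) b)
| lc_scaleAr c a b : lcongr (LScale c (LMul a b)) (LMul a (LScale c b))
| lc_vv v : lcongr (LMul (LGen (Vtx v)) (LGen (Vtx v))) (LGen (Vtx v))
| lc_vw v w : v <> w -> lcongr (LMul (LGen (Vtx v)) (LGen (Vtx w))) LZero
| lc_se e : lcongr (LMul (LGen (Vtx (src e))) (LGen (Edg e))) (LGen (Edg e))
| lc_er e : lcongr (LMul (LGen (Edg e)) (LGen (Vtx (rng e)))) (LGen (Edg e))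
| lc_rg e : lcongr (LMul (LGen (Vtx (rng e))) (LGen (Gst e))) (LGen (Gst e))
| lc_gs e : lcongr (LMul (LGen (Gst e)) (LGen (Vtx (src e)))) (LGen (Gst e))
| lc_ge e : lcongr (LMul (LGen (Gst e)) (LGen (Edg e))) (LGen (Vtx (rng e)))
| lc_gf e f : e <> f -> lcongr (LMul (LGen (Gst e)) (LGen (Edg f))) LZero
| lc_ck2 v : ~ is_sink v ->
    lcongr (LGen (Vtx v))
      (\big[LAdd/LZero]_(e : edge E | src e == v)
          LMul (LGen (Edg e)) (LGen (Gst e)))
| lc_unit : lcongr (\big[LAdd/LZero]_(v : vertex E) LGen (Vtx v)) LOne.

Definition lrel (a b : {classic lterm}) : bool := `[< lcongr a b >].

Fact lrel_refl : reflexive lrel.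
Proof. by move=> a; apply/asboolP; apply: lc_refl. Qed.

Fact lrel_sym : symmetric lrel.
Proof. by move=> a b; apply/asboolP/asboolP => /lc_sym. Qed.

Fact lrel_trans : transitive lrel.
Proof. by move=> b a c /asboolP ab /asboolP bc; apply/asboolP; apply: lc_trans bc. Qed.

Canonical lrel_equiv := EquivRel lrel lrel_refl lrel_sym lrel_trans.

Definition leavitt : Type := {eq_quot lrel_equiv}.
HB.instance Definition _ := Choice.on leavitt.

Definition lpt (a : lterm) : leavitt := \pi_({eq_quot lrel_equiv}) (a : {classic lterm}).
Definition lrp (x : leavitt) : lterm := repr (x : {eq_quot lrel_equiv}).

Lemma lrpK x : lpt (lrp x) = x. Proof. exact: reprK. Qed.

Lemma lptP a b : lpt a = lpt b <-> lcongr a b.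
Proof. by split=> [/eqmodP/asboolP//|ab]; apply/eqmodP; apply/asboolP. Qed.

Lemma lrpP a : lcongr (lrp (lpt a)) a.
Proof. by apply/lptP; rewrite lrpK. Qed.

Definition l_add (x y : leavitt) : leavitt := lpt (LAdd (lrp x) (lrp y)).
Definition l_opp (x : leavitt) : leavitt := lpt (LOpp (lrp x)).
Definition l_mul (x y : leavitt) : leavitt := lpt (LMul (lrp x) (lrp y)).
Definition l_scale (c : k) (x : leavitt) : leavitt := lpt (LScale c (lrp x)).

Fact l_addE a b : l_add (lpt a) (lpt b) = lpt (LAdd a b).
Proof. by apply/lptP; apply: lc_add; apply: lrpP. Qed.

Fact l_oppE a : l_opp (lpt a) = lpt (LOpp a).
Proof. by apply/lptP; apply: lc_opp; apply: lrpP. Qed.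

Fact l_mulE a b : l_mul (lpt a) (lpt b) = lpt (LMul a b).
Proof. by apply/lptP; apply: lc_mul; apply: lrpP. Qed.

Fact l_scaleE c a : l_scale c (lpt a) = lpt (LScale c a).
Proof. by apply/lptP; apply: lc_scale; apply: lrpP. Qed.

Let lE := (l_addE, l_oppE, l_mulE, l_scaleE).

Fact l_ind (P : leavitt -> Prop) : (forall a, P (lpt a)) -> forall x, P x.
Proof. by move=> Pa x; rewrite -(lrpK x). Qed.

Fact l_addA : associative l_add.
Proof.
by elim/l_ind=> a; elim/l_ind=> b; elim/l_ind=> c; rewrite !lE; apply/lptP/lc_addA.
Qed.

Fact l_addC : commutative l_add.
Proof. by elim/l_ind=> a; elim/l_ind=> b; rewrite !lE; apply/lptP/lc_addC. Qed.

Fact l_add0 : left_id (lpt LZero) l_add.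
Proof. by elim/l_ind=> a; rewrite !lE; apply/lptP/lc_add0. Qed.

Fact l_addN : left_inverse (lpt LZero) l_opp l_add.
Proof. by elim/l_ind=> a; rewrite !lE; apply/lptP/lc_addN. Qed.

Fact l_mulA : associative l_mul.
Proof.
by elim/l_ind=> a; elim/l_ind=> b; elim/l_ind=> c; rewrite !lE; apply/lptP/lc_mulA.
Qed.

Fact l_mul1l : left_id (lpt LOne) l_mul.
Proof. by elim/l_ind=> a; rewrite !lE; apply/lptP/lc_mul1l. Qed.

Fact l_mul1r : right_id (lpt LOne) l_mul.
Proof. by elim/l_ind=> a; rewrite !lE; apply/lptP/lc_mul1r. Qed.

Fact l_mulDl : left_distributive l_mul l_add.
Proof.
by elim/l_ind=> a; elim/l_ind=> b; elim/l_ind=> c; rewrite !lE; apply/lptP/lc_mulDl.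
Qed.

Fact l_mulDr : right_distributive l_mul l_add.
Proof.
by elim/l_ind=> a; elim/l_ind=> b; elim/l_ind=> c; rewrite !lE; apply/lptP/lc_mulDr.
Qed.

HB.instance Definition _ := GRing.isPzRing.Build leavitt
  l_addA l_addC l_add0 l_addN l_mulA l_mul1l l_mul1r l_mulDl l_mulDr.

Fact l_scaleA c d x : l_scale c (l_scale d x) = l_scale (c * d) x.
Proof. by elim/l_ind: x => a; rewrite !lE; apply/lptP/lc_scaleA. Qed.

Fact l_scale1 : left_id 1 l_scale.
Proof. by elim/l_ind=> a; rewrite !lE; apply/lptP/lc_scale1. Qed.

Fact l_scaleDr : right_distributive l_scale +%R.
Proof.
move=> c; elim/l_ind=> a; elim/l_ind=> b.
by rewrite -[_ + _]/(l_add _ _) -[RHS]/(l_add _ _) !lE; apply/lptP/lc_scaleDr.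
Qed.

Fact l_scaleDl x : {morph l_scale^~ x : c d / c + d}.
Proof.
move=> c d; elim/l_ind: x => a.
by rewrite -[RHS]/(l_add _ _) !lE; apply/lptP/lc_scaleDl.
Qed.

HB.instance Definition _ := GRing.Zmodule_isLmodule.Build k leavitt
  l_scaleA l_scale1 l_scaleDr l_scaleDl.

Lemma lptD a b : lpt (LAdd a b) = lpt a + lpt b.
Proof. by rewrite -l_addE. Qed.

Lemma lptN a : lpt (LOpp a) = - lpt a.
Proof. by rewrite -l_oppE. Qed.

Lemma lptM a b : lpt (LMul a b) = lpt a * lpt b.
Proof. by rewrite -l_mulE. Qed.

Lemma lptZ c a : lpt (LScale c a) = c *: lpt a.
Proof. by rewrite -l_scaleE. Qed.

Lemma lpt0 : lpt LZero = 0. Proof. by []. Qed.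
Lemma lpt1 : lpt LOne = 1. Proof. by []. Qed.

Lemma lpt_sum (I : finType) (P : pred I) (F : I -> lterm) :
  lpt (\big[LAdd/LZero]_(i | P i) F i) = \sum_(i | P i) lpt (F i).
Proof. by apply: (big_morph lpt) => // a b; apply: lptD. Qed.

(* [leavitt] is an associative k-algebra; it is not declared as an [algType]
   because these are nonzero. *)
Lemma leavitt_scaleAl c (x y : leavitt) : c *: (x * y) = (c *: x) * y.
Proof.
elim/l_ind: x => a; elim/l_ind: y => b.
by rewrite -lptM -!lptZ -lptM; apply/lptP/lc_scaleAl.
Qed.

Lemma leavitt_scaleAr c (x y : leavitt) : c *: (x * y) = x * (c *: y).
Proof.
elim/l_ind: x => a; elim/l_ind: y => b.
by rewrite -lptM -!lptZ -lptM; apply/lptP/lc_scaleAr.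
Qed.

Definition l_gen (g : lgen) : leavitt := lpt (LGen g).
Definition l_vertex (v : vertex E) : leavitt := l_gen (Vtx v).
Definition l_edge (e : edge E) : leavitt := l_gen (Edg e).
Definition l_ghost (e : edge E) : leavitt := l_gen (Gst e).

Lemma l_vertex_sum : \sum_v l_vertex v = 1.
Proof. by rewrite -lpt1 -lpt_sum; apply/lptP/lc_unit. Qed.

Section Families.
Variable A : pzRingType.
Variables (V : vertex E -> A) (Ed Gh : edge E -> A).

Definition leavitt_family : Prop :=
  [/\ (forall v, V v * V v = V v) /\ (forall v w, v <> w -> V v * V w = 0),
      forall e, V (src e) * Ed e = Ed e /\ Ed e * V (rng e) = Ed e,
      forall e, V (rng e) * Gh e = Gh e /\ Gh e * V (src e) = Gh e,
      (forall e, Gh e * Ed e = V (rng e)) /\ (forall e f, e <> f -> Gh e * Ed f = 0)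
    & forall v, ~ is_sink v -> V v = \sum_(e | src e == v) Ed e * Gh e].

End Families.

Lemma leavitt_familyP : leavitt_family l_vertex l_edge l_ghost.
Proof.
split; first split.
- by move=> v; rewrite -lptM; apply/lptP/lc_vv.
- by move=> v w vw; rewrite -lptM; apply/lptP/lc_vw.
- by move=> e; rewrite -!lptM; split; apply/lptP; [apply: lc_se|apply: lc_er].
- by move=> e; rewrite -!lptM; split; apply/lptP; [apply: lc_rg|apply: lc_gs].
- split; first by move=> e; rewrite -lptM; apply/lptP/lc_ge.
  by move=> e f ef; rewrite -lptM; apply/lptP/lc_gf.
- move=> v nsv; under eq_bigr do rewrite -lptM.
  by rewrite -lpt_sum; apply/lptP/lc_ck2.
Qed.

Section Universal.
Variables (A : algType k) (V : vertex E -> A) (Ed Gh : edge E -> A).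
Hypothesis fam : leavitt_family V Ed Gh.

Let unitA : A := \sum_v V v.

Fixpoint leval (a : lterm) : A :=
  match a with
  | LGen (Vtx v) => V v
  | LGen (Edg e) => Ed e
  | LGen (Gst e) => Gh e
  | LZero => 0
  | LOne => unitA
  | LAdd a b => leval a + leval b
  | LOpp a => - leval a
  | LMul a b => leval a * leval b
  | LScale c a => c *: leval a
  end.

Fact leval_sum (I : finType) (P : pred I) (F : I -> lterm) :
  leval (\big[LAdd/LZero]_(i | P i) F i) = \sum_(i | P i) leval (F i).
Proof. exact: (big_morph leval). Qed.

Fact unitA_vl v : unitA * V v = V v.
Proof.
case: fam => [[vv vw] _ _ _ _]; rewrite /unitA mulr_suml (bigD1 v) //= vv.
by rewrite big1 ?addr0 // => w /eqP wv; rewrite vw.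
Qed.

Fact unitA_vr v : V v * unitA = V v.
Proof.
case: fam => [[vv vw] _ _ _ _]; rewrite /unitA mulr_sumr (bigD1 v) //= vv.
by rewrite big1 ?addr0 // => w /eqP wv; rewrite vw // => /esym.
Qed.

Fact unitA_leval a : unitA * leval a = leval a /\ leval a * unitA = leval a.
Proof.
have unitAA : unitA * unitA = unitA.
  by rewrite {2 3}/unitA mulr_sumr; apply: eq_bigr => v _; apply: unitA_vl.
case: (fam) => [_ sr rs _ _].
elim: a => [[v|e|e]|||a [al ar] b [bl br]|a [al ar]|a [al ar] b [bl br]|c a [al ar]] /=.
- by rewrite unitA_vl unitA_vr.
- have [sE rE] := sr e; split.
    by rewrite -{1}sE mulrA unitA_vl.
  by rewrite -{1}rE -mulrA unitA_vr.
- have [sE rE] := rs e; split.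
    by rewrite -{1}sE mulrA unitA_vl.
  by rewrite -{1}rE -mulrA unitA_vr.
- by rewrite mulr0 mul0r.
- by [].
- by rewrite mulrDl mulrDr al ar bl br.
- by rewrite mulNr mulrN al ar.
- by rewrite mulrA al -mulrA br.
- by rewrite -scalerAl -scalerAr al ar.
Qed.

Fact leval_congr a b : lcongr a b -> leval a = leval b.
Proof.
move=> ab; case: (fam) => [[vv vw] sr rs [ge gf] ck2].
elim: a b / ab => //=.
- by move=> a b c _ -> _ ->.
- by move=> a a' b b' _ -> _ ->.
- by move=> a a' _ ->.
- by move=> a a' b b' _ -> _ ->.
- by move=> c a a' _ ->.
- by move=> a b c; apply: addrA.
- by move=> a b; apply: addrC.
- by move=> a; apply: add0r.
- by move=> a; apply: addNr.
- by move=> a b c; apply: mulrA.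
- by move=> a; apply: (unitA_leval a).1.
- by move=> a; apply: (unitA_leval a).2.
- by move=> a b c; apply: mulrDl.
- by move=> a b c; apply: mulrDr.
- by move=> c d a; apply: scalerA.
- by move=> a; apply: scale1r.
- by move=> c a b; apply: scalerDr.
- by move=> c d a; apply: scalerDl.
- by move=> c a b; apply: scalerAl.
- by move=> c a b; apply: scalerAr.
- by move=> e; apply: (sr e).1.
- by move=> e; apply: (sr e).2.
- by move=> e; apply: (rs e).1.
- by move=> e; apply: (rs e).2.
- by move=> v /ck2 ->; rewrite leval_sum.
- by rewrite leval_sum.
Qed.

(* The homomorphism is not required to be unital, and the sum of the family
   need not be 1: this is the universal property among all k-algebras. *)
Theorem leavitt_universal :
  exists! f : leavitt -> A,
    [/\ {morph f : x y / x + y}, {morph f : x y / x * y},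
        forall c, {morph f : x / c *: x >-> c *: x}
      & [/\ forall v, f (l_vertex v) = V v, forall e, f (l_edge e) = Ed e
          & forall e, f (l_ghost e) = Gh e]].
Proof.
have fE a : leval (lrp (lpt a)) = leval a by apply/leval_congr/lrpP.
exists (fun x => leval (lrp x)); split.
  split; last by split=> ?; apply: fE.
  - by elim/l_ind=> a; elim/l_ind=> b; rewrite -lptD !fE.
  - by elim/l_ind=> a; elim/l_ind=> b; rewrite -lptM !fE.
  - by move=> c; elim/l_ind=> a; rewrite -lptZ !fE.
move=> g [gD gM gZ [gv ge gg]]; apply: funext; elim/l_ind=> a; rewrite fE.
have g0 : g 0 = 0 by apply: (addrI (g 0)); rewrite -gD !addr0.
elim: a => [[v|e|e]|||a IHa b IHb|a IHa|a IHa b IHb|c a IHa] /=.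
- by rewrite -gv.
- by rewrite -ge.
- by rewrite -gg.
- by rewrite g0.
- rewrite lpt1 -l_vertex_sum (big_morph g gD g0).
  by apply: eq_bigr => v _; rewrite gv.
- by rewrite lptD gD IHa IHb.
- by apply/eqP; rewrite IHa lptN eq_sym -addr_eq0 -gD addNr g0.
- by rewrite lptM gM IHa IHb.
- by rewrite lptZ gZ IHa.
Qed.

End Universal.

Definition l_word (w : seq lgen) : leavitt := \prod_(g <- w) l_gen g.
Definition wdeg (w : seq lgen) : int := \sum_(g <- w) gdeg g.

Definition leavitt_part (n : int) : set leavitt :=
  [set x | exists s : seq (k * seq lgen),
     (forall p, p \in s -> wdeg p.2 = n) /\
     x = \sum_(p <- s) p.1 *: l_word p.2].

(* The elements of leavitt act on maps int -> leavitt, homogeneous elements of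
   degree d shifting the argument by d; this yields the components. *)
Fixpoint lact (a : lterm) (f : int -> leavitt) : int -> leavitt :=
  match a with
  | LGen g => fun n => l_gen g * f (n - gdeg g)
  | LZero => fun=> 0
  | LOne => f
  | LAdd a b => fun n => lact a f n + lact b f n
  | LOpp a => fun n => - lact a f n
  | LMul a b => lact a (lact b f)
  | LScale c a => fun n => c *: lact a f n
  end.

Fact lactD a f g n : lact a (fun m => f m + g m) n = lact a f n + lact a g n.
Proof.
elim: a f g n => [x|||a IHa b IHb|a IHa|a IHa b IHb|c a IHa] f g n /=.
- by rewrite mulrDr.
- by rewrite addr0.
- by [].
- by rewrite IHa IHb addrACA.
- by rewrite IHa opprD.
- by rewrite -IHa; congr (lact a _ n); apply: funext => m; rewrite IHb.
- by rewrite IHa scalerDr.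
Qed.

Fact lactZ a d f n : lact a (fun m => d *: f m) n = d *: lact a f n.
Proof.
elim: a f n => [x|||a IHa b IHb|a IHa|a IHa b IHb|c a IHa] f n /=.
- by rewrite -leavitt_scaleAr.
- by rewrite scaler0.
- by [].
- by rewrite IHa IHb scalerDr.
- by rewrite IHa scalerN.
- by rewrite -IHa; congr (lact a _ n); apply: funext => m; rewrite IHb.
- by rewrite IHa !scalerA mulrC.
Qed.

Fact lact_sum (I : finType) (P : pred I) (F : I -> lterm) f n :
  lact (\big[LAdd/LZero]_(i | P i) F i) f n = \sum_(i | P i) lact (F i) f n.
Proof. exact: (big_morph (fun a => lact a f n)). Qed.

Fact lact_congr a b f : lcongr a b -> lact a f = lact b f.
Proof.
move=> ab; case: leavitt_familyP => [[vv vw] sr rs [ge gf] ck2].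
elim: a b / ab f => //=.
- by move=> a b c _ Hab _ Hbc f; rewrite Hab.
- by move=> a a' b b' _ Ha _ Hb f; rewrite Ha Hb.
- by move=> a a' _ Ha f; rewrite Ha.
- by move=> a a' b b' _ Ha _ Hb f; rewrite Hb Ha.
- by move=> c a a' _ Ha f; rewrite Ha.
- by move=> a b c f; apply: funext => n; apply: addrA.
- by move=> a b f; apply: funext => n; apply: addrC.
- by move=> a f; apply: funext => n; apply: add0r.
- by move=> a f; apply: funext => n; apply: addNr.
- by move=> a b c f; apply: funext => n; apply: lactD.
- by move=> c d a f; apply: funext => n; apply: scalerA.
- by move=> a f; apply: funext => n; apply: scale1r.
- by move=> c a b f; apply: funext => n; apply: scalerDr.
- by move=> c d a f; apply: funext => n; apply: scalerDl.
- by move=> c a b f; apply: funext => n; rewrite lactZ.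
- by move=> v f; apply: funext => n; rewrite !subr0 mulrA -/(l_vertex v) vv.
- by move=> v w vw' f; apply: funext => n; rewrite mulrA [X in X * _]vw // mul0r.
- by move=> e f; apply: funext => n; rewrite subr0 mulrA [X in X * _](sr e).1.
- by move=> e f; apply: funext => n; rewrite subr0 mulrA [X in X * _](sr e).2.
- by move=> e f; apply: funext => n; rewrite subr0 mulrA [X in X * _](rs e).1.
- by move=> e f; apply: funext => n; rewrite subr0 mulrA [X in X * _](rs e).2.
- move=> e f; apply: funext => n.
  by rewrite mulrA [X in X * _]ge opprK addrK subr0.
- by move=> e g eg f; apply: funext => n; rewrite mulrA [X in X * _]gf // mul0r.
- move=> v nsv f; apply: funext => n; rewrite lact_sum /= -/(l_vertex v) ck2 //.
  rewrite subr0 mulr_suml; apply: eq_bigr => e _.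
  by rewrite opprK subrK mulrA.
- move=> f; apply: funext => n; rewrite lact_sum /=.
  under eq_bigr do rewrite subr0.
  by rewrite -mulr_suml [X in X * _]l_vertex_sum mul1r.
Qed.

Definition ldelta (n : int) : leavitt := if n == 0 then 1 else 0.
Definition lproj (n : int) (x : leavitt) : leavitt := lact (lrp x) ldelta n.

Fact lprojE n a : lproj n (lpt a) = lact a ldelta n.
Proof. by rewrite /lproj (lact_congr _ (lrpP a)). Qed.

Fact lprojD n : {morph lproj n : x y / x + y}.
Proof. by elim/l_ind=> a; elim/l_ind=> b; rewrite -lptD !lprojE. Qed.

Fact lprojZ n c x : lproj n (c *: x) = c *: lproj n x.
Proof. by elim/l_ind: x => a; rewrite -lptZ !lprojE. Qed.

Fact lproj0 n : lproj n 0 = 0.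
Proof. exact: lprojE. Qed.

Fact lproj_word n w : lproj n (l_word w) = if wdeg w == n then l_word w else 0.
Proof.
pose tw := foldr (fun g => LMul (LGen g)) LOne.
have twE v : lpt (tw v) = l_word v.
  rewrite /l_word; elim: v => [|g v IH]; first by rewrite big_nil lpt1.
  by rewrite big_cons /= lptM IH.
have act v f m : lact (tw v) f m = l_word v * f (m - wdeg v).
  rewrite /l_word /wdeg; elim: v m => [|g v IH] m /=.
    by rewrite !big_nil mul1r subr0.
  by rewrite !big_cons IH mulrA opprD addrA.
rewrite -{1}twE lprojE act /ldelta subr_eq0 eq_sym.
by case: eqP => _; rewrite ?mulr1 ?mulr0.
Qed.

Fact leavitt_partD n x y : leavitt_part n x -> leavitt_part n y ->
  leavitt_part n (x + y).
Proof.
move=> [s [sn ->]] [t [tn ->]]; exists (s ++ t); rewrite big_cat; split=> // q.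
by rewrite mem_cat => /orP[]; [apply: sn|apply: tn].
Qed.

Fact leavitt_partZ n c x : leavitt_part n x -> leavitt_part n (c *: x).
Proof.
move=> [s [sn ->]]; exists [seq (c * p.1, p.2) | p <- s]; split.
  by move=> q /mapP[p ps ->]; exact: (sn p ps).
by rewrite big_map scaler_sumr; apply: eq_bigr => p _; rewrite scalerA.
Qed.

Fact leavitt_part0 n : leavitt_part n 0.
Proof. by exists [::]; rewrite big_nil. Qed.

Fact leavitt_part_word w : leavitt_part (wdeg w) (l_word w).
Proof.
exists [:: (1, w)]; rewrite big_seq1 scale1r; split=> // q.
by rewrite inE => /eqP->.
Qed.

Fact leavitt_part_mul m n x y : leavitt_part m x -> leavitt_part n y ->
  leavitt_part (m + n) (x * y).
Proof.
move=> [s [sm ->]] [t [tn ->]]; rewrite mulr_suml big_seq.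
elim/big_ind: _ => [|u v|p ps]; [exact: leavitt_part0|exact: leavitt_partD|].
rewrite mulr_sumr big_seq.
elim/big_ind: _ => [|u v|q qt]; [exact: leavitt_part0|exact: leavitt_partD|].
rewrite -leavitt_scaleAl -leavitt_scaleAr; do 2!apply: leavitt_partZ.
rewrite -(sm p ps) -(tn q qt).
have -> : l_word p.2 * l_word q.2 = l_word (p.2 ++ q.2) by rewrite /l_word big_cat.
have -> : wdeg p.2 + wdeg q.2 = wdeg (p.2 ++ q.2) by rewrite /wdeg big_cat.
exact: leavitt_part_word.
Qed.

Fact leavitt_span x : exists s : seq (k * seq lgen),
  x = \sum_(p <- s) p.1 *: l_word p.2.
Proof.
elim/l_ind: x; elim=> [g|||a [s sE] b [t tE]|a [s sE]|a [s sE] b [t tE]|c a [s sE]].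
- by exists [:: (1, [:: g])]; rewrite big_seq1 scale1r /l_word big_seq1.
- by exists [::]; rewrite big_nil.
- by exists [:: (1, [::])]; rewrite big_seq1 scale1r /l_word big_nil.
- by exists (s ++ t); rewrite lptD big_cat sE tE.
- exists [seq (- p.1, p.2) | p <- s]; rewrite lptN big_map sE -sumrN.
  by apply: eq_bigr => p _; rewrite scaleNr.
- exists [seq (p.1 * q.1, p.2 ++ q.2) | p <- s, q <- t].
  rewrite lptM sE tE big_allpairs_dep /= mulr_suml; apply: eq_bigr => p _.
  rewrite mulr_sumr; apply: eq_bigr => q _.
  by rewrite -leavitt_scaleAl -leavitt_scaleAr scalerA /l_word big_cat.
- exists [seq (c * p.1, p.2) | p <- s]; rewrite lptZ big_map sE scaler_sumr.
  by apply: eq_bigr => p _; rewrite scalerA.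
Qed.

Fact leavitt_grading : is_grading leavitt_part.
Proof.
apply: (@is_gradingP _ _ lproj) => //.
- exact: leavitt_part0.
- move=> n x y Cx Cy; apply: leavitt_partD => //.
  by rewrite -scaleN1r; apply: leavitt_partZ.
- exact: lprojD.
- move=> m n x [s [sm ->]]; rewrite (big_morph _ (lprojD n) (lproj0 n)) /=.
  have H p : p \in s -> lproj n (p.1 *: l_word p.2) =
      if m == n then p.1 *: l_word p.2 else 0.
    move=> ps; rewrite lprojZ lproj_word.
    rewrite (sm p ps).
    by case: ifP => // _; rewrite scaler0.
  rewrite big_seq (eq_bigr _ H) -big_seq.
  by case: ifP => // _; rewrite big1.
- move=> x; have [s ->] := leavitt_span x.
  exists [seq (wdeg p.2, p.1 *: l_word p.2) | p <- s]; split; last by rewrite big_map.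
  by move=> q /mapP[p _ ->] /=; apply/leavitt_partZ/leavitt_part_word.
Qed.

Fact leavitt_part_one : leavitt_part 0 1.
Proof. by have := leavitt_part_word [::]; rewrite /wdeg /l_word !big_nil. Qed.

Definition leavitt_path_algebra : grRing :=
  GrRing leavitt_grading leavitt_part_one leavitt_part_mul.

End Leavitt.

(* Main.v *)
Require Import Defs.
From HB Require Import structures.
From mathcomp Require Import all_boot all_order all_algebra.
From mathcomp Require Import boolp classical_sets.

(** Write L for a Leavitt path algebra of a finite graph without sinks, v, w for
    its vertices. The proof has two halves.

    Structure of graded projectives over L. Without sinks the relation
    v = \sum_(src e = v) e e^* applies at every vertex and gives
    vL = \oplus_(src e = v) r(e)L(-1). So a module which is a direct sum of copies
    of the wL(-n) is also one of copies of the wL(-n-1), and so on. A homogeneous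
    map between such sums is a matrix with entries in L_0, and replacing the
    generators by their products with the paths of length d conjugates this
    matrix by paths: an entry a becomes the block of all p^* a q, with p and q of
    length d. For d large these elements are scalar multiples of vertices
    ([gr_part0_vlevel]); hence after enough expansion every map is a family of
    scalar matrices, one for each vertex. Two facts follow from linear algebra
    over the field. A scalar idempotent splits, so every finitely generated graded
    projective module is a direct sum of shifted vertex modules
    ([fgProj_multiplicity]). An invertible scalar matrix is square, so the number
    of summands of each kind is eventually determined by the module, and equality
    of classes in the graded Grothendieck group is graded isomorphism
    ([k0_class_inj]). This group is also generated by the classes of the vL and
    their shifts ([k0_additive_eq]).

    Lifting alpha. By positivity alpha [vL(E)] = [Q_v] for a graded projective
    module Q_v over L(F). As alpha is pointed and linear, the classes of the Q_v
    add up to [L(F)], and [Q_v] is the sum of the [Q_r(e)(-1)] over the edges e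
    leaving v. By cancellation these equations are realized by isomorphisms
    L(F) = \oplus_v Q_v and Q_v = \oplus_(src e = v) Q_r(e)(-1). Composing their
    injections and projections gives homogeneous endomorphisms of the right
    module L(F), i.e. homogeneous elements of L(F), that satisfy the relations of L(E)
    ([fam_leavitt]): this is psi. The vertex v is sent to the projection onto Q_v,
    so vL(E) tensored with L(F) is Q_v ([tensor_corner]); thus K_0(psi) and alpha
    agree on generators. *)

Set Implicit Arguments.
Unset Strict Implicit.
Unset Printing Implicit Defensive.

Import Order.TTheory GRing.Theory Num.Theory.
Local Open Scope ring_scope.

(** * Right actions and homogeneous maps *)

Definition ract (T : grRing) (M : grMod T) (x : M) (t : T) : M := (t : T^c) *: x.
Notation "x <* t" := (ract x t) (at level 40, left associativity).

Section RightAction.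
Variable T : grRing.
Implicit Types (M N : grMod T) (s t : T).

Lemma ractA M (x : M) s t : x <* s <* t = x <* (s * t).
Proof. exact: scaler_conv. Qed.

Lemma ract1 M (x : M) : x <* 1 = x.
Proof. exact: scale1r. Qed.

Lemma ractDl M (x y : M) t : (x + y) <* t = x <* t + y <* t.
Proof. exact: scalerDr. Qed.

Lemma ractDr M (x : M) s t : x <* (s + t) = x <* s + x <* t.
Proof. exact: scalerDl. Qed.

Lemma ract0l M t : (0 : M) <* t = 0.
Proof. exact: scaler0. Qed.

Lemma ract0r M (x : M) : x <* 0 = 0.
Proof. exact: scale0r. Qed.

Lemma ract_suml M (I : Type) (r : seq I) (P : pred I) (F : I -> M) t :
  (\sum_(i <- r | P i) F i) <* t = \sum_(i <- r | P i) F i <* t.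
Proof. by apply: (big_morph (fun x => x <* t)) => [x y|]; rewrite ?ractDl ?ract0l. Qed.

Lemma ract_sumr M (x : M) (I : Type) (r : seq I) (P : pred I) (F : I -> T) :
  x <* (\sum_(i <- r | P i) F i) = \sum_(i <- r | P i) x <* F i.
Proof. by apply: (big_morph (ract x)) => [s t|]; rewrite ?ractDr ?ract0r. Qed.

Lemma ract_part M m n (x : M) t :
  gm_part m x -> gr_part n t -> gm_part (m + n) (x <* t).
Proof. exact: gm_act. Qed.

Lemma ract_part0 M n (x : M) t : gm_part n x -> gr_part 0 t -> gm_part n (x <* t).
Proof. by move=> Cx Ct; have := ract_part Cx Ct; rewrite addr0. Qed.

Lemma hom_ract M N (f : grHom M N) x t : f (x <* t) = f x <* t.
Proof. exact: linearZ. Qed.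

Lemma homD M N (f : grHom M N) x y : f (x + y) = f x + f y.
Proof. exact: linearD. Qed.

Lemma hom0 M N (f : grHom M N) : f 0 = 0.
Proof. exact: linear0. Qed.

Lemma hom_sum M N (f : grHom M N) (I : Type) (r : seq I) (P : pred I) (F : I -> M) :
  f (\sum_(i <- r | P i) F i) = \sum_(i <- r | P i) f (F i).
Proof. exact: (big_morph f (homD f) (hom0 f)). Qed.

Lemma hom_reg N (f : grHom (regularM T) N) t : f t = f (1 : T) <* t.
Proof. by rewrite -hom_ract; congr (f _); rewrite -[RHS]/((1 : T) * t) mul1r. Qed.

Lemma gm_part_sum M n (I : Type) (r : seq I) (P : pred I) (F : I -> M) :
  (forall i, P i -> gm_part n (F i)) -> gm_part n (\sum_(i <- r | P i) F i).
Proof.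
move=> FP; elim/big_ind: _ => [|x y|i]; last exact: FP.
  exact: grading0 (gm_grading M) _.
exact: (gradingD (gm_grading M)).
Qed.

Lemma gr_part_sum n (I : Type) (r : seq I) (P : pred I) (F : I -> T) :
  (forall i, P i -> gr_part n (F i)) -> gr_part n (\sum_(i <- r | P i) F i).
Proof.
move=> FP; elim/big_ind: _ => [|x y|i]; last exact: FP.
  exact: grading0 (gr_grading T) _.
exact: (gradingD (gr_grading T)).
Qed.

Lemma hom_exists M N (f : M -> N) :
  (forall x y, f (x + y) = f x + f y) -> (forall x t, f (x <* t) = f x <* t) ->
  (forall n x, gm_part n x -> gm_part n (f x)) ->
  exists g : grHom M N, g =1 f.
Proof.
move=> fD fZ fd.
have flin : linear f by move=> a x y; rewrite fD -[a *: x]/(x <* a) fZ.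
by exists (mkHom flin fd).
Qed.

End RightAction.

(** * Frames: homogeneous dual bases *)

Section Frames.
Variable T : grRing.
Implicit Types (M N : grMod T).

Definition functional M (n : int) (phi : M -> T) : Prop :=
  [/\ forall x y, phi (x + y) = phi x + phi y,
      forall x t, phi (x <* t) = phi x * t
    & forall m x, gm_part m x -> gr_part (m - n) (phi x)].

(** A frame identifies M with the direct sum of the right ideals eps_i T, all
    shifted by -n. Describing this by elements and functionals rather than by an
    isomorphism with a constructed module makes change of frame a computation in T. *)
Record frame M (n : int) (I : finType) (eps : I -> T) := Frame {
  fvec : I -> M;
  fcov : I -> M -> T;
  fvec_part : forall i, gm_part n (fvec i);
  fcov_functional : forall i, functional n (fcov i);
  fcov_vec : forall i j, fcov i (fvec j) = if i == j then eps i else 0;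
  frame_sum : forall x, x = \sum_i fvec i <* fcov i x
}.

Section Functional.
Variables (M : grMod T) (n : int) (phi : M -> T).
Hypothesis phiP : functional n phi.

Lemma fctD x y : phi (x + y) = phi x + phi y.
Proof. by case: phiP. Qed.

Lemma fct_ract x t : phi (x <* t) = phi x * t.
Proof. by case: phiP. Qed.

Lemma fct_part m x : gm_part m x -> gr_part (m - n) (phi x).
Proof. by case: phiP => _ _; apply. Qed.

Lemma fct0 : phi 0 = 0.
Proof. by apply: (addrI (phi 0)); rewrite -fctD !addr0. Qed.

Lemma fct_sum (I : Type) (r : seq I) (P : pred I) (F : I -> M) :
  phi (\sum_(i <- r | P i) F i) = \sum_(i <- r | P i) phi (F i).
Proof. exact: (big_morph phi fctD fct0). Qed.

Lemma functional_comp N (f : grHom N M) : functional n (phi \o f).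
Proof.
split=> [x y|x t|m x Cx] /=; first by rewrite linearD fctD.
  by rewrite hom_ract fct_ract.
exact/fct_part/hom_deg.
Qed.

Lemma functional_mul d (a : T) : gr_part d a ->
  functional (n - d) (fun x => a * phi x).
Proof.
move=> Ca; split=> [x y|x t|m x Cx]; first by rewrite fctD mulrDr.
  by rewrite fct_ract mulrA.
have -> : m - (n - d) = d + (m - n) by rewrite opprB addrCA addrA.
by apply: gr_mul => //; apply: fct_part.
Qed.

Lemma functional_mul0 (a : T) : gr_part 0 a -> functional n (fun x => a * phi x).
Proof. by move=> Ca; have := functional_mul Ca; rewrite subr0. Qed.

End Functional.

Lemma functional_sum M n (I : Type) (r : seq I) (phi : I -> M -> T) :
  (forall i, functional n (phi i)) ->
  functional n (fun x => \sum_(i <- r) phi i x).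
Proof.
move=> phiP; split=> [x y|x t|m x Cx].
- by rewrite -big_split; apply: eq_bigr => i _; rewrite (fctD (phiP i)).
- by rewrite mulr_suml; apply: eq_bigr => i _; rewrite (fct_ract (phiP i)).
- by apply: gr_part_sum => i _; apply: fct_part (phiP i) _ _ Cx.
Qed.

Section FrameTheory.
Variables (M : grMod T) (n : int) (I : finType) (eps : I -> T).
Variable fr : frame M n eps.
Local Notation x_ := (fvec fr).
Local Notation phi := (fcov fr).

Lemma fvec_eps i : x_ i <* eps i = x_ i.
Proof.
rewrite [RHS](frame_sum fr) (bigD1 i) //= fcov_vec eqxx big1 ?addr0 // => j ji.
by rewrite fcov_vec (negPf ji) ract0r.
Qed.

Lemma eps_fcov i y : eps i * phi i y = phi i y.
Proof.
rewrite [y in RHS](frame_sum fr) (fct_sum (fcov_functional fr i)) (bigD1 i) //=.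
rewrite (fct_ract (fcov_functional fr i)) fcov_vec eqxx big1 ?addr0 // => j ji.
by rewrite (fct_ract (fcov_functional fr i)) fcov_vec eq_sym (negPf ji) mul0r.
Qed.

(** Indices with eps_i = 0 can be dropped, so multiplicities are compared only at
    vertices which are nonzero in L. *)
Lemma fvec_eq0 i : eps i = 0 -> x_ i = 0.
Proof. by move=> e0; rewrite -fvec_eps e0 ract0r. Qed.

Lemma frame_lift N (a : I -> N) : (forall i, gm_part n (a i)) ->
  exists h : grHom M N, forall y, h y = \sum_i a i <* phi i y.
Proof.
move=> Ca; have fP := fcov_functional fr.
apply: (hom_exists (f := fun y => \sum_i a i <* phi i y)) => [y z|y t|m y Cy].
- by rewrite -big_split; apply: eq_bigr => i _; rewrite (fctD (fP i)) ractDr.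
- by rewrite ract_suml; apply: eq_bigr => i _; rewrite (fct_ract (fP i)) ractA.
- apply: gm_part_sum => i _; rewrite -[m](subrK n) addrC.
  by apply: ract_part => //; apply: fct_part (fP i) _ _ Cy.
Qed.

Lemma frame_fin_gen : fin_gen M.
Proof.
exists #|I|, (x_ \o enum_val) => y; exists (fun i => phi (enum_val i) y).
rewrite {1}[y](frame_sum fr) (reindex_onto enum_val enum_rank) /=.
  by apply: eq_bigl => i; rewrite enum_valK eqxx.
by move=> i _; rewrite enum_rankK.
Qed.

(** As for free modules: lift the images of the vectors of the frame,
    choosing homogeneous lifts. *)
Lemma frame_projective : gr_projective M.
Proof.
move=> A B g f gs.
have aP i : exists a : A, gm_part n a /\ g a = f (x_ i).
  have [a ga] := gs (f (x_ i)); exists (component (gm_grading A) n a).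
  split; first exact: componentP.
  rewrite -hom_component ga (@component_homog _ _ _ n) ?eqxx //.
  exact/hom_deg/fvec_part.
have [h hE] := frame_lift (fun i => (projT2 (cid (aP i))).1).
exists h => y; rewrite hE hom_sum [in RHS](frame_sum fr y) hom_sum.
apply: eq_bigr => i _; rewrite !hom_ract; congr (_ <* _).
by case: cid => a [].
Qed.

Lemma frame_iso N : grIso M N -> inhabited (frame N n eps).
Proof.
case=> f [g [fK gK]].
have H1 i j : (phi i \o g) (f (x_ j)) = if i == j then eps i else 0.
  by rewrite /= fK fcov_vec.
have H2 y : y = \sum_i f (x_ i) <* (phi i \o g) y.
  rewrite -{1}[y]gK {1}(frame_sum fr (g y)) hom_sum.
  by apply: eq_bigr => i _; rewrite hom_ract.
exact: (inhabits (Frame (fun i => hom_deg f (fvec_part fr i))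
  (fun i => functional_comp (fcov_functional fr i) g) H1 H2)).
Qed.

Lemma frame_shift d : frame (shiftM d M) (n - d) eps.
Proof.
have H1 i : @gm_part T (shiftM d M) (n - d) (x_ i).
  by rewrite /= /shift_part addrC subrK; apply: fvec_part.
have H2 i : @functional (shiftM d M) (n - d) (phi i).
  have [fD fZ fd] := fcov_functional fr i; split=> // m y Cy.
  by rewrite opprB addrA [m + d]addrC; apply: fd.
exact: (@Frame (shiftM d M) (n - d) _ eps x_ phi H1 H2 (fcov_vec fr) (frame_sum fr)).
Qed.

Lemma frame_reindex (J : finType) (h : J -> I) : injective h ->
  (forall i, i \notin codom h -> eps i = 0) ->
  frame M n (eps \o h).
Proof.
move=> hinj h0.
have H1 i j : phi (h i) (x_ (h j)) = if i == j then eps (h i) else 0.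
  by rewrite fcov_vec (inj_eq hinj).
have H2 y : y = \sum_j x_ (h j) <* phi (h j) y.
  rewrite {1}[y](frame_sum fr) (bigID (mem (codom h))) /= [X in _ + X]big1 ?addr0.
    rewrite -[LHS]big_uniq ?/codom ?/image_mem; last exact/injectiveP.
    by rewrite big_map big_enum.
  by move=> i /h0 e0; rewrite fvec_eq0 // ract0l.
exact: (@Frame M n J (eps \o h) (x_ \o h) (fun j => phi (h j))
  (fun j => fvec_part fr (h j)) (fun j => fcov_functional fr (h j)) H1 H2).
Qed.

End FrameTheory.

(** Send the vectors of one frame to those of the other; the relation
    x_i eps_i = x_i makes the two maps inverse to each other. *)
Lemma frames_iso M N n (I : finType) (eps : I -> T) :
  frame M n eps -> frame N n eps -> grIso M N.
Proof.
move=> fr fr'.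
have [f fE] := frame_lift fr (fvec_part fr').
have [g gE] := frame_lift fr' (fvec_part fr).
have K (A B : grMod T) (f1 : frame A n eps) (f2 : frame B n eps)
    (f' : grHom A B) (g' : grHom B A) :
    (forall y, f' y = \sum_i fvec f2 i <* fcov f1 i y) ->
    (forall y, g' y = \sum_i fvec f1 i <* fcov f2 i y) -> cancel f' g'.
  move=> f'E g'E y; rewrite f'E hom_sum [RHS](frame_sum f1).
  apply: eq_bigr => i _; rewrite hom_ract g'E ract_suml (bigD1 i) //=.
  rewrite fcov_vec eqxx ractA eps_fcov big1 ?addr0 // => j ji.
  by rewrite fcov_vec (negPf ji) ract0r ract0l.
by exists f, g; split; [apply: K fE gE|apply: K gE fE].
Qed.

Definition sum_eps (I J : finType) (eps : I -> T) (eps' : J -> T) (i : I + J) : T :=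
  match i with inl i => eps i | inr j => eps' j end.

Lemma frame_sumM M N n (I J : finType) (eps : I -> T) (eps' : J -> T) :
  frame M n eps -> frame N n eps' ->
  frame (sumM M N) n (sum_eps eps eps').
Proof.
move=> fr fr'.
pose x (i : I + J) : sumM M N :=
  match i with inl i => (fvec fr i, 0) | inr j => (0, fvec fr' j) end.
pose phi (i : I + J) (y : sumM M N) : T :=
  match i with inl i => fcov fr i y.1 | inr j => fcov fr' j y.2 end.
have H1 i : gm_part n (x i).
  by case: i => i; split; solve [exact: fvec_part|apply: grading0; apply: gm_grading].
have H2 i : functional n (phi i).
  case: i => i; split=> [y z|y t|m y [C1 C2]] /=.
  - exact: (fctD (fcov_functional fr i)).
  - exact: (fct_ract (fcov_functional fr i)).
  - exact: (fct_part (fcov_functional fr i)).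
  - exact: (fctD (fcov_functional fr' i)).
  - exact: (fct_ract (fcov_functional fr' i)).
  - exact: (fct_part (fcov_functional fr' i)).
have H3 i j : phi i (x j) = if i == j then sum_eps eps eps' i else 0.
  case: i j => i [] j //=; rewrite ?fcov_vec ?(fct0 (fcov_functional _ _)) //;
  by case: (i =P j) => [->|ij]; rewrite ?eqxx //; case: eqP => // -[].
have H4 y : y = \sum_i x i <* phi i y.
  rewrite big_sumType /=.
  have yE : y = inlHom M N y.1 + inrHom M N y.2.
    by case: y => y z; rewrite -[RHS]/(y + 0, 0 + z) addr0 add0r.
  rewrite [LHS]yE {1}(frame_sum fr y.1) {1}(frame_sum fr' y.2) !hom_sum.
  by congr (_ + _); apply: eq_bigr => i _; rewrite hom_ract.
exact: (Frame H1 H2 H3 H4).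
Qed.

End Frames.

(** * Degree zero elements are eventually scalar *)

Section LeavittBasics.
Variables (k : fieldType) (E : digraph).
Local Notation L := (leavitt_path_algebra k E).

Definition vtx (v : vertex E) : L := l_vertex k v.
Definition edg (e : edge E) : L := l_edge k e.
Definition gst (e : edge E) : L := l_ghost k e.
(** As graded modules are taken over a ring, the field acts on them through
    central elements. *)
Definition cst (c : k) : L := c *: (1 : leavitt k E).

Lemma vtxM v w : vtx v * vtx w = if v == w then vtx v else 0.
Proof.
case: (leavitt_familyP k E) => [[vv vw] _ _ _ _].
by case: eqP => [<-|]; [exact: vv|exact: vw].
Qed.

Lemma gst_vtx e v : gst e * vtx v = if src e == v then gst e else 0.
Proof.
have [_ _ rg _ _] := leavitt_familyP k E.
have <- : gst e * vtx (src e) = gst e := (rg e).2.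
by rewrite -mulrA vtxM; case: eqP => [->|_] //; rewrite mulr0.
Qed.

Lemma gst_edg e f : gst e * edg f = if e == f then vtx (rng e) else 0.
Proof.
have [_ _ _ [ge gf] _] := leavitt_familyP k E.
by case: eqP => [<-|]; [exact: ge|exact: gf].
Qed.

Lemma vtx_sum : \sum_v vtx v = 1.
Proof. exact: l_vertex_sum. Qed.

Lemma gen_part g : @gr_part L (gdeg g) (l_gen k g).
Proof.
have := @leavitt_part_word k E [:: g].
by rewrite /wdeg /l_word !big_seq1.
Qed.

Lemma vtx_part v : @gr_part L 0 (vtx v). Proof. exact: (gen_part (Vtx v)). Qed.
Lemma edg_part e : @gr_part L 1 (edg e). Proof. exact: (gen_part (Edg e)). Qed.
Lemma gst_part e : @gr_part L (-1) (gst e). Proof. exact: (gen_part (Gst e)). Qed.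

Lemma cst_part c : @gr_part L 0 (cst c).
Proof. exact/leavitt_partZ/leavitt_part_one. Qed.

Lemma cst_vtx_part c v : @gr_part L 0 (cst c * vtx v).
Proof. by rewrite -[0]addr0; apply: gr_mul; [apply: cst_part|apply: vtx_part]. Qed.

Lemma scale_cst c (x : L) : c *: (x : leavitt k E) = cst c * x.
Proof.
rewrite -[RHS]/((c *: (1 : leavitt k E)) * (x : leavitt k E)) -leavitt_scaleAl.
by rewrite mul1r.
Qed.

Lemma cstC c (x : L) : cst c * x = x * cst c.
Proof.
rewrite -scale_cst -[RHS]/((x : leavitt k E) * (c *: (1 : leavitt k E))).
by rewrite -leavitt_scaleAr mulr1.
Qed.

Lemma cstD c d : cst (c + d) = cst c + cst d.
Proof. exact: scalerDl. Qed.

Lemma cst0 : cst 0 = 0.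
Proof. exact: scale0r. Qed.

Lemma cst1 : cst 1 = 1.
Proof. exact: scale1r. Qed.

Lemma cstM c d : cst (c * d) = cst c * cst d.
Proof. by rewrite -scale_cst /cst scalerA. Qed.

Lemma cst_sum (I : Type) (r : seq I) (P : pred I) (F : I -> k) :
  cst (\sum_(i <- r | P i) F i) = \sum_(i <- r | P i) cst (F i).
Proof. exact: (big_morph cst cstD cst0). Qed.

Lemma cst_vtx_inj v c d : vtx v <> 0 -> cst c * vtx v = cst d * vtx v -> c = d.
Proof.
move=> v0 /eqP; rewrite -subr_eq0 -mulrBl.
have -> : cst c - cst d = cst (c - d) by rewrite cstD /cst scaleNr.
move/eqP => cdv; apply/eqP; rewrite -subr_eq0; apply/eqP.
case: (eqVneq (c - d) 0) => // cd0; case: v0.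
by rewrite -[vtx v]mul1r -cst1 -(mulVf cd0) cstM -mulrA cdv mulr0.
Qed.

Definition vspan (a : L) : Prop := exists c : vertex E -> k, a = \sum_v cst (c v) * vtx v.

Lemma vspan0 : vspan 0.
Proof. by exists (fun=> 0); rewrite big1 // => v _; rewrite cst0 mul0r. Qed.

Lemma vspanD a b : vspan a -> vspan b -> vspan (a + b).
Proof.
move=> [c ->] [d ->]; exists (fun v => c v + d v).
by rewrite -big_split; apply: eq_bigr => v _; rewrite cstD mulrDl.
Qed.

Lemma vspanZ c a : vspan a -> vspan (cst c * a).
Proof.
move=> [d ->]; exists (fun v => c * d v).
by rewrite mulr_sumr; apply: eq_bigr => v _; rewrite cstM mulrA.
Qed.

Lemma vspan_vtx v : vspan (vtx v).
Proof.
exists (fun w => (w == v)%:R); rewrite (bigD1 v) //= eqxx cst1 mul1r.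
by rewrite big1 ?addr0 // => w /negPf ->; rewrite cst0 mul0r.
Qed.

Lemma vspan1 : vspan 1.
Proof. by rewrite -vtx_sum; elim/big_ind: _ => *; [exact: vspan0|exact: vspanD|exact: vspan_vtx]. Qed.

(** The vertices are orthogonal idempotents, so corners of their span are
    scalar. *)
Lemma vspan_corner a v w : vspan a ->
  exists c, vtx v * a * vtx w = if v == w then cst c * vtx v else 0.
Proof.
move=> [c ->]; exists (c v).
have H u : vtx v * (cst (c u) * vtx u) = if v == u then cst (c v) * vtx v else 0.
  by rewrite mulrA -cstC -mulrA vtxM; case: eqP => [->|_] //; rewrite mulr0.
rewrite mulr_sumr (bigD1 v) //= H eqxx big1 ?addr0; last first.
  by move=> u uv; rewrite H eq_sym (negPf uv).
by rewrite -mulrA vtxM; case: eqP => // _; rewrite mulr0.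
Qed.

(** The elements which become scalar after expanding rows and columns d times;
    the recursion matches one step of [expand_frame]. *)
Fixpoint vlevel (d : nat) (a : L) : Prop :=
  if d is d'.+1 then forall e f, vlevel d' (gst e * a * edg f) else vspan a.

(** The empty path is 1, the sum of all vertices. Sequences of edges that are not
    composable are allowed, as their products vanish. *)
Definition gpath (p : seq (edge E)) : L := foldr (fun e a => a * gst e) 1 p.
Definition epath (p : seq (edge E)) : L := foldr (fun e a => edg e * a) 1 p.

Lemma vlevel_paths d a :
  (forall p q, size p = d -> size q = d -> vspan (gpath p * a * epath q)) -> vlevel d a.
Proof.
elim: d a => [|d IH] a H /=.
  by have := H [::] [::] erefl erefl; rewrite mul1r mulr1.
move=> e f; apply: IH => p q sp sq.
by have := H (e :: p) (f :: q); rewrite /= sp sq !mulrA; apply.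
Qed.

(** The analogue for degree m of membership in every sufficiently high
    [vlevel]: in degree m the two paths differ in length by m. Allowing all m lets
    one prepend the generators of a word one at a time. *)
Definition eventually_vspan (m : int) (a : L) : Prop :=
  exists N : nat, forall p q, (N <= size p)%N -> (N <= size q)%N ->
    (size p)%:Z = (size q)%:Z + m -> vspan (gpath p * a * epath q).

Lemma gpath_vtx e p v : exists b : bool, gpath (e :: p) * vtx v = if b then gpath (e :: p) else 0.
Proof.
exists (src e == v); rewrite /= -mulrA gst_vtx; by case: eqP => //; rewrite mulr0.
Qed.

Lemma eventually_vspan1 : eventually_vspan 0 1.
Proof.
exists 0 => p q _ _; rewrite addr0 => -[]; rewrite mulr1.
elim: p q => [|e p IH] [|f q] //= => [_|[spq]]; first by rewrite mulr1; apply: vspan1.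
rewrite -mulrA [gst e * _]mulrA gst_edg.
case: eqP => [_|_]; last by rewrite mul0r mulr0; apply: vspan0.
case: p q spq IH => [|e' p] [|f' q] // spq IH.
  by rewrite mulr1 mul1r; apply: vspan_vtx.
rewrite mulrA; have [[] ->] := gpath_vtx e' p (rng e); last by rewrite mul0r; apply: vspan0.
by apply: IH.
Qed.

(** A ghost edge e^* only lengthens the left path. An edge is cancelled against
    the first edge of the left path, and a vertex is absorbed by it; this is why
    the path is required to be longer than for a. *)
Lemma eventually_vspan_gen g m a : eventually_vspan m a ->
  eventually_vspan (gdeg g + m) ((l_gen k g : L) * a).
Proof.
move=> [N NP]; exists N.+2 => -[|e1 [|e2 p]] //= q.
rewrite !ltnS => sp sq spq.
case: g spq => [v|e|e] /= spq.
- rewrite -[l_gen k _]/(vtx v) mulrA.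
  rewrite add0r in spq.
  have [[] ->] := gpath_vtx e1 (e2 :: p) v; last by rewrite !mul0r; apply: vspan0.
  by apply: NP => //=; [rewrite ltnW // ltnW // ltnS|rewrite ltnW // ltnW].
- rewrite -[l_gen k _]/(edg e) mulrA -[_ * _ * gst e1 * _]mulrA gst_edg.
  case: eqP => _; last by rewrite mulr0 !mul0r; apply: vspan0.
  have [[] ->] := gpath_vtx e2 p (rng e1); last by rewrite !mul0r; apply: vspan0.
  apply: NP => //=; [by rewrite ltnW // ltnS|by rewrite ltnW // ltnW|].
  by apply: (addrI 1); rewrite -intS spq addrCA.
- rewrite -[l_gen k _]/(gst e) mulrA.
  have := NP (e :: e1 :: e2 :: p) q; apply => /=.
  + by do 3 apply: leqW.
  + by do 2 apply: ltnW.
  by rewrite intS spq addrCA [1 + (_ + _)]addrA subrr add0r.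
Qed.

Lemma eventually_vspanD m a b : eventually_vspan m a -> eventually_vspan m b ->
  eventually_vspan m (a + b).
Proof.
move=> [N NP] [N' NP']; exists (maxn N N') => p q.
rewrite !geq_max => /andP[p1 p2] /andP[q1 q2] spq.
by rewrite mulrDr mulrDl; apply: vspanD; [apply: NP|apply: NP'].
Qed.

Lemma eventually_vspanZ m c a : eventually_vspan m a -> eventually_vspan m (cst c * a).
Proof.
move=> [N NP]; exists N => p q sp sq spq.
by rewrite mulrA -cstC -!mulrA; apply: vspanZ; rewrite mulrA; apply: NP.
Qed.

Lemma gr_part_eventually m a : @gr_part L m a -> eventually_vspan m a.
Proof.
move=> [s [sm ->]]; rewrite big_seq.
elim/big_ind: _ => [|x y|[c w] cw] //.
- by exists 0 => p q _ _ _; rewrite mulr0 mul0r; apply: vspan0.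
- exact: eventually_vspanD.
- rewrite scale_cst; apply: eventually_vspanZ; rewrite -(sm _ cw) /=.
  elim: w {cw} => [|g w IH]; first by rewrite /wdeg /l_word !big_nil; apply: eventually_vspan1.
  by rewrite /wdeg /l_word !big_cons; apply: eventually_vspan_gen.
Qed.

Lemma gr_part0_vlevel a : @gr_part L 0 a ->
  exists N, forall d, (N <= d)%N -> vlevel d a.
Proof.
move=> /gr_part_eventually[N NP]; exists N => d Nd; apply: vlevel_paths => p q sp sq.
by apply: NP; rewrite ?sp ?sq ?addr0.
Qed.

End LeavittBasics.

(** * Expanding frames along edges *)

Section VertexFrames.
Variables (k : fieldType) (E : digraph).
Hypothesis hE : no_sinks E.
Local Notation L := (leavitt_path_algebra k E).
Local Notation V := (@vtx k E).
Implicit Types (M N : grMod L).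

Definition vframe M n (I : finType) (w : I -> vertex E) := frame M n (fun i => V (w i)).

Definition multiplicity (I : finType) (w : I -> vertex E) (v : vertex E) : nat :=
  #|[pred i | w i == v]|.

(** The effect on multiplicities of replacing vL by the sum of the r(e)L. *)
Definition adjacency (m : vertex E -> nat) (v : vertex E) : nat :=
  (\sum_(e | rng e == v) m (src e))%N.

Lemma vtx_ck2 v : V v = \sum_(e | src e == v) edg k e * gst k e.
Proof. by case: (leavitt_familyP k E) => _ _ _ _ /(_ v); apply; apply: hE. Qed.

(** By v = \sum_(src e = v) e e^* the vectors x_i e and the functionals e^* phi_i,
    for e leaving w_i, again form a frame. *)
Section Expand.
Variables (M : grMod L) (n : int) (I : finType) (w : I -> vertex E).
Variable fr : vframe M n w.

Definition expand_index : finType := {p : I * edge E | w p.1 == src p.2}.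
Definition expand_vertex (p : expand_index) : vertex E := rng (val p).2.

Let x_ (p : expand_index) : M := fvec fr (val p).1 <* edg k (val p).2.
Let phi (p : expand_index) (y : M) : L := gst k (val p).2 * fcov fr (val p).1 y.

Fact expand_part p : gm_part (n + 1) (x_ p).
Proof. by apply: ract_part; [apply: fvec_part|apply: edg_part]. Qed.

Fact expand_functional p : functional (n + 1) (phi p).
Proof.
rewrite -[1]opprK; apply: functional_mul (gst_part _ _).
exact: fcov_functional.
Qed.

Fact expand_dual p q : phi p (x_ q) = if p == q then V (expand_vertex p) else 0.
Proof.
rewrite /phi /x_ /expand_vertex (fct_ract (fcov_functional fr _)) fcov_vec.
rewrite -(inj_eq val_inj); have := valP p.
case: (val p) (val q) => [i e] [j f] /= we; rewrite xpair_eqE.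
case: eqP => _ /=; last by rewrite mul0r mulr0.
by rewrite mulrA gst_vtx eq_sym we gst_edg; case: eqP.
Qed.

Fact expand_sum y : y = \sum_p x_ p <* phi p y.
Proof.
pose F (p : I * edge E) := fvec fr p.1 <* edg k p.2 <* (gst k p.2 * fcov fr p.1 y).
rewrite -(big_sub (fun p : I * edge E => w p.1 == src p.2) F) /=.
rewrite (eq_bigl (fun p : I * edge E => xpredT p.1 && (src p.2 == w p.1))); last first.
  by move=> p; rewrite /= eq_sym.
rewrite -(pair_big_dep xpredT (fun i e => src e == w i) (fun i e => F (i, e))) /=.
rewrite [LHS](frame_sum fr); apply: eq_bigr => i _.
rewrite -[in LHS](eps_fcov fr) /= vtx_ck2 mulr_suml ract_sumr.
by apply: eq_bigr => e _; rewrite /F ractA mulrA.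
Qed.

Definition expand_frame : vframe M (n + 1) expand_vertex :=
  Frame expand_part expand_functional expand_dual expand_sum.

Lemma expand_multiplicity :
  multiplicity expand_vertex = adjacency (multiplicity w).
Proof.
apply: funext => v; rewrite /multiplicity /adjacency -sum1_card.
transitivity (\sum_(p : I * edge E | true && ((w p.1 == src p.2) && (rng p.2 == v))) 1)%N.
  apply/esym; rewrite (eq_bigl _ _ (fun=> erefl)).
  exact: (big_sub_cond (fun p : I * edge E => w p.1 == src p.2)
    (fun p : I * edge E => rng p.2 == v) (fun=> 1%N)).
rewrite -(pair_big_dep xpredT (fun i e => (w i == src e) && (rng e == v)) (fun _ _ => 1%N)) /=.
rewrite (exchange_big_dep (fun e => rng e == v)) /= => [|i e _ /andP[]//].
apply: eq_bigr => e /eqP re; rewrite -sum1_card.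
by apply: eq_bigl => i; rewrite re eqxx andbT.
Qed.

End Expand.

(** Coordinates of vectors supported at w_i in a frame supported at the u_j lie
    in the corners u_j L w_i; when they are in the span of the vertices they form
    a block matrix of scalars. *)
Lemma scalar_matrix M n (I J : finType) (u : J -> vertex E) (fr : vframe M n u)
    (w : I -> vertex E) (y : I -> M) :
    (forall i, y i <* V (w i) = y i) -> (forall i j, vspan (fcov fr j (y i))) ->
  exists c : J -> I -> k, forall j i,
    fcov fr j (y i) = if u j == w i then cst E (c j i) * V (u j) else 0.
Proof.
move=> yV ys.
have cP j i : exists c, fcov fr j (y i) = if u j == w i then cst E c * V (u j) else 0.
  have [c cE] := vspan_corner (u j) (w i) (ys i j); exists c; rewrite -cE.
  by have /= -> := eps_fcov fr j (y i); rewrite -(fct_ract (fcov_functional fr j)) yV.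
exists (fun j i => projT1 (cid (cP j i))) => j i; exact: (projT2 (cid (cP j i))).
Qed.

(** The two matrices of change of frame are inverse to each other; restricted to
    the indices lying over v they are scalar matrices A and B with B A = 1, which
    bounds the size of one by that of the other. *)
Lemma multiplicity_le M n (I J : finType) (w : I -> vertex E) (u : J -> vertex E)
    (fr : vframe M n w) (fr' : vframe M n u) v :
    (forall i j, vspan (fcov fr' j (fvec fr i))) ->
    (forall i j, vspan (fcov fr i (fvec fr' j))) ->
  V v <> 0 -> (multiplicity w v <= multiplicity u v)%N.
Proof.
move=> H1 H2 v0.
have [a aE] := scalar_matrix (fvec_eps fr) H1.
have [b bE] := scalar_matrix (fvec_eps fr') (fun j i => H2 i j).
pose B : 'M[k]_(multiplicity w v, multiplicity u v) :=
  \matrix_(p, q) b (enum_val p) (enum_val q).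
pose A : 'M[k]_(multiplicity u v, multiplicity w v) :=
  \matrix_(q, p) a (enum_val q) (enum_val p).
suff : B *m A = 1%:M by apply: mulmx1_min.
apply/matrixP => p p'; rewrite !mxE; under eq_bigr do rewrite !mxE.
have wp (q : 'I_(multiplicity w v)) : w (enum_val q) = v by have := enum_valP q; rewrite inE => /eqP.
rewrite -(big_enum_val (fun j => b (enum_val p) j * a j (enum_val p'))) /=.
apply: (cst_vtx_inj v0); rewrite cst_sum mulr_suml.
transitivity (fcov fr (enum_val p) (fvec fr (enum_val p'))); last first.
  rewrite fcov_vec (inj_eq enum_val_inj) wp.
  by case: eqP => _; rewrite ?cst1 ?mul1r // cst0 mul0r.
rewrite [fvec fr _ in RHS](frame_sum fr') (fct_sum (fcov_functional fr _)).
rewrite [RHS](bigID (fun j => u j == v)) /= [X in _ + X]big1 ?addr0.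
  apply: eq_bigr => j /eqP uj; rewrite (fct_ract (fcov_functional fr _)).
  rewrite bE aE !wp uj eqxx cstM -!mulrA; congr (_ * _).
  by rewrite mulrA -cstC -mulrA vtxM eqxx.
move=> j /negPf uj; rewrite (fct_ract (fcov_functional fr _)).
by rewrite bE wp eq_sym uj mul0r.
Qed.

Lemma multiplicity_eventually_eq M n d (I J : finType) (w : I -> vertex E)
    (u : J -> vertex E) (fr : vframe M n w) (fr' : vframe M n u) v :
    (forall i j, vlevel d (fcov fr' j (fvec fr i))) ->
    (forall i j, vlevel d (fcov fr i (fvec fr' j))) ->
  V v <> 0 ->
  iter d adjacency (multiplicity w) v = iter d adjacency (multiplicity u) v.
Proof.
elim: d n I J w u fr fr' => [|d IH] n I J w u fr fr' H1 H2 v0.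
  apply/eqP; rewrite eqn_leq (multiplicity_le H1 H2 v0) /=.
  exact: multiplicity_le (fun i j => H2 j i) (fun i j => H1 j i) v0.
rewrite !iterSr -!expand_multiplicity.
apply: (IH _ _ _ _ _ (expand_frame fr) (expand_frame fr')) => //.
- move=> i j /=; rewrite (fct_ract (fcov_functional _ _)) mulrA; exact: H1.
- move=> i j /=; rewrite (fct_ract (fcov_functional _ _)) mulrA; exact: H2.
Qed.

End VertexFrames.
Arguments adjacency {E} m v.

(** * Multiplicities and cancellation *)

Section Multiplicities.
Variables (k : fieldType) (E : digraph).
Hypothesis hE : no_sinks E.
Local Notation L := (leavitt_path_algebra k E).
Local Notation V := (@vtx k E).
Implicit Types (M N S : grMod L) (m : vertex E -> nat).

Definition has_multiplicity M n m : Prop :=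
  exists (I : finType) (w : I -> vertex E) (fr : vframe M n w), multiplicity w = m.

Lemma has_multiplicity_iso M N n m :
  grIso M N -> has_multiplicity M n m -> has_multiplicity N n m.
Proof. by move=> MN [I [w [fr <-]]]; have [fr'] := frame_iso fr MN; exists I, w, fr'. Qed.

Lemma has_multiplicity_shift M n m d :
  has_multiplicity M n m -> has_multiplicity (shiftM d M) (n - d) m.
Proof. by move=> [I [w [fr <-]]]; exists I, w, (frame_shift fr d). Qed.

Lemma has_multiplicity_sum M N n m m' :
  has_multiplicity M n m -> has_multiplicity N n m' ->
  has_multiplicity (sumM M N) n (fun v => m v + m' v)%N.
Proof.
move=> [I [w [fr <-]]] [J [u [fr' <-]]]; have fs := frame_sumM fr fr'.
pose wu (i : I + J) := match i with inl i => w i | inr j => u j end.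
have e : sum_eps (fun i => V (w i)) (fun j => V (u j)) = (fun i => V (wu i)).
  by apply: funext => -[].
rewrite e in fs; exists (I + J : finType)%type, wu, fs; apply: funext => v.
rewrite /multiplicity -!sum1_card.
pose P i := wu i == v.
by rewrite -/P big_sumType.
Qed.

Lemma has_multiplicity0 n : has_multiplicity (zeroM L) n (fun=> 0%N).
Proof.
pose w (i : 'I_0) : vertex E := match i with Ordinal _ h => match notF (h : false) with end end.
have fr : vframe (zeroM L) n w.
  apply: (@Frame _ _ _ _ _ (fun i : 'I_0 => 0) (fun i y => 0)) => [[]|[]|[]|x] //.
  exact: zeroM_eq.
by exists 'I_0, w, fr; apply: funext => v; apply/eqP/pred0P => -[].
Qed.

Lemma has_multiplicity_regular : has_multiplicity (regularM L) 0 (fun=> 1%N).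
Proof.
have fr : vframe (regularM L) 0 (@id (vertex E)).
  pose x v : regularM L := V v.
  pose phi v (y : regularM L) : L := V v * (y : L).
  apply: (@Frame L (regularM L) 0 _ (fun v => V v) x phi) => /=.
  - exact: vtx_part.
  - move=> v; split=> [y z|y t|d y Cy]; first exact: mulrDr.
      exact: mulrA.
    by rewrite subr0 -[d]add0r; apply: gr_mul => //; apply: vtx_part.
  - by move=> v w; apply: vtxM.
  - move=> y; transitivity (\sum_v V v * (y : L)).
      by rewrite -mulr_suml vtx_sum mul1r.
    apply: eq_bigr => v _.
    by rewrite -[RHS]/(V v * (V v * (y : L))) mulrA vtxM eqxx.
exists (vertex E), id, fr; apply: funext => v.
by rewrite /multiplicity -(card1 v); apply: eq_card => w; rewrite !inE.
Qed.

Lemma has_multiplicity_expand M n m d :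
  has_multiplicity M n m -> has_multiplicity M (n + d%:Z) (iter d adjacency m).
Proof.
elim: d => [|d IH] /=; first by rewrite addr0.
move=> /IH[I [w [fr <-]]]; rewrite -addn1 PoszD addrA.
by exists _, _, (expand_frame hE fr); rewrite expand_multiplicity.
Qed.

Lemma has_multiplicity_ge M (n n' : int) m : (n <= n')%R -> has_multiplicity M n m ->
  exists m', has_multiplicity M n' m'.
Proof.
move=> nn' /has_multiplicity_expand H; exists (iter `|n' - n|%N adjacency m).
by have := H `|n' - n|%N; rewrite gez0_abs ?subr_ge0 // addrCA subrr addr0.
Qed.

Lemma has_multiplicity_fin_gen M n m : has_multiplicity M n m -> fin_gen M.
Proof. by move=> [I [w [fr _]]]; apply: frame_fin_gen fr. Qed.

Lemma has_multiplicity_projective M n m : has_multiplicity M n m -> gr_projective M.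
Proof. by move=> [I [w [fr _]]]; apply: frame_projective fr. Qed.

(** Reindexing by pairs (v, a) makes frames with the same multiplicities literally
    indexed by the same type. *)
Lemma frame_standard M n (I : finType) (w : I -> vertex E) (m : vertex E -> nat) :
  vframe M n w -> (forall v, m v = if V v == 0 then 0%N else multiplicity w v) ->
  @vframe k E M n {v : vertex E & 'I_(m v)} tag.
Proof.
move=> fr mE; pose A v := [pred i | (w i == v) && (V v != 0)].
have {mE} -> : m = (fun v => #|A v|).
  apply: funext => v; rewrite mE /multiplicity /A.
  case: eqP => _; last by apply: eq_card => i; rewrite !inE andbT.
  by apply/esym/eq_card0 => i; rewrite !inE andbF.
pose h (p : {v : vertex E & 'I_#|A v|}) : I := enum_val (tagged p).
have wh p : w (h p) = tag p.
  by have := enum_valP (tagged p); rewrite inE => /andP[/eqP].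
have hinj : injective h.
  move=> [v a] [v' a'] hh; have vv' : v = v'.
    by have := wh (existT _ v a); rewrite hh wh.
  by case: v' / vv' a' hh => a'; rewrite /h /= => /enum_val_inj ->.
have h0 i : i \notin codom h -> V (w i) = 0.
  move=> ni; apply/eqP; apply: contraR ni => Vi.
  have iA : i \in A (w i) by rewrite inE eqxx.
  apply/codomP; exists (existT _ (w i) (enum_rank_in iA i)).
  by rewrite /h /= enum_rankK_in.
have fr' := frame_reindex fr hinj h0.
have e : (fun i => V (w i)) \o h = (fun p => V (tag p)).
  by apply: funext => p /=; rewrite wh.
by rewrite e in fr'.
Qed.

(** Multiplicities at vertices that vanish in L count zero summands. *)
Lemma isom_of_multiplicity M N n m m' :
  has_multiplicity M n m -> has_multiplicity N n m' ->
  (forall v, V v <> 0 -> m v = m' v) -> grIso M N.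
Proof.
move=> [I [w [fr <-]]] [J [u [fr' <-]]] mm'.
pose m0 v := if V v == 0 then 0%N else multiplicity w v.
have f := frame_standard (m := m0) fr (fun=> erefl).
have m0E v : m0 v = if V v == 0 then 0%N else multiplicity u v.
  by rewrite /m0; case: eqP => // /mm'.
exact: frames_iso f (frame_standard fr' m0E).
Qed.

Lemma eventually_forall (I : finType) (P : I -> nat -> Prop) :
  (forall i, exists D, forall d, (D <= d)%N -> P i d) ->
  exists D, forall d, (D <= d)%N -> forall i, P i d.
Proof.
move=> H; pose D i := projT1 (cid (H i)).
exists (\max_i D i) => d Dd i; apply: (projT2 (cid (H i))).
exact: leq_trans (leq_bigmax i) Dd.
Qed.

Lemma coord_vlevel M n (I J : finType) (w : I -> vertex E) (fr : vframe M n w)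
    (y : J -> M) : (forall j, gm_part n (y j)) ->
  exists D, forall d, (D <= d)%N -> forall p : I * J, vlevel d (fcov fr p.1 (y p.2)).
Proof.
move=> Cy; apply: eventually_forall => -[i j] /=; apply: gr_part0_vlevel.
by rewrite -(subrr n); apply: (fct_part (fcov_functional fr i)).
Qed.

(** Multiplicities of a module are well defined only after enough expansions,
    when the two changes of frame have become scalar. *)
Lemma has_multiplicity_unique M n m m' :
  has_multiplicity M n m -> has_multiplicity M n m' ->
  exists d, forall v, V v <> 0 -> iter d adjacency m v = iter d adjacency m' v.
Proof.
move=> [I [w [fr <-]]] [J [u [fr' <-]]].
have [N1 H1] := coord_vlevel fr' (fvec_part fr).
have [N2 H2] := coord_vlevel fr (fvec_part fr').
exists (maxn N1 N2) => v v0.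
apply: (multiplicity_eventually_eq hE (fr := fr) (fr' := fr')) v0 => i j.
  exact: (H1 _ (leq_maxl _ _) (j, i)).
exact: (H2 _ (leq_maxr _ _) (i, j)).
Qed.

Lemma iter_adjacencyD d m m' v :
  iter d adjacency (fun v => m v + m' v)%N v =
  (iter d adjacency m v + iter d adjacency m' v)%N.
Proof.
elim: d v => //= d IH v; rewrite /adjacency -big_split.
by apply: eq_bigr => e _; apply: IH.
Qed.

(** Bring all three frames to a common degree. Expanded multiplicities are
    additive natural numbers, which cancel. *)
Lemma multiplicity_cancel M N S n1 n2 n3 m1 m2 m3 :
  has_multiplicity M n1 m1 -> has_multiplicity N n2 m2 -> has_multiplicity S n3 m3 ->
  grIso (sumM M S) (sumM N S) -> grIso M N.
Proof.
pose n := Order.max n1 (Order.max n2 n3).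
move=> /(@has_multiplicity_ge _ _ n)[|{}m1 hM]; first by rewrite le_max lexx.
move=> /(@has_multiplicity_ge _ _ n)[|{}m2 hN]; first by rewrite !le_max lexx orbT.
move=> /(@has_multiplicity_ge _ _ n)[|{}m3 hS iso]; first by rewrite !le_max lexx !orbT.
have [d H] := has_multiplicity_unique
  (has_multiplicity_iso iso (has_multiplicity_sum hM hS)) (has_multiplicity_sum hN hS).
apply: isom_of_multiplicity (has_multiplicity_expand d hM) (has_multiplicity_expand d hN) _.
by move=> v /H; rewrite !iter_adjacencyD => /addIn.
Qed.

End Multiplicities.

(** * Graded projectives are sums of vertex modules *)

(** The rank factorization e = C R of an idempotent satisfies R C = 1, hence
    R e C = 1. *)
Lemma idempotent_factor (k : fieldType) (I : finType) (e : I -> I -> k) :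
    (forall i l, \sum_j e i j * e j l = e i l) ->
  exists r (C : I -> 'I_r -> k) (R : 'I_r -> I -> k),
    (forall i j, e i j = \sum_a C i a * R a j) /\
    (forall a b, \sum_j (\sum_i R a i * e i j) * C j b = (a == b)%:R).
Proof.
move=> ee.
pose A : 'M[k]_#|I| := \matrix_(p, q) e (enum_val p) (enum_val q).
have AA : A *m A = A.
  apply/matrixP => p q; rewrite !mxE -[RHS]ee; under eq_bigr do rewrite !mxE.
  by rewrite -(big_enum_val (fun j => e (enum_val p) j * e j (enum_val q))).
have := mulmx_base A; have := row_base_free A; have := col_base_full A.
move: (\rank A) (col_base A) (row_base A) => r Cb Rb Cfull Rfree CR.
have RC : Rb *m Cb = 1%:M.
  apply: (row_free_inj Rfree); apply: (row_full_inj Cfull).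
  by rewrite /= mul1mx !mulmxA CR -mulmxA CR.
exists r, (fun i a => Cb (enum_rank i) a), (fun a i => Rb a (enum_rank i)).
split=> [i j|a b].
  have := congr1 (fun B : 'M_#|I| => B (enum_rank i) (enum_rank j)) CR.
  by rewrite !mxE !enum_rankK.
have RAC : Rb *m A *m Cb = 1%:M by rewrite -CR mulmxA RC mul1mx RC.
have := congr1 (fun B : 'M_r => B a b) RAC.
rewrite !mxE => <-; rewrite (reindex (@enum_val I I)) /=; last exact/onW_bij/enum_val_bij.
apply: eq_bigr => p _; rewrite enum_valK mxE; congr (_ * _).
rewrite (reindex (@enum_val I I)) /=; last exact/onW_bij/enum_val_bij.
by apply: eq_bigr => q _; rewrite enum_valK !mxE.
Qed.

Section Existence.
Variables (k : fieldType) (E : digraph).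
Hypothesis hE : no_sinks E.
Local Notation L := (leavitt_path_algebra k E).
Local Notation V := (@vtx k E).
Implicit Types (M N S : grMod L) (m : vertex E -> nat).

Lemma expand_to_vspan M (f : grHom M M) d n (I : finType) (w : I -> vertex E)
    (fr : vframe M n w) : (forall i j, vlevel d (fcov fr i (f (fvec fr j)))) ->
  exists n' (I' : finType) (w' : I' -> vertex E) (fr' : vframe M n' w'),
    forall i j, vspan (fcov fr' i (f (fvec fr' j))).
Proof.
elim: d n I w fr => [|d IH] n I w fr H; first by exists n, I, w, fr.
apply: (IH _ _ _ (expand_frame hE fr)) => i j /=.
by rewrite hom_ract (fct_ract (fcov_functional _ _)) mulrA; apply: H.
Qed.

(** The idempotent h g of A has a block matrix of scalars, with one idempotent
    scalar matrix over each vertex v. Its rank factorization C R turns the frame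
    x_i, phi_i of A into the vectors \sum_i g(x_i) C_ia v and the functionals
    \sum_i R_ai v phi_i h of M. *)
Lemma retract_frame A M (g : grHom A M) (h : grHom M A) n (I : finType)
    (w : I -> vertex E) (fr : vframe A n w) :
    cancel h g -> (forall i j, vspan (fcov fr i (h (g (fvec fr j))))) ->
  exists m, has_multiplicity M n m.
Proof.
move=> hK; set Z := fun i j => fcov fr i (h (g (fvec fr j))) => Zs.
have [c cE] : exists c : I -> I -> vertex E -> k,
    forall i j, Z i j = \sum_v cst E (c i j v) * V v.
  by exists (fun i j => projT1 (cid (Zs i j))) => i j; apply: (projT2 (cid (Zs i j))).
(* The scalars c are determined only over the nonzero vertices; over the others
   they are set to 0 so that e v is idempotent. *)
pose e v i j := if V v == 0 then 0 else c i j v.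
have VZ v i j : V v * Z i j = cst E (e v i j) * V v.
  rewrite cE mulr_sumr (bigD1 v) //= big1 ?addr0 => [|u /negPf uv].
    rewrite mulrA -cstC -mulrA vtxM eqxx /e.
    by case: eqP => [->|//]; rewrite !mulr0.
  by rewrite mulrA -cstC -mulrA vtxM eq_sym uv mulr0.
have Zsum i j : Z i j = \sum_v cst E (e v i j) * V v.
  by under [RHS]eq_bigr do rewrite -VZ; rewrite -mulr_suml vtx_sum mul1r.
have phihg i y : fcov fr i (h (g y)) = \sum_j Z i j * fcov fr j y.
  rewrite {1}(frame_sum fr y) !hom_sum (fct_sum (fcov_functional fr i)).
  by apply: eq_bigr => j _; rewrite !hom_ract (fct_ract (fcov_functional fr i)).
have ee v i l : \sum_j e v i j * e v j l = e v i l.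
  have [v0|v0] := eqVneq (V v) 0.
    by rewrite /e v0 eqxx big1 // => j _; rewrite mulr0.
  apply: cst_vtx_inj (elimN eqP v0) _.
  rewrite cst_sum mulr_suml -VZ /Z -[g _]hK phihg mulr_sumr.
  by apply: eq_bigr => j _; rewrite mulrA VZ -mulrA VZ mulrA cstM.
have H v := idempotent_factor (ee v).
pose r v := projT1 (cid (H v)).
have [C [R CR]] : exists (C : forall v, I -> 'I_(r v) -> k) (R : forall v, 'I_(r v) -> I -> k),
    forall v, (forall i j, e v i j = \sum_a C v i a * R v a j) /\
    (forall a b, \sum_j (\sum_i R v a i * e v i j) * C v j b = (a == b)%:R).
  exists (fun v => projT1 (cid (projT2 (cid (H v))))).
  exists (fun v => projT1 (cid (projT2 (cid (projT2 (cid (H v))))))).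
  by move=> v; apply: (projT2 (cid (projT2 (cid (projT2 (cid (H v))))))).
pose J : finType := {v : vertex E & 'I_(r v)}.
pose y (p : J) : M := \sum_i g (fvec fr i) <* (cst E (C (tag p) i (tagged p)) * V (tag p)).
pose theta (p : J) (z : M) : L :=
  \sum_i cst E (R (tag p) (tagged p) i) * V (tag p) * fcov fr i (h z).
have yP p : gm_part n (y p).
  apply: gm_part_sum => i _; apply: ract_part0; last exact: cst_vtx_part.
  exact/hom_deg/fvec_part.
have tP p : functional n (theta p).
  apply: functional_sum => i.
  exact: (functional_mul0 (functional_comp (fcov_functional fr i) h) (cst_vtx_part _ _)).
have term v u i j c1 c2 : cst E c1 * V v * (Z i j * (cst E c2 * V u)) =
    if v == u then cst E (c1 * e v i j * c2) * V v else 0.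
  rewrite mulrA -[_ * V v * _]mulrA VZ -!mulrA.
  rewrite [V v * (cst E c2 * _)]mulrA -[V v * _]cstC -mulrA vtxM.
  by case: eqP => _; rewrite ?mulr0 // !cstM !mulrA.
have dual p q : theta p (y q) = if p == q then V (tag p) else 0.
  transitivity (\sum_i \sum_j cst E (R (tag p) (tagged p) i) * V (tag p) *
      (Z i j * (cst E (C (tag q) j (tagged q)) * V (tag q)))).
    apply: eq_bigr => i _; rewrite -mulr_sumr; congr (_ * _).
    rewrite /y !hom_sum (fct_sum (fcov_functional fr i)); apply: eq_bigr => j _.
    by rewrite !hom_ract (fct_ract (fcov_functional fr i)).
  under eq_bigr => i _ do under eq_bigr => j _ do rewrite term.
  case: p q => [v a] [u b] /=.
  have [vu|vu] := eqVneq v u; last first.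
    rewrite big1 => [|i _]; last by rewrite big1.
    by case: eqP => // -[/eqP]; rewrite (negPf vu).
  case: u / vu b => b; rewrite eq_Tagged /= exchange_big /=.
  under eq_bigr => j _ do rewrite -mulr_suml -cst_sum -mulr_suml.
  rewrite -mulr_suml -cst_sum; have [_ ->] := CR v.
  by case: eqP => _; rewrite ?cst1 ?mul1r // cst0 mul0r.
have full z : z = \sum_p y p <* theta p z.
  pose F v a := (\sum_i g (fvec fr i) <* (cst E (C v i a) * V v)) <*
    (\sum_i cst E (R v a i) * V v * fcov fr i (h z)).
  rewrite -[RHS](sig_big_dep (fun v => true) (fun v a => true) (fun v a => F v a)) /=.
  transitivity (\sum_i g (fvec fr i) <* (\sum_j Z i j * fcov fr j (h z))).
    rewrite -{1}[z]hK -{1}[z]hK {1}(frame_sum fr (h (g (h z)))) hom_sum.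
    by apply: eq_bigr => i _; rewrite hom_ract phihg.
  under [RHS]eq_bigr => v _ do under eq_bigr => a _ do rewrite /F ract_suml.
  under [RHS]eq_bigr => v _ do rewrite exchange_big /=.
  rewrite exchange_big /=; apply: eq_bigr => i _.
  under [RHS]eq_bigr => v _ do under eq_bigr => a _ do rewrite ractA.
  under [RHS]eq_bigr => v _ do rewrite -ract_sumr.
  rewrite -ract_sumr; congr (_ <* _).
  under eq_bigr => j _ do rewrite Zsum mulr_suml.
  rewrite exchange_big /=; apply: eq_bigr => v _.
  under [RHS]eq_bigr => a _ do rewrite mulr_sumr.
  rewrite exchange_big /=; apply: eq_bigr => j _.
  have [-> _] := CR v; rewrite cst_sum !mulr_suml; apply: eq_bigr => a _.
  rewrite cstM !mulrA; congr (_ * _).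
  by rewrite -[_ * V v * cst _ _]mulrA -[V v * cst _ _]cstC mulrA -[RHS]mulrA vtxM eqxx.
pose fr' : @vframe k E M n J tag := Frame yP tP dual full.
by exists (multiplicity (fun p : J => tag p)), J, tag, fr'.
Qed.

Lemma regular_hom M n (x : M) : gm_part n x ->
  exists g : grHom (shiftM (- n) (regularM L)) M, g (1 : L) = x.
Proof.
move=> Cx.
have [||m t Ct|g gE] := @hom_exists _ (shiftM (- n) (regularM L)) M (fun t => x <* (t : L)).
- by move=> s t; apply: ractDr.
- by move=> s t; rewrite ractA.
- have := ract_part Cx (Ct : @gr_part L (- n + m) t).
  by rewrite addrA subrr add0r.
by exists g; rewrite gE ract1.
Qed.

(** Each homogeneous element of degree d is the image of 1 under a map from
    L(-d). *)
Lemma homogeneous_cover M (s : seq (int * M)) : (forall q, q \in s -> gm_part q.1 q.2) ->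
  exists A n m (g : grHom A M), has_multiplicity A n m /\
    forall q, q \in s -> exists a, g a = q.2.
Proof.
elim: s => [|[d x] s IH] sC.
  by exists (zeroM L), 0, (fun=> 0%N), (zeroHom _ _); split=> //; apply: has_multiplicity0.
have [|A [n [m [g [hA gs]]]]] := IH; first by move=> q qs; apply: sC; rewrite in_cons qs orbT.
have [g' g'1] := regular_hom (sC (d, x) (mem_head _ _)).
have hR : has_multiplicity (shiftM (- d) (regularM L)) d (fun=> 1%N).
  by have := has_multiplicity_shift (- d) (has_multiplicity_regular k E); rewrite sub0r opprK.
have le_l : d <= Order.max d n by rewrite le_max lexx.
have le_r : n <= Order.max d n by rewrite le_max lexx orbT.
have [m1 hR'] := has_multiplicity_ge hE le_l hR.
have [m2 hA'] := has_multiplicity_ge hE le_r hA.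
exists _, (Order.max d n), (fun v => m1 v + m2 v)%N, (copairHom g' g); split; first exact: has_multiplicity_sum hR' hA'.
move=> q; rewrite in_cons => /orP[/eqP ->|/gs[a <-]].
  by exists ((1 : L), 0); rewrite copairHomE hom0 addr0.
by exists (0, a); rewrite copairHomE hom0 add0r.
Qed.

Lemma fin_gen_cover M : fin_gen M ->
  exists A n m (g : grHom A M), has_multiplicity A n m /\ forall x, exists a, g a = x.
Proof.
move=> [r [b bP]].
pose s := flatten [seq [seq (n, component (gm_grading M) n (b i)) |
  n <- grsupp (gm_grading M) (b i)] | i <- enum 'I_r].
have [|A [n [m [g [hA gs]]]]] := @homogeneous_cover M s.
  by move=> q /flattenP[t /mapP[i _ ->] /mapP[d _ ->]]; apply: componentP.
exists A, n, m, g; split=> // x.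
have rD y z : (exists a, g a = y) -> (exists a, g a = z) -> exists a, g a = y + z.
  by move=> [a <-] [a' <-]; exists (a + a'); rewrite homD.
have r0 : exists a, g a = 0 by exists 0; rewrite hom0.
have [c ->] := bP x; elim/big_ind: _ => // i _.
suff [a <-] : exists a, g a = b i by exists (a <* c i); rewrite hom_ract.
rewrite (component_sum (gm_grading M) (b i)) big_seq.
elim/big_ind: _ => // d dC; apply: (gs (d, _)).
apply/flattenP; exists [seq (n, component (gm_grading M) n (b i)) |
  n <- grsupp (gm_grading M) (b i)]; last exact: map_f.
by apply: map_f; rewrite mem_enum.
Qed.

Lemma fgProj_multiplicity (P : fgProj L) : exists n m, has_multiplicity P n m.
Proof.
have [A [n [m [g [[I [w [fr _]]] gs]]]]] := fin_gen_cover (fgp_fin_gen P).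
have [h hK] := @fgp_proj L P A P g (idHom P) gs.
have [N1 H1] := coord_vlevel fr (y := fun j => h (g (fvec fr j)))
  (fun j => hom_deg h (hom_deg g (fvec_part fr j))).
have [n' [I' [w' [fr' H']]]] := expand_to_vspan (f := compHom h g) (fr := fr)
  (fun i j => H1 _ (leqnn _) (i, j)).
by have [m' hm] := retract_frame hK H'; exists n', m'.
Qed.

(** Equality in the group completion provides an isomorphism after adding some
    module; cancel it. *)
Lemma k0_class_inj (P Q : fgProj L) : k0_class P = k0_class Q -> grIso P Q.
Proof.
move=> /k0_diffP[S]; rewrite -(v_reprK S) /v_zero !v_addE => /v_classP /= iso.
have [n1 [m1 hP]] := fgProj_multiplicity P.
have [n2 [m2 hQ]] := fgProj_multiplicity Q.
have [n3 [m3 hS]] := fgProj_multiplicity (sumP (zeroP L) (lrepr S)).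
apply: (multiplicity_cancel hE hP hQ hS) => /=.
apply: (grIso_trans (sumM_isoA _ _ _)).
exact: (grIso_trans iso (grIso_sym (sumM_isoA _ _ _))).
Qed.

End Existence.

(** * The right ideal generated by a homogeneous idempotent *)

Section Corner.
Variables (T : grRing) (a : T).
Hypotheses (a_part : gr_part 0 a) (a_idem : a * a = a).

Definition corner_pred : {pred (T^c)^o} := fun x => (a * (x : T) == x :> T).

Fact corner_closed : submod_closed corner_pred.
Proof.
split; first by rewrite unfold_in mulr0.
move=> c x y /eqP ax /eqP ay; rewrite unfold_in; apply/eqP.
rewrite -[c *: x + y]/((x : T) * (c : T) + (y : T)) mulrDr mulrA.
by rewrite [a * (x : T)]ax [a * (y : T)]ay.
Qed.
HB.instance Definition _ := GRing.isSubmodClosed.Build T^c (T^c)^o corner_pred corner_closed.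

Record corner := Corner { corner_val : (T^c)^o; _ : corner_val \in corner_pred }.
HB.instance Definition _ := [isSub for corner_val].
HB.instance Definition _ := [Choice of corner by <:].
HB.instance Definition _ := [SubChoice_isSubLmodule of corner by <:].

Lemma corner_valP (x : corner) : a * (corner_val x : T) = corner_val x.
Proof. by case: x => x /= /eqP. Qed.

Fact corner_mem (t : T) : (a * t : (T^c)^o) \in corner_pred.
Proof. by rewrite unfold_in mulrA a_idem. Qed.

Definition corner_part (n : int) : set corner :=
  [set x | @gr_part T n (corner_val x)]%classic.

Fact corner_grading : is_grading corner_part.
Proof.
pose G := gr_grading T.
have aC n t : component G n (a * t) = a * component G n t.
  elim/(grading_ind G): t => [|t u IHt IHu|m t Ct].
  - by rewrite component0 mulr0 component0.
  - by rewrite mulrDr !componentD IHt IHu mulrDr.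
  have := gr_mul a_part Ct; rewrite add0r => Cat.
  rewrite (component_homog G _ Ct) (component_homog G _ Cat).
  by case: eqP; rewrite ?mulr0.
have cP n (x : corner) : (component G n (corner_val x) : (T^c)^o) \in corner_pred.
  by rewrite unfold_in -aC corner_valP.
apply: (@is_gradingP _ _ (fun n x => Corner (cP n x))).
- by move=> n; apply: (grading0 G).
- by move=> n x y; apply: (gradingB G).
- by move=> n x y; apply: val_inj; apply: (componentD G).
- move=> m n x Cx; apply: val_inj => /=; rewrite (component_homog G _ Cx).
  by case: eqP.
- move=> x; exists [seq (n, Corner (cP n x)) | n <- grsupp G (corner_val x)]; split.
    by move=> q /mapP[n _ ->]; apply: componentP.
  apply: val_inj; rewrite big_map raddf_sum /=; exact: component_sum.
Qed.

Fact corner_act m n (x : corner) (t : T) :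
  corner_part m x -> gr_part n t -> corner_part (m + n) ((t : T^c) *: x).
Proof. exact: gr_mul. Qed.

Definition cornerM : grMod T := @GrMod T corner _ corner_grading corner_act.

Definition corner_in (t : T) : cornerM := Corner (corner_mem t).
Definition corner_out (x : cornerM) : T := corner_val x.

Lemma corner_inK t : corner_out (corner_in t) = a * t.
Proof. by []. Qed.

Lemma corner_out_ract x t : corner_out (x <* t) = corner_out x * t.
Proof. by []. Qed.

Lemma corner_outD x y : corner_out (x + y) = corner_out x + corner_out y.
Proof. by []. Qed.

Lemma corner_frame : frame cornerM 0 (fun _ : unit => a).
Proof.
have H1 : functional 0 corner_out.
  by split=> // m x Cx; rewrite subr0.
have H2 (i j : unit) : corner_out (corner_in 1) = if i == j then a else 0.
  by case: i j => -[]; rewrite eqxx corner_inK mulr1.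
have H3 x : x = \sum_(i : unit) corner_in 1 <* corner_out x.
  rewrite big_const card_unit /= addr0; apply: val_inj.
  by rewrite -[RHS]/(a * 1 * corner_out x) mulr1; apply/esym/corner_valP.
have H0 (i : unit) : @gm_part T cornerM 0 (corner_in 1).
  by rewrite /= /corner_part /= mulr1.
exact: (@Frame T cornerM 0 _ _ (fun=> corner_in 1) (fun=> corner_out) H0 (fun=> H1) H2 H3).
Qed.

End Corner.

(** * Sums in the graded Grothendieck group and direct sums *)

(** Folds are used because the graded Grothendieck group lives in a universe too
    large for the hierarchy of algebraic structures. *)
Definition k0_sum (T : grRing) (I : Type) (s : seq I) (F : I -> K0gr T) : K0gr T :=
  foldr (fun i => k0_add (F i)) (k0_zero T) s.

Definition iterated_sum (T : grRing) (I : Type) (s : seq I) (P : I -> fgProj T) : fgProj T :=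
  foldr (fun i => sumP (P i)) (zeroP T) s.

Lemma k0_sum_cons (T : grRing) (I : Type) i (s : seq I) (F : I -> K0gr T) :
  k0_sum (i :: s) F = k0_add (F i) (k0_sum s F).
Proof. by []. Qed.

Lemma k0_class_iterated_sum (T : grRing) (I : Type) (s : seq I) (P : I -> fgProj T) :
  k0_class (iterated_sum s P) = k0_sum s (fun i => k0_class (P i)).
Proof. by elim: s => [|i s IH] //; rewrite k0_sum_cons -IH k0_classD. Qed.

Lemma eq_k0_sum (T : grRing) (I : Type) (s : seq I) (F G : I -> K0gr T) :
  F =1 G -> k0_sum s F = k0_sum s G.
Proof. by move=> FG; elim: s => [|i s IH]; [exact: erefl|rewrite !k0_sum_cons FG IH]. Qed.

Lemma k0_sum_map (T : grRing) (I J : Type) (h : I -> J) (s : seq I) (F : J -> K0gr T) :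
  k0_sum (map h s) F = k0_sum s (F \o h).
Proof. by elim: s => [|i s IH] //; rewrite k0_sum_cons -IH. Qed.

Section AdditiveMaps.
Variables (T T' : grRing) (f : K0gr T -> K0gr T').
Hypothesis fD : forall x y, f (k0_add x y) = k0_add (f x) (f y).

Lemma k0_addI (x : K0gr T') : injective (k0_add x).
Proof.
by move=> y z /(congr1 (k0_add (k0_opp x))); rewrite !k0_addA (k0_addN x) !k0_add0.
Qed.

Lemma k0_additive0 : f (k0_zero T) = k0_zero T'.
Proof. by apply: (k0_addI (x := f (k0_zero T))); rewrite -fD k0_add0 k0_addC k0_add0. Qed.

Lemma k0_additiveN x : f (k0_opp x) = k0_opp (f x).
Proof.
apply: (k0_addI (x := f x)); rewrite -fD [k0_add x _]k0_addC (k0_addN x).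
by rewrite k0_additive0 [RHS]k0_addC (k0_addN (f x)).
Qed.

Lemma k0_additive_sum (I : Type) (s : seq I) (F : I -> K0gr T) :
  f (k0_sum s F) = k0_sum s (fun i => f (F i)).
Proof. by elim: s => [|i s IH]; [exact: k0_additive0|rewrite !k0_sum_cons fD IH]. Qed.

End AdditiveMaps.

Lemma k0_class_iso (T : grRing) (P Q : fgProj T) : grIso P Q -> k0_class P = k0_class Q.
Proof. by move=> /v_classP e; rewrite /k0_class e. Qed.

Lemma k0_diff_class (T : grRing) (P Q : fgProj T) :
  k0_diff (v_class P) (v_class Q) = k0_add (k0_class P) (k0_opp (k0_class Q)).
Proof. by rewrite k0_oppE k0_addE v_add0 v_addC v_add0. Qed.

Section DirectSums.
Variable T : grRing.

Lemma pairHom_exists (M N P : grMod T) (f : grHom M N) (g : grHom M P) :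
  exists h : grHom M (sumM N P), forall x, h x = (f x, g x).
Proof.
apply: (hom_exists (f := fun x => (f x, g x) : sumM N P)) => [x y|x t|n x Cx].
- by rewrite !homD.
- by rewrite !hom_ract.
- by split; apply: hom_deg.
Qed.

Variables (I : eqType).

(** The Kronecker delta of a family of modules. *)
Definition deltaHom (M : I -> grMod T) (i j : I) : grHom (M i) (M j) :=
  match i =P j with
  | ReflectT e => ecast j (grHom (M i) (M j)) e (idHom (M i))
  | ReflectF _ => zeroHom _ _
  end.

Lemma deltaHom_id M i x : deltaHom M i i x = x.
Proof. by rewrite /deltaHom; case: eqP => // e; rewrite eq_axiomK. Qed.

Lemma deltaHom_neq M i j x : i != j -> deltaHom M i j x = 0.
Proof. by rewrite /deltaHom; case: eqP. Qed.

(** Families indexed by all of I, zero outside s, avoid dependent types over the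
    elements of s. *)
Definition direct_sum (s : seq I) (M : I -> grMod T) (N : grMod T)
    (inj : forall i, grHom (M i) N) (prj : forall i, grHom N (M i)) : Prop :=
  [/\ forall i j x, prj i (inj j x) = if j \in s then deltaHom M j i x else 0,
      forall i y, i \notin s -> prj i y = 0,
      forall i x, i \notin s -> inj i x = 0
    & forall y, y = \sum_(i <- s) inj i (prj i y)].

Lemma iterated_sum_direct (s : seq I) (P : I -> fgProj T) : uniq s ->
  exists inj prj, @direct_sum s P (iterated_sum s P) inj prj.
Proof.
elim: s => [_|a s IH] /=.
  exists (fun i => zeroHom _ _), (fun i => zeroHom _ _); split=> // y.
  exact: zeroM_eq.
case/andP=> as_ /IH[inj [prj [pi p0 i0 full]]].
have injP i := pairHom_exists (deltaHom P i a) (inj i).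
pose inj' i := projT1 (cid (injP i)).
have inj'E i x : inj' i x = (deltaHom P i a x, inj i x) := projT2 (cid (injP i)) x.
pose prj' i := copairHom (deltaHom P a i) (prj i).
have prj'E i y z : prj' i (y, z) = deltaHom P a i y + prj i z by [].
exists inj', prj'; split.
- move=> i j x; rewrite inj'E prj'E pi in_cons.
  have [ja|ja] := eqVneq j a.
    by move: x; rewrite ja => x; rewrite deltaHom_id (negPf as_) addr0.
  by rewrite (deltaHom_neq _ ja) (hom0 (deltaHom P a i)) add0r.
- move=> i [y z]; rewrite in_cons negb_or => /andP[ia si].
  by rewrite prj'E deltaHom_neq 1?eq_sym // p0 // addr0.
- move=> i x; rewrite in_cons negb_or => /andP[ia si].
  by rewrite inj'E deltaHom_neq // i0.
- move=> [y z]; rewrite big_cons inj'E prj'E deltaHom_id p0 // addr0 deltaHom_id i0 //.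
  rewrite big_seq (eq_bigr (fun i => inrHom _ _ (inj i (prj i z)))); last first.
    move=> i si; have ia : i != a by apply: contraNneq as_ => <-.
    by rewrite inj'E prj'E deltaHom_neq // deltaHom_neq 1?eq_sym // add0r.
  rewrite -big_seq -hom_sum -full inrHomE.
  by rewrite -[RHS]/(y + 0, 0 + z) addr0 add0r.
Qed.

Lemma direct_sum_iso (s : seq I) (M : I -> grMod T) (N N' : grMod T) inj prj :
  grIso N N' -> @direct_sum s M N inj prj ->
  exists inj' prj', @direct_sum s M N' inj' prj'.
Proof.
move=> [f [g [fK gK]]] [pi p0 i0 full].
exists (fun i => compHom f (inj i)), (fun i => compHom (prj i) g); split.
- by move=> i j x; rewrite !compHomE fK pi.
- by move=> i y si; rewrite compHomE p0.
- by move=> i x si; rewrite compHomE i0 // hom0.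
- move=> y; rewrite -[LHS]gK (full (g y)) hom_sum.
  by apply: eq_bigr => i _; rewrite !compHomE.
Qed.

End DirectSums.

(** * Generators of the graded Grothendieck group *)

Section VertexModules.
Variables (k : fieldType) (E : digraph).
Hypothesis hE : no_sinks E.
Local Notation L := (leavitt_path_algebra k E).
Local Notation V := (@vtx k E).

(** This is where cancellation enters the construction of psi: equations
    between classes become decompositions of modules. *)
Lemma direct_sum_k0 (I : eqType) (s : seq I) (P : I -> fgProj L) (Q : fgProj L) :
  uniq s -> k0_class Q = k0_sum s (fun i => k0_class (P i)) ->
  exists inj prj, @direct_sum L I s P Q inj prj.
Proof.
move=> us; rewrite -k0_class_iterated_sum => /(k0_class_inj hE)/grIso_sym iso.
by have [inj [prj H]] := iterated_sum_direct P us; apply: direct_sum_iso iso H.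
Qed.

Fact vtx_idem v : V v * V v = V v.
Proof. by rewrite vtxM eqxx. Qed.

Definition vertex_module (v : vertex E) : grMod L := cornerM (vtx_part k v).

Lemma vertex_module_multiplicity v : has_multiplicity (vertex_module v) 0 (fun u => v == u).
Proof.
exists unit, (fun=> v), (corner_frame (vtx_part k v) (vtx_idem v)); apply: funext => u; rewrite /multiplicity.
case: eqP => vu; first by rewrite -[RHS]card_unit; apply: eq_card => i; apply/eqP.
by apply: eq_card0 => i; apply/eqP.
Qed.

Definition vertex_proj v : fgProj L :=
  FgProj (has_multiplicity_fin_gen (vertex_module_multiplicity v))
         (has_multiplicity_projective (vertex_module_multiplicity v)).

Lemma sum_vertex_proj_multiplicity n (s : seq (vertex E)) :
  has_multiplicity (iterated_sum s (fun v => shiftP (- n) (vertex_proj v))) n (fun u => count_mem u s).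
Proof.
elim: s => [|v s IH] /=; first exact: has_multiplicity0.
apply: has_multiplicity_sum IH.
by have := has_multiplicity_shift (- n) (vertex_module_multiplicity v); rewrite sub0r opprK.
Qed.

(** A module is isomorphic to any module with the same multiplicities, here the
    direct sum of the shifted vertex modules listed by s. *)
Lemma k0_class_multiplicity (P : fgProj L) n m (s : seq (vertex E)) :
    has_multiplicity P n m -> (forall v, count_mem v s = m v) ->
  k0_class P = k0_sum s (fun v => k0_shift (- n) (k0_class (vertex_proj v))).
Proof.
move=> hP sm.
rewrite (eq_k0_sum s (fun v => k0_class_shift (- n) (vertex_proj v))) -k0_class_iterated_sum.
by apply: k0_class_iso; apply: isom_of_multiplicity hP (sum_vertex_proj_multiplicity _ _) _ => v _; rewrite sm.
Qed.

Lemma k0_additive_eq (T : grRing) (f g : K0gr L -> K0gr T) :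
    (forall x y, f (k0_add x y) = k0_add (f x) (f y)) ->
    (forall x y, g (k0_add x y) = k0_add (g x) (g y)) ->
    (forall n x, f (k0_shift n x) = k0_shift n (f x)) ->
    (forall n x, g (k0_shift n x) = k0_shift n (g x)) ->
    (forall v, f (k0_class (vertex_proj v)) = g (k0_class (vertex_proj v))) ->
  f =1 g.
Proof.
move=> fD gD fS gS fg.
have H (P : fgProj L) : f (k0_class P) = g (k0_class P).
  have [n [m [I [w [fr wm]]]]] := fgProj_multiplicity hE P.
  have hP : has_multiplicity P n m by exists I, w, fr.
  rewrite (k0_class_multiplicity (s := map w (enum I)) hP) => [|v].
    rewrite (k0_additive_sum fD) (k0_additive_sum gD); apply: eq_k0_sum => v.
    by rewrite fS gS fg.
  by rewrite count_map -wm /multiplicity cardE -size_filter enumT.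
elim/k0_ind => a b; rewrite -(v_reprK a) -(v_reprK b) k0_diff_class.
rewrite fD gD (k0_additiveN fD) (k0_additiveN gD).
by rewrite (H (lrepr a)) (H (lrepr b)).
Qed.

Lemma k0_regular : k0_class (regularP L) = k0_sum (enum (vertex E)) (fun v => k0_class (vertex_proj v)).
Proof.
rewrite (k0_class_multiplicity (P := regularP L) (s := enum (vertex E)) (has_multiplicity_regular k E)).
  by apply: eq_k0_sum => v; rewrite oppr0 k0_shift0.
by move=> v; rewrite count_uniq_mem ?enum_uniq // mem_enum.
Qed.

(** The module form of v = \sum_(src e = v) e e^*. *)
Lemma k0_vertex_proj v : k0_class (vertex_proj v) =
  k0_sum [seq e <- enum (edge E) | src e == v] (fun e => k0_shift (-1) (k0_class (vertex_proj (rng e)))).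
Proof.
have hv := has_multiplicity_expand hE 1 (vertex_module_multiplicity v).
rewrite (k0_class_multiplicity (P := vertex_proj v) (s := map (@rng E) [seq e <- enum (edge E) | src e == v]) hv).
  by rewrite k0_sum_map.
move=> u; rewrite /= /adjacency count_map count_filter -sum1_count big_enum_cond /=.
rewrite [LHS]big_mkcond [RHS]big_mkcond /=; apply: eq_bigr => e _.
by rewrite eq_sym [v == _]eq_sym; case: eqP; case: eqP.
Qed.

End VertexModules.

(** * Graded homomorphisms out of a Leavitt path algebra *)

(** Algebras are nonzero in the hierarchy, and the universal property is stated
    for them: the proof that 1 is nonzero is made part of the type. *)
Section NonzeroLeavitt.
Variables (k : fieldType) (F : digraph).

Definition nz_leavitt (nz : (1 : leavitt k F) != 0) : Type := leavitt k F.

Variable nz : (1 : leavitt k F) != 0.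
HB.instance Definition _ := GRing.PzRing.on (nz_leavitt nz).
HB.instance Definition _ := GRing.Lmodule.on (nz_leavitt nz).
HB.instance Definition _ := GRing.PzSemiRing_isNonZero.Build (nz_leavitt nz) nz.
HB.instance Definition _ :=
  GRing.LSemiModule_isLSemiAlgebra.Build k (nz_leavitt nz) (@leavitt_scaleAl k F).
HB.instance Definition _ :=
  GRing.LSemiAlgebra_isSemiAlgebra.Build k (nz_leavitt nz) (@leavitt_scaleAr k F).
End NonzeroLeavitt.

Section LeavittMorphism.
Variables (k : fieldType) (E F : digraph).
Local Notation LE := (leavitt_path_algebra k E).
Local Notation LF := (leavitt_path_algebra k F).

(** When L(F) is zero the zero map is a unital homomorphism; otherwise the
    universal property applies. *)
Lemma leavitt_morphism (V' : vertex E -> LF) (D' G' : edge E -> LF) :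
    leavitt_family V' D' G' -> \sum_v V' v = 1 ->
    (forall v, gr_part 0 (V' v)) -> (forall e, gr_part 1 (D' e)) ->
    (forall e, gr_part (-1) (G' e)) ->
  exists psi : grRHom LE LF, forall v, psi (vtx k v) = V' v.
Proof.
move=> fam V1 V0 D1 G1.
have [f [fD fM fZ [[f1 fpart] fv]]] : exists f : leavitt k E -> leavitt k F,
  [/\ {morph f : x y / x + y}, {morph f : x y / x * y},
      forall c, {morph f : x / c *: x},
      f 1 = 1 /\ (forall g, @gr_part LF (gdeg g) (f (l_gen k g)))
    & forall v, f (l_vertex k v) = V' v].
  have [z|nz] := eqVneq (1 : leavitt k F) 0.
    have all0 (x : leavitt k F) : x = 0 by rewrite -[x]mul1r z mul0r.
    exists (fun=> 0); split=> [x y|x y|c x||v]; rewrite ?[RHS]all0 //.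
    by split=> [|g]; [exact/esym/all0|apply: grading0 (gr_grading LF) _].
  have [f [[fD fM fZ [fv fe fg]] _]] := @leavitt_universal k E (nz_leavitt nz) V' D' G' fam.
  exists f; split=> //; split=> [|[v|e|e]] /=.
  - rewrite -l_vertex_sum; have f0 : f 0 = 0 by apply: (addrI (f 0)); rewrite -fD !addr0.
    rewrite (big_morph f fD f0) -V1; by apply: eq_bigr => v _; rewrite fv.
  - by have := V0 v; rewrite -fv.
  - by have := D1 e; rewrite -fe.
  - by have := G1 e; rewrite -fg.
have f0 : f 0 = 0 by apply: (addrI (f 0)); rewrite -fD !addr0.
have fN x : f (- x) = - f x by apply/eqP; rewrite -addr_eq0 -fD addNr f0.
have fB : {morph (f : LE -> LF) : x y / x - y} by move=> x y; rewrite fD fN.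
pose fa := GRing.isZmodMorphism.Build LE LF f fB.
pose fm := GRing.isMonoidMorphism.Build LE LF f (f1, fM).
pose fr : {rmorphism LE -> LF} := HB.pack_for {rmorphism LE -> LF} (f : LE -> LF) fa fm.
have fdeg n x : @gr_part LE n x -> @gr_part LF n (fr x).
  move=> [s [sn ->]]; rewrite (big_morph fr (rmorphD fr) (rmorph0 fr)) big_seq.
  elim/big_ind: _ => [|y z|[c w] cw]; first exact: leavitt_part0.
    exact: leavitt_partD.
  rewrite -[fr _]/(f _) fZ; apply: leavitt_partZ; rewrite -(sn _ cw) /= {cw}.
  elim: w => [|g w IH]; rewrite /l_word /wdeg ?big_nil ?big_cons.
    by rewrite f1; apply: leavitt_part_one.
  by rewrite fM; apply: leavitt_part_mul IH; apply: fpart.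
by exists (GrRHom fdeg).
Qed.

End LeavittMorphism.

(** * A Leavitt family from direct sum decompositions *)

(** The endomorphisms of T as a right module are the left multiplications by
    elements of T. With T = \oplus_v Q_v and Q_v = \oplus_(src e = v) Q_r(e)(-1),
    the vertex v becomes the projection onto Q_v, and the edge e the composite of
    the projection T -> Q_r(e) and the injection Q_r(e) -> Q_src(e) -> T. The latter
    has degree 1, because Q_r(e) and Q_r(e)(-1) have the same elements and their
    degrees differ by 1. *)
Section DirectSumFamily.
Variables (T : grRing) (E : digraph) (Q : vertex E -> grMod T).
Variables (inj : forall v, grHom (Q v) (regularM T)) (prj : forall v, grHom (regularM T) (Q v)).
Hypothesis sumT : direct_sum (enum (vertex E)) inj prj.
Local Notation Q1 e := (shiftM (-1) (Q (rng e))).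
Local Notation out v := [seq e <- enum (edge E) | src e == v].
Variables (einj : forall v e, grHom (Q1 e) (Q v)) (eprj : forall v e, grHom (Q v) (Q1 e)).
Hypothesis sumQ : forall v, direct_sum (out v) (einj v) (eprj v).

Definition fam_vertex v : T := inj v (prj v (1 : T)).
Definition fam_edge e : T :=
  inj (src e) (einj (src e) e (prj (rng e) (1 : T) : Q1 e)).
Definition fam_ghost e : T :=
  inj (rng e) (eprj (src e) e (prj (src e) (1 : T)) : Q (rng e)).

Lemma hom_regM N (f : grHom (regularM T) N) (t : T) : f (1 : T) <* t = f t.
Proof. exact/esym/hom_reg. Qed.

Lemma fam_vertexM v (t : T) : fam_vertex v * t = inj v (prj v t).
Proof.
by rewrite -[LHS](hom_ract (inj v) (prj v (1 : T)) t) hom_regM.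
Qed.

Lemma fam_edgeM e (t : T) :
  fam_edge e * t = inj (src e) (einj (src e) e (prj (rng e) t : Q1 e)).
Proof.
rewrite -[LHS](hom_ract (inj (src e)) (einj (src e) e (prj (rng e) (1 : T) : Q1 e)) t).
by rewrite -hom_ract -[in RHS]hom_regM.
Qed.

Lemma fam_ghostM e (t : T) :
  fam_ghost e * t = inj (rng e) (eprj (src e) e (prj (src e) t) : Q (rng e)).
Proof.
rewrite -[LHS](hom_ract (inj (rng e)) (eprj (src e) e (prj (src e) (1 : T)) : Q (rng e)) t).
rewrite -[in RHS]hom_regM [in RHS]hom_ract; exact: erefl.
Qed.

Lemma prj_inj v (x : Q v) : prj v (inj v x) = x.
Proof. by case: sumT => -> _ _ _; rewrite mem_enum deltaHom_id. Qed.

Lemma prj_inj0 v w (x : Q w) : v != w -> prj v (inj w x) = 0.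
Proof. by case: sumT => -> _ _ _ vw; rewrite mem_enum deltaHom_neq // eq_sym. Qed.

Lemma eprj_einj e (x : Q1 e) : eprj (src e) e (einj (src e) e x) = x.
Proof. by case: (sumQ (src e)) => -> _ _ _; rewrite mem_filter eqxx mem_enum deltaHom_id. Qed.

Lemma eprj_einj0 v e f (x : Q1 f) : e != f -> eprj v e (einj v f x) = 0.
Proof.
case: (sumQ v) => -> _ _ _ ef.
by case: ifP => // _; rewrite deltaHom_neq // eq_sym.
Qed.

(** Every product is computed as a composite of maps; an injection meets a
    projection in the middle and they give a Kronecker delta. The relation for v is
    that Q_v is the sum of its summands. *)
Lemma fam_leavitt : leavitt_family fam_vertex fam_edge fam_ghost.
Proof.
split.
- split=> [v|v w /eqP vw]; rewrite fam_vertexM /fam_vertex; first by rewrite prj_inj.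
  by rewrite prj_inj0 // hom0.
- by move=> e; rewrite fam_vertexM fam_edgeM /fam_vertex /fam_edge !prj_inj.
- by move=> e; rewrite fam_vertexM fam_ghostM /fam_vertex /fam_ghost !prj_inj.
- split=> [e|e f /eqP ef]; rewrite fam_ghostM /fam_edge.
    by rewrite prj_inj eprj_einj.
  have [es|es] := eqVneq (src e) (src f).
    by rewrite -es prj_inj eprj_einj0 // hom0.
  by rewrite prj_inj0 // !hom0.
- move=> v _; rewrite /fam_vertex.
  have [_ _ _ full] := sumQ v.
  rewrite [X in inj v X]full hom_sum big_filter big_enum_cond /=.
  apply: eq_bigr => e /eqP <-.
  by rewrite fam_edgeM /fam_ghost prj_inj.
Qed.

Lemma fam_vertex_sum : \sum_v fam_vertex v = 1.
Proof. by have [_ _ _ /(_ (1 : T)) ->] := sumT; rewrite big_enum. Qed.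

Lemma fam_vertex_part v : gr_part 0 (fam_vertex v).
Proof. exact: (hom_deg (inj v) (hom_deg (prj v) (gr_one T))). Qed.

Lemma fam_edge_part e : gr_part 1 (fam_edge e).
Proof.
apply: (hom_deg (inj _)); apply: (hom_deg (einj _ _)).
by rewrite /= /shift_part addNr; exact: (hom_deg (prj (rng e)) (gr_one T)).
Qed.

Lemma fam_ghost_part e : gr_part (-1) (fam_ghost e).
Proof.
apply: (hom_deg (inj _)).
have := hom_deg (eprj (src e) e) (hom_deg (prj (src e)) (gr_one T)).
by rewrite /= /shift_part addr0.
Qed.

End DirectSumFamily.

(** * Extension of scalars *)

Section Tensor.
Variables (T T' : grRing) (psi : grRHom T T').

(** The inverse isomorphisms are x (x) t |-> p (psi(x) t) and
    q |-> a (x) i q. *)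
Lemma tensor_corner (a : T) (a_part : gr_part 0 a) (a_idem : a * a = a) (Q : grMod T')
    (i : grHom Q (regularM T')) (p : grHom (regularM T') Q) :
    (forall q, p (i q) = q) -> (forall t : T', i (p t) = psi a * t) ->
  grIso (tensorM psi (cornerM a_part)) Q.
Proof.
move=> ip pi; pose C := cornerM a_part.
have [f fE] : exists f : grHom C (resM psi Q), forall x, f x = p (psi (corner_out x)).
  apply: (hom_exists (f := fun x : C => p (psi (corner_out x)) : resM psi Q)).
  - by move=> x y; rewrite corner_outD rmorphD homD.
  - by move=> x t; rewrite corner_out_ract rmorphM; apply: (hom_ract p (psi (corner_out x) : regularM T') (psi t)).
  - by move=> n x Cx; apply: (hom_deg p); apply: rhom_deg.
pose e : C := corner_in a_part a_idem 1.
have [g gE] : exists g : grHom Q (tensorM psi C), forall q, g q = tens psi e (i q).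
  apply: (hom_exists (f := fun q => tens psi e (i q) : tensorM psi C)).
  - by move=> x y; rewrite homD tensDr.
  - by move=> x t; rewrite hom_ract; exact: esym (tens_act psi e (i x : T') t).
  - move=> n q Cq; apply: (@tpart_tens _ _ _ _ n 0 n); last by rewrite add0r.
      by rewrite /= /corner_part /= mulr1.
    exact: (hom_deg i).
exists (tens_ext f), g; split.
  apply: (tens_hom_eq (f := compHom g (tens_ext f)) (g := idHom _)) => x.
  rewrite compHomE tens_extE -[_ *: _]/((f x : Q) <* 1) ract1 gE fE pi.
  rewrite -[corner_out x in LHS](corner_valP x) -rmorphM mulrA a_idem.
  rewrite -[psi _]mulr1 -tens_bal; congr (tens psi _ _); apply: val_inj.
  by rewrite -[LHS]/(a * 1 * (a * corner_out x)) mulr1 mulrA a_idem; apply: corner_valP.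
move=> q; rewrite gE tens_extE fE -[LHS](hom_ract p).
by rewrite -[X in p X]/(psi (a * 1) * i q) mulr1 -pi !ip.
Qed.

(** Both maps are the identity on symbols x (x) t; they are built separately as
    the tensor products for X and X(n) are distinct types. *)
Lemma tensor_shift n (X : grMod T) :
  grIso (tensorM psi (shiftM n X)) (shiftM n (tensorM psi X)).
Proof.
have [f fE] : exists f : grHom (shiftM n X) (resM psi (shiftM n (tensorM psi X))),
    forall x, f x = tens psi (x : X) 1.
  have := hom_exists (M := shiftM n X) (N := resM psi (shiftM n (tensorM psi X)))
    (f := fun x => tens psi (x : X) 1); apply.
  - by move=> x y; rewrite tensDl.
  - move=> x t; rewrite -[LHS]/(tens psi ((t : T^c) *: (x : X)) 1) tens_bal mulr1.
    by rewrite [RHS](tens_act psi (x : X) 1 (psi t)) mul1r.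
  - by move=> m x Cx; exact: (@tpart_tens _ _ psi X (n + m) (n + m) 0 x 1 Cx (gr_one T') (addr0 _)).
have [g gE] : exists g : grHom X (resM psi (shiftM (- n) (tensorM psi (shiftM n X)))),
    forall x, g x = tens psi (x : shiftM n X) 1.
  have := hom_exists (M := X) (N := resM psi (shiftM (- n) (tensorM psi (shiftM n X))))
    (f := fun x => tens psi (x : shiftM n X) 1); apply.
  - by move=> x y; rewrite -tensDl.
  - move=> x t; rewrite -[LHS]/(tens psi ((t : T^c) *: (x : shiftM n X)) 1) tens_bal mulr1.
    by rewrite [RHS](tens_act psi (x : shiftM n X) 1 (psi t)) mul1r.
  - move=> m x Cx; have Cx' : @gm_part T (shiftM n X) (- n + m) x.
      by rewrite /= /shift_part addrA subrr add0r.
    exact: (@tpart_tens _ _ psi (shiftM n X) (- n + m) (- n + m) 0 x 1 Cx' (gr_one T') (addr0 _)).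
have [G GE] : exists G : grHom (shiftM n (tensorM psi X)) (tensorM psi (shiftM n X)),
    forall y, G y = tens_ext g y.
  apply: hom_exists.
  - by move=> x y; apply: homD (tens_ext g) x y.
  - by move=> x t; apply: hom_ract (tens_ext g) x t.
  - move=> m x Cx; have := hom_deg (tens_ext g) Cx.
    by rewrite /= /shift_part addrA addNr add0r.
exists (tens_ext f), G; split.
  apply: (tens_hom_eq (f := compHom G (tens_ext f)) (g := idHom _)) => x.
  by rewrite compHomE tens_extE fE GE scale1r tens_extE gE scale1r.
move=> y; rewrite GE.
elim/tens_ind: y => [|x y IHx IHy|x t].
- by rewrite (hom0 (tens_ext g)) (hom0 (tens_ext f)).
- by rewrite (homD (tens_ext g)) (homD (tens_ext f)) IHx IHy.
have -> : tens_ext g (tens psi x t) = tens psi (x : shiftM n X) t.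
  by rewrite tens_extE gE [LHS](tens_act psi (x : shiftM n X) 1 t) mul1r.
by rewrite tens_extE fE [LHS](tens_act psi (x : X) 1 t) mul1r.
Qed.

Lemma k0_mapD x y : k0_map psi (k0_add x y) = k0_add (k0_map psi x) (k0_map psi y).
Proof.
elim/k0_ind: x => a b; elim/k0_ind: y => c d.
by rewrite (k0_addE a b c d) !(k0_mapE psi) k0_addE !v_mapD.
Qed.

Lemma k0_map_shift n x : k0_map psi (k0_shift n x) = k0_shift n (k0_map psi x).
Proof.
have H a : v_map psi (v_shift n a) = v_shift n (v_map psi a).
  rewrite -(v_reprK a) v_shiftE !v_mapE v_shiftE; apply/v_classP.
  exact: tensor_shift.
by elim/k0_ind: x => a b; rewrite k0_shiftE !k0_mapE k0_shiftE !H.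
Qed.

End Tensor.

(** * Lifting alpha *)

Theorem corollary4p6 (k : fieldType) (E F : digraph)
    (hE : no_sinks E) (hF : no_sinks F)
    (alpha : K0gr (leavitt_path_algebra k E) -> K0gr (leavitt_path_algebra k F))
    (alpha_pos : is_order_preserving alpha)
    (alpha_pointed : is_pointed alpha)
    (alpha_linear : is_laurent_linear alpha) :
  exists psi : grRHom (leavitt_path_algebra k E) (leavitt_path_algebra k F),
    k0_map psi =1 alpha.
Proof.
have [aD aS] := (is_laurent_linearP alpha).1 alpha_linear.
have posP v : exists Q, alpha (k0_class (vertex_proj k v)) = k0_class Q.
  by apply: alpha_pos; exists (vertex_proj k v).
pose Q v := projT1 (cid (posP v)).
have QE v : alpha (k0_class (vertex_proj k v)) = k0_class (Q v) := projT2 (cid (posP v)).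
have regE : k0_class (regularP (leavitt_path_algebra k F)) =
    k0_sum (enum (vertex E)) (fun v => k0_class (Q v)).
  rewrite -alpha_pointed (k0_regular k E) (k0_additive_sum aD).
  exact: eq_k0_sum QE.
have outE v : k0_class (Q v) = k0_sum [seq e <- enum (edge E) | src e == v]
    (fun e => k0_class (shiftP (-1) (Q (rng e)))).
  rewrite -QE (k0_vertex_proj k hE) (k0_additive_sum aD); apply: eq_k0_sum => e.
  by rewrite aS QE k0_class_shift.
have [inj [prj sumT]] := direct_sum_k0 hF (enum_uniq (vertex E)) regE.
have outP v := direct_sum_k0 hF (filter_uniq _ (enum_uniq (edge E))) (outE v).
pose einj v := projT1 (cid (outP v)).
pose eprj v := projT1 (cid (projT2 (cid (outP v)))).
have sumQ v : direct_sum _ (einj v) (eprj v) := projT2 (cid (projT2 (cid (outP v)))).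
have [psi psiV] := leavitt_morphism (fam_leavitt sumT sumQ) (fam_vertex_sum sumT)
  (fam_vertex_part inj prj) (fam_edge_part inj prj einj) (fam_ghost_part inj prj eprj).
exists psi; apply: (k0_additive_eq hE) => //.
- exact: k0_mapD.
- exact: k0_map_shift.
move=> v; rewrite k0_map_class QE; apply: k0_class_iso.
have vE (t : leavitt_path_algebra k F) : inj v (prj v t) = psi (vtx k v) * t.
  by rewrite psiV fam_vertexM.
exact: (tensor_corner (vtx_part k v) (vtx_idem k v) (prj_inj sumT (v := v)) vE).
Qed.
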